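(* Let $b>0$, $\tau>0$, $\Omega=(-b,b)\times(0,\tau)$, let $q\in C[-b,b]$ be complex valued, and let the functions $u_n$, $n\in\mathbb{N}_0$ (transmuted heat polynomials) be as defined in the context. Let $u(x,t)$ be continuous in $\bar\Omega$ and satisfy $$u_{xx}(x,t)-q(x)u(x,t)=u_t(x,t)$$ in $\Omega$ (in the classical sense). Then for every $\varepsilon>0$ there exist $N\in\mathbb{N}$ and (complex) constants $a_0,a_1,\ldots,a_N$ such that $$\max_{(x,t)\in\bar\Omega}\left|u(x,t)-\sum_{n=0}^{N}a_n u_n(x,t)\right|<\varepsilon.$$
   Context: Functions are complex valued. Satisfying the equation in the classical sense means that $u_{xx}$ and $u_t$ exist and are continuous in $\Omega$ and the equation holds pointwise there. The function $f$ is a (complex valued) solution of $f''-q(x)f=0$ with $f(0)=1$ and $f'(0)=\alpha$, where $\alpha\in\mathbb{C}$, nonvanishing on $[-b,b]$. Recurrent integrals: define $X^{(0)}\equiv 1$, $\tilde X^{(0)}\equiv 1$ and, for $n\in\mathbb{N}$ and $x\in[-b,b]$, $$X^{(n)}(x)=n\int_0^x X^{(n-1)}(s)\,\bigl(f^2(s)\bigr)^{(-1)^n}ds,\qquad \tilde X^{(n)}(x)=n\int_0^x \tilde X^{(n-1)}(s)\,\bigl(f^2(s)\bigr)^{(-1)^{n-1}}ds.$$ Formal powers associated with $f$: $\varphi_k(x)=f(x)X^{(k)}(x)$ if $k$ is odd, and $\varphi_k(x)=f(x)\tilde X^{(k)}(x)$ if $k$ is even, $k=0,1,2,\ldots$ Transmuted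 heat polynomials: for $n\in\mathbb{N}_0$, $$u_n(x,t)=n!\sum_{k=0}^{[n/2]}\frac{t^k\,\varphi_{n-2k}(x)}{k!\,(n-2k)!},$$ where $[n/2]$ denotes the integer part of $n/2$. *)

(* Defs.v *)
From Stdlib Require Export Reals Factorial.
From Coquelicot Require Export Coquelicot.

Open Scope R_scope.

(** Functions R -> C are differentiated and integrated with C seen as a normed
    space over R, i.e. with [C_R_NormedModule] / [C_R_CompleteNormedModule]. *)

Definition segment (b : R) : R -> Prop := fun x => -b <= x <= b.

Definition Omega (b tau : R) : R * R -> Prop :=
  fun p => -b < fst p < b /\ 0 < snd p < tau.

Definition Omega_bar (b tau : R) : R * R -> Prop :=
  fun p => -b <= fst p <= b /\ 0 <= snd p <= tau.

(** Derivative relative to [D]: two-sided at interior points of a segment [D],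
    one-sided at its endpoints. *)
Definition is_derive_within (D : R -> Prop) (g : R -> C) (x : R) (l : C) : Prop :=
  filterdiff (K := R_AbsRing) (U := R_NormedModule) (V := C_R_NormedModule)
    g (within D (locally x)) (fun y : R => scal (V := C_R_NormedModule) y l).

(** Solution on the closed segment of [f'' - q f = 0], [f 0 = 1], [f' 0 = alpha]. *)
Definition ode_solution (b : R) (q : R -> C) (alpha : C) (f : R -> C) : Prop :=
  exists f' f'' : R -> C,
    (forall x, segment b x -> is_derive_within (segment b) f x (f' x)) /\
    (forall x, segment b x -> is_derive_within (segment b) f' x (f'' x)) /\
    (forall x, segment b x -> (f'' x - q x * f x)%C = RtoC 0) /\
    f 0 = RtoC 1 /\
    f' 0 = alpha.

(** [(f^2)^((-1)^n)] *)
Definition sq_weight (f : R -> C) (n : nat) (s : R) : C :=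
  if Nat.even n then (f s ^ 2)%C else (/ (f s ^ 2))%C.

Fixpoint X (f : R -> C) (n : nat) (x : R) : C :=
  match n with
  | O => RtoC 1
  | S m => (RtoC (INR n) *
      RInt (V := C_R_CompleteNormedModule)
        (fun s => (X f m s * sq_weight f n s)%C) 0 x)%C
  end.

Fixpoint Xtilde (f : R -> C) (n : nat) (x : R) : C :=
  match n with
  | O => RtoC 1
  | S m => (RtoC (INR n) *
      RInt (V := C_R_CompleteNormedModule)
        (fun s => (Xtilde f m s * sq_weight f (n - 1) s)%C) 0 x)%C
  end.

Definition formal_power (f : R -> C) (k : nat) (x : R) : C :=
  if Nat.odd k then (f x * X f k x)%C else (f x * Xtilde f k x)%C.

Definition transmuted_heat_poly (f : R -> C) (n : nat) (x t : R) : C :=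
  (RtoC (INR (fact n)) *
   sum_n (fun k : nat =>
     RtoC (t ^ k) * formal_power f (n - 2 * k) x
       / (RtoC (INR (fact k)) * RtoC (INR (fact (n - 2 * k)))))
     (n / 2)%nat)%C.

(** Only the values of [ux], [uxx], [ut] in the open set [Omega] matter. *)
Definition classical_solution (b tau : R) (q : R -> C) (u : R -> R -> C) : Prop :=
  exists ux uxx ut : R -> R -> C,
    (forall x t, Omega b tau (x, t) ->
       is_derive (K := R_AbsRing) (V := C_R_NormedModule)
         (fun y => u y t) x (ux x t) /\
       is_derive (K := R_AbsRing) (V := C_R_NormedModule)
         (fun y => ux y t) x (uxx x t) /\
       is_derive (K := R_AbsRing) (V := C_R_NormedModule)
         (fun s => u x s) t (ut x t)) /\
    continuous_on (Omega b tau) (fun p : R * R => uxx (fst p) (snd p)) /\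
    continuous_on (Omega b tau) (fun p : R * R => ut (fst p) (snd p)) /\
    (forall x t, Omega b tau (x, t) -> (uxx x t - q x * u x t)%C = ut x t).

Definition is_max_on (D : R * R -> Prop) (g : R * R -> R) (M : R) : Prop :=
  (exists p, D p /\ g p = M) /\ (forall p, D p -> g p <= M).

(* Main.v *)
Require Import Defs.
From Stdlib Require Import Lra Lia Psatz.

(** The modulus of a solution is controlled by its values on the parabolic
    boundary: at an interior maximum of [exp (- 2 (Q + 1) t) |v|^2], with [Q] a
    bound for [|q|], the equation is violated. So it suffices that the
    transmuted heat polynomials are dense in the continuous functions on the
    parabolic boundary. Their generating series in [mu] are the solutions
    [exp (mu t) y(x)] with [y'' = (q + mu) y], and the Dirichlet problem for [y]
    is solvable when [mu] stays away from the spectrum of the case [q = 0].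
    Large real [mu] and the Weierstrass theorem in the variable [exp (mu t)]
    give arbitrary lateral values. Initial values [g] vanishing at [-b] and [b]
    come from averaging [mu exp (mu t) y_mu(x)] over a large circle, where [y_mu]
    is the resolvent applied to [g] minus the solution of the inhomogeneous
    equation with zero Cauchy data at [0]. The latter is entire in [mu], so that
    replacing the circle by roots of unity makes its average negligible. *)

(** The obstacle is that the polynomials carry Cauchy data at [x = 0], while their values are to be
    controlled at [-b] and [b]. Up to factorials they are the coefficients of the powers of [mu] in
    [exp (mu t) y] with [y = (1 - mu J)^-1 h], where [J] inverts [y'' - q y] with zero Cauchy data
    at [0] and [h] runs through the solutions of [h'' = q h]. These [y] form a two-parameter family,
    which matches the two Dirichlet values. As [q] is complex, the operator need not be
    self-adjoint; the bounds come from the explicit Green function for [q = 0], with [q y] absorbed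
    as a perturbation when [mu] is large. The averaging works since [mu (mu - L)^-1 g] tends to [g]
    for [L g = g'' - q g], and since the resolvent part vanishes at [-b] and [b]: on the sides only
    the average of the entire part is left. The radius of the circle is fixed by the resolvent
    error, and only then is the number of roots of unity chosen, from the Taylor tail on that
    circle. *)

Notation Cder := (is_derive (K := R_AbsRing) (V := C_R_NormedModule)).
Notation CRInt := (RInt (V := C_R_CompleteNormedModule)).

(** A sum by [sum_n] is typed in a carrier of the algebraic hierarchy; the equation is recast in
    [C], where [ring] knows the structure. *)
Ltac cring := lazymatch goal with |- @eq _ ?a ?c => change (@eq C a c); first [ring | symmetry; ring] end.

(** * Continuity and differentiation of complex valued functions *)

Lemma sum_n_S_C (a : nat -> C) (n : nat) : sum_n a (S n) = (sum_n a n + a (S n))%C :> C.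
Proof. apply (sum_Sn (G := C_AbelianMonoid)). Qed.

Lemma sum_n_0_C (a : nat -> C) : sum_n a 0 = a 0%nat :> C.
Proof. apply (sum_O (G := C_AbelianMonoid)). Qed.

Lemma continuous_pair_C {U : UniformSpace} (f g : U -> R) (x : U) :
  continuous f x -> continuous g x -> continuous (fun y => (f y, g y) : C) x.
Proof.
  intros Hf Hg P [eps HP].
  generalize (Hf _ (locally_ball (f x) eps)) (Hg _ (locally_ball (g x) eps)).
  intros H1 H2. unfold filtermap in *.
  generalize (filter_and _ _ H1 H2). apply filter_imp.
  intros y [A B]. apply HP. split; [exact A | exact B].
Qed.

Lemma continuous_fst_C {U : UniformSpace} (f : U -> C) (x : U) :
  continuous f x -> continuous (fun y => fst (f y)) x.
Proof.
  intros Hf. apply (continuous_comp f (fun z : C => fst z) x Hf).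
  apply (continuous_fst (U := R_UniformSpace) (V := R_UniformSpace)).
Qed.

Lemma continuous_snd_C {U : UniformSpace} (f : U -> C) (x : U) :
  continuous f x -> continuous (fun y => snd (f y)) x.
Proof.
  intros Hf. apply (continuous_comp f (fun z : C => snd z) x Hf).
  apply (continuous_snd (U := R_UniformSpace) (V := R_UniformSpace)).
Qed.

Lemma continuous_C_ext {U : UniformSpace} (f g : U -> C) (x : U) :
  (forall y, f y = g y) -> continuous f x -> continuous g x.
Proof. intros E. apply continuous_ext. exact E. Qed.

Lemma continuous_Cplus {U : UniformSpace} (f g : U -> C) (x : U) :
  continuous f x -> continuous g x -> continuous (fun y => (f y + g y)%C) x.
Proof.
  intros Hf Hg. unfold Cplus. apply continuous_pair_C;
  apply (continuous_plus (V := R_NormedModule)); auto using continuous_fst_C, continuous_snd_C.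
Qed.

Lemma continuous_Copp {U : UniformSpace} (f : U -> C) (x : U) :
  continuous f x -> continuous (fun y => (- f y)%C) x.
Proof.
  intros Hf. unfold Copp. apply continuous_pair_C;
  apply (continuous_opp (V := R_NormedModule)); auto using continuous_fst_C, continuous_snd_C.
Qed.

Lemma continuous_Cminus {U : UniformSpace} (f g : U -> C) (x : U) :
  continuous f x -> continuous g x -> continuous (fun y => (f y - g y)%C) x.
Proof. intros Hf Hg. apply continuous_Cplus; auto using continuous_Copp. Qed.

Lemma continuous_Rmult {U : UniformSpace} (f g : U -> R) (x : U) :
  continuous f x -> continuous g x -> continuous (fun y => f y * g y) x.
Proof. apply (continuous_mult (K := R_AbsRing)). Qed.

Lemma continuous_Cmult {U : UniformSpace} (f g : U -> C) (x : U) :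
  continuous f x -> continuous g x -> continuous (fun y => (f y * g y)%C) x.
Proof.
  intros Hf Hg. unfold Cmult. apply continuous_pair_C;
  [apply (continuous_minus (V := R_NormedModule)) | apply (continuous_plus (V := R_NormedModule))];
  apply continuous_Rmult; auto using continuous_fst_C, continuous_snd_C.
Qed.

Lemma continuous_RtoC {U : UniformSpace} (f : U -> R) (x : U) :
  continuous f x -> continuous (fun y => RtoC (f y)) x.
Proof. intros Hf. apply continuous_pair_C; [exact Hf | apply continuous_const]. Qed.

Lemma continuous_Rcomp {U : UniformSpace} (f : U -> R) (g : R -> R) (x : U) :
  continuous f x -> continuity_pt g (f x) -> continuous (fun y => g (f y)) x.
Proof.
  intros Hf Hg. apply (continuous_comp f g x Hf).
  apply continuity_pt_filterlim. exact Hg.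
Qed.

Lemma continuous_sqnorm {U : UniformSpace} (f : U -> C) (x : U) :
  continuous f x -> continuous (fun y => fst (f y) ^ 2 + snd (f y) ^ 2) x.
Proof.
  intros Hf. apply (continuous_plus (V := R_NormedModule)).
  - apply (continuous_Rcomp (fun y => fst (f y)) (fun z => z ^ 2)).
    now apply continuous_fst_C. apply derivable_continuous_pt, derivable_pt_pow.
  - apply (continuous_Rcomp (fun y => snd (f y)) (fun z => z ^ 2)).
    now apply continuous_snd_C. apply derivable_continuous_pt, derivable_pt_pow.
Qed.

Lemma continuous_Cmod {U : UniformSpace} (f : U -> C) (x : U) :
  continuous f x -> continuous (fun y => Cmod (f y)) x.
Proof.
  intros Hf. unfold Cmod.
  apply (continuous_Rcomp (fun y => fst (f y) ^ 2 + snd (f y) ^ 2) sqrt).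
  - now apply continuous_sqnorm.
  - apply continuity_pt_sqrt. nra.
Qed.

Lemma continuous_Cinv {U : UniformSpace} (f : U -> C) (x : U) :
  f x <> RtoC 0 -> continuous f x -> continuous (fun y => (/ f y)%C) x.
Proof.
  intros Hn Hf. unfold Cinv.
  assert (D : continuous (fun y => / (fst (f y) ^ 2 + snd (f y) ^ 2)) x).
  { apply (continuous_Rcomp (fun y => fst (f y) ^ 2 + snd (f y) ^ 2) Rinv).
    - now apply continuous_sqnorm.
    - apply continuity_pt_inv. apply continuity_pt_id.
      intros H. apply Hn. destruct (f x) as [a c]; simpl in H.
      assert (a = 0) by nra. assert (c = 0) by nra. subst. reflexivity. }
  apply continuous_pair_C; apply continuous_Rmult; auto using continuous_fst_C.
  apply (continuous_opp (V := R_NormedModule)). auto using continuous_snd_C.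
Qed.

Lemma continuous_csum {U : UniformSpace} (a : nat -> U -> C) (n : nat) (x : U) :
  (forall k, continuous (a k) x) -> continuous (fun y => sum_n (fun k => a k y) n) x.
Proof.
  intros H. induction n as [|n IH].
  - apply (continuous_C_ext (a 0%nat)); [intros; now rewrite sum_n_0_C | apply H].
  - apply (continuous_C_ext (fun y => (sum_n (fun k => a k y) n + a (S n) y)%C)).
    intros; now rewrite sum_n_S_C. now apply continuous_Cplus.
Qed.

Lemma Cder_fst (f : R -> C) (x : R) (l : C) :
  Cder f x l -> is_derive (fun y => fst (f y)) x (fst l).
Proof.
  intros H. unfold is_derive in *.
  apply (filterdiff_comp' (U := R_NormedModule) (V := C_R_NormedModule) (W := R_NormedModule)
    f (fun z => fst z) x _ (fun z => fst z) H).
  apply filterdiff_linear. apply (is_linear_fst (U := R_NormedModule) (V := R_NormedModule)).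
Qed.

Lemma Cder_snd (f : R -> C) (x : R) (l : C) :
  Cder f x l -> is_derive (fun y => snd (f y)) x (snd l).
Proof.
  intros H. unfold is_derive in *.
  apply (filterdiff_comp' (U := R_NormedModule) (V := C_R_NormedModule) (W := R_NormedModule)
    f (fun z => snd z) x _ (fun z => snd z) H).
  apply filterdiff_linear. apply (is_linear_snd (U := R_NormedModule) (V := R_NormedModule)).
Qed.

Lemma Cder_ext (f g : R -> C) (x : R) (l m : C) :
  (forall y, f y = g y) -> l = m -> Cder f x l -> Cder g x m.
Proof. intros E -> H. apply (is_derive_ext f); auto. Qed.

Lemma Cder_pair (f g : R -> R) (x : R) (l m : R) :
  is_derive f x l -> is_derive g x m -> Cder (fun y => (f y, g y)) x (l, m).
Proof.
  intros Hf Hg.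
  apply (is_derive_ext (K := R_AbsRing) (V := C_R_NormedModule)
    (fun y => plus (scal (f y) ((1, 0) : C_R_NormedModule)) (scal (g y) ((0, 1) : C_R_NormedModule)))).
  { intros y. unfold plus, scal; simpl. unfold prod_plus, prod_scal; simpl.
    unfold plus, scal, mult; simpl. unfold mult; simpl. f_equal; ring. }
  assert (E : ((l, m) : C_R_NormedModule) =
    plus (scal l ((1, 0) : C_R_NormedModule)) (scal m ((0, 1) : C_R_NormedModule))).
  { unfold plus, scal; simpl. unfold prod_plus, prod_scal; simpl.
    unfold plus, scal, mult; simpl. unfold mult; simpl. f_equal; ring. }
  rewrite E. apply (is_derive_plus (K := R_AbsRing) (V := C_R_NormedModule));
  apply (is_derive_scal_l (K := R_AbsRing) (V := C_R_NormedModule)); assumption.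
Qed.

Lemma Cder_of_components (f : R -> C) (x : R) (l : C) :
  is_derive (fun y => fst (f y)) x (fst l) -> is_derive (fun y => snd (f y)) x (snd l) ->
  Cder f x l.
Proof.
  intros H1 H2. generalize (Cder_pair _ _ _ _ _ H1 H2).
  apply Cder_ext; [intros; now destruct (f y) | now destruct l].
Qed.

Lemma Cder_const (c : C) (x : R) : Cder (fun _ => c) x (RtoC 0).
Proof. apply (is_derive_const (K := R_AbsRing) (V := C_R_NormedModule)). Qed.

Lemma Cder_plus (f g : R -> C) (x : R) (l m : C) :
  Cder f x l -> Cder g x m -> Cder (fun y => (f y + g y)%C) x (l + m)%C.
Proof. apply (is_derive_plus (K := R_AbsRing) (V := C_R_NormedModule)). Qed.

Lemma is_derive_Rmult (f g : R -> R) (x l m : R) :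
  is_derive f x l -> is_derive g x m -> is_derive (fun y => f y * g y) x (l * g x + f x * m).
Proof.
  intros Hf Hg. apply (is_derive_mult f g x l m Hf Hg). intros; apply Rmult_comm.
Qed.

Lemma is_derive_Rext (f g : R -> R) (x l m : R) :
  (forall y, f y = g y) -> l = m -> is_derive f x l -> is_derive g x m.
Proof. intros E -> H. apply (is_derive_ext f); auto. Qed.

Lemma Cder_mult (f g : R -> C) (x : R) (l m : C) :
  Cder f x l -> Cder g x m -> Cder (fun y => (f y * g y)%C) x (l * g x + f x * m)%C.
Proof.
  intros Hf Hg.
  pose proof (Cder_fst _ _ _ Hf) as F1. pose proof (Cder_snd _ _ _ Hf) as F2.
  pose proof (Cder_fst _ _ _ Hg) as G1. pose proof (Cder_snd _ _ _ Hg) as G2.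
  apply Cder_of_components; unfold Cmult, Cplus; cbn [fst snd].
  - refine (is_derive_Rext _ _ _ _ _ _ _ (is_derive_minus _ _ _ _ _
      (is_derive_Rmult _ _ _ _ _ F1 G1) (is_derive_Rmult _ _ _ _ _ F2 G2))).
    reflexivity. unfold minus, plus, opp; simpl; ring.
  - refine (is_derive_Rext _ _ _ _ _ _ _ (is_derive_plus _ _ _ _ _
      (is_derive_Rmult _ _ _ _ _ F1 G2) (is_derive_Rmult _ _ _ _ _ F2 G1))).
    reflexivity. unfold minus, plus, opp; simpl; ring.
Qed.

Lemma Cder_scal (c : C) (f : R -> C) (x : R) (l : C) :
  Cder f x l -> Cder (fun y => (c * f y)%C) x (c * l)%C.
Proof.
  intros H. generalize (Cder_mult _ _ _ _ _ (Cder_const c x) H).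
  apply Cder_ext; [reflexivity | ring].
Qed.

Lemma Cder_minus (f g : R -> C) (x : R) (l m : C) :
  Cder f x l -> Cder g x m -> Cder (fun y => (f y - g y)%C) x (l - m)%C.
Proof. apply (is_derive_minus (K := R_AbsRing) (V := C_R_NormedModule)). Qed.

Lemma Cder_RtoC (f : R -> R) (x l : R) :
  is_derive f x l -> Cder (fun y => RtoC (f y)) x (RtoC l).
Proof.
  intros H. apply Cder_pair; auto. apply (is_derive_const (K := R_AbsRing) (V := R_NormedModule)).
Qed.

Lemma Cder_csum (a : nat -> R -> C) (d : nat -> C) (n : nat) (x : R) :
  (forall k, Cder (a k) x (d k)) ->
  Cder (fun y => sum_n (fun k => a k y) n) x (sum_n d n).
Proof.
  intros H. induction n as [|n IH].
  - apply (Cder_ext (a 0%nat) _ _ (d 0%nat)); try (intros; now rewrite sum_n_0_C). apply H.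
  - apply (Cder_ext (fun y => (sum_n (fun k => a k y) n + a (S n) y)%C) _ _ (sum_n d n + d (S n))%C);
      try (intros; now rewrite sum_n_S_C). now apply Cder_plus.
Qed.

Lemma Cder_continuous (f : R -> C) (x : R) (l : C) : Cder f x l -> continuous f x.
Proof.
  intros H. apply (ex_derive_continuous (V := C_R_NormedModule)). now exists l.
Qed.

Lemma Cder_ext_interval (f g : R -> C) (lo hi x : R) (l : C) :
  lo < x < hi -> (forall y, lo < y < hi -> f y = g y) -> Cder f x l -> Cder g x l.
Proof.
  intros Hx E. apply (is_derive_ext_loc (K := R_AbsRing) (V := C_R_NormedModule)).
  assert (O : locally x (fun y => lo < y < hi))
    by (apply (open_and (fun y : R => lo < y) (fun y : R => y < hi)); auto using open_gt, open_lt).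
  revert O. now apply filter_imp.
Qed.

Lemma Cder_unique (f : R -> C) (x : R) (l m : C) : Cder f x l -> Cder f x m -> l = m.
Proof.
  intros H1 H2.
  pose proof (is_derive_unique _ _ _ (Cder_fst _ _ _ H1)) as A1.
  pose proof (is_derive_unique _ _ _ (Cder_fst _ _ _ H2)) as A2.
  pose proof (is_derive_unique _ _ _ (Cder_snd _ _ _ H1)) as B1.
  pose proof (is_derive_unique _ _ _ (Cder_snd _ _ _ H2)) as B2.
  destruct l, m; simpl in *; congruence.
Qed.

Lemma Cder_zero_const (G : R -> C) (a c : R) :
  a <= c -> (forall x, continuous G x) ->
  (forall x, a < x < c -> Cder G x (RtoC 0)) -> G c = G a.
Proof.
  intros Hac Hc Hd.
  assert (K : forall p : R -> R, (forall x, continuous p x) ->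
    (forall x, a < x < c -> is_derive p x 0) -> p c = p a).
  { intros p Hp Hp'.
    destruct (MVT_gen p a c (fun _ => 0)) as [z [_ Hz]].
    - intros x. rewrite Rmin_left, Rmax_right by lra. apply Hp'.
    - intros x _. apply continuity_pt_filterlim. apply Hp.
    - lra. }
  pose proof (K (fun x => fst (G x)) (fun x => continuous_fst_C _ _ (Hc x))
    (fun x H => Cder_fst _ _ _ (Hd x H))) as E1.
  pose proof (K (fun x => snd (G x)) (fun x => continuous_snd_C _ _ (Hc x))
    (fun x H => Cder_snd _ _ _ (Hd x H))) as E2.
  simpl in *. destruct (G c), (G a); simpl in *; congruence.
Qed.

(** ** Primitives of continuous complex functions *)

Definition prim (h : R -> C) (x : R) : C := CRInt h 0 x.

Lemma prim_der (h : R -> C) (x : R) :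
  (forall y, continuous h y) -> Cder (prim h) x (h x).
Proof.
  intros Hh. apply (is_derive_RInt (V := C_R_NormedModule) h (prim h) 0 x).
  - apply filter_forall. intros y. apply (RInt_correct (V := C_R_CompleteNormedModule)).
    apply (ex_RInt_continuous (V := C_R_CompleteNormedModule)). intros; apply Hh.
  - apply Hh.
Qed.

Lemma prim_0 (h : R -> C) : prim h 0 = RtoC 0.
Proof. apply (RInt_point (V := C_R_CompleteNormedModule)). Qed.

Lemma prim_continuous (h : R -> C) (x : R) :
  (forall y, continuous h y) -> continuous (prim h) x.
Proof. intros Hh. eapply Cder_continuous. now apply prim_der. Qed.

Lemma prim_unique (h G : R -> C) :
  (forall y, continuous h y) -> (forall x, Cder G x (h x)) -> G 0 = RtoC 0 ->
  forall x, prim h x = G x.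
Proof.
  intros Hh HG H0 x.
  set (D := fun y => (prim h y - G y)%C).
  assert (HD : forall y, Cder D y (RtoC 0)).
  { intros y. generalize (Cder_minus _ _ _ _ _ (prim_der h y Hh) (HG y)).
    apply Cder_ext; [reflexivity | ring]. }
  assert (E : D x = D 0).
  { destruct (Rle_dec 0 x) as [L | L].
    - apply Cder_zero_const; auto. intros y. apply (Cder_continuous _ _ _ (HD y)).
    - symmetry. apply Cder_zero_const; [lra | | auto]. intros y. apply (Cder_continuous _ _ _ (HD y)). }
  unfold D in E. rewrite prim_0, H0 in E.
  replace (prim h x) with ((prim h x - G x) + G x)%C by ring. rewrite E. ring.
Qed.

Lemma prim_lin (c d : C) (h k : R -> C) (x : R) :
  (forall y, continuous h y) -> (forall y, continuous k y) ->
  prim (fun y => (c * h y + d * k y)%C) x = (c * prim h x + d * prim k x)%C.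
Proof.
  intros Hh Hk.
  apply (prim_unique _ (fun x => (c * prim h x + d * prim k x)%C)).
  - intros y. apply continuous_Cplus; apply continuous_Cmult; auto using continuous_const.
  - intros y. apply Cder_plus; apply Cder_scal; now apply prim_der.
  - rewrite !prim_0. ring.
Qed.

Lemma prim_ext (h k : R -> C) (x B : R) :
  Rabs x <= B -> (forall y, Rabs y <= B -> h y = k y) -> prim h x = prim k x.
Proof.
  intros Hx E. apply (RInt_ext (V := C_R_CompleteNormedModule)).
  intros y Hy. apply E. revert Hx Hy. unfold Rmin, Rmax.
  destruct (Rle_dec 0 x); intros; unfold Rabs in *;
  destruct (Rcase_abs x); destruct (Rcase_abs y); lra.
Qed.

Lemma cosh_gt_0 (x : R) : 0 < cosh x.
Proof. unfold cosh. pose proof (exp_pos x). pose proof (exp_pos (- x)). lra. Qed.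

Lemma is_RInt_cosh (K s a c : R) : s <> 0 ->
  is_RInt (fun y => K * cosh (s * y)) a c (K / s * sinh (s * c) - K / s * sinh (s * a)).
Proof.
  intros Hs.
  apply (is_RInt_derive (V := R_CompleteNormedModule) (fun y => K / s * sinh (s * y))).
  - intros x _. unfold sinh, cosh. auto_derive; auto. field. auto.
  - intros x _. apply (ex_derive_continuous (V := R_NormedModule)). unfold cosh. auto_derive; auto.
Qed.

Lemma Rabs_sinh_le_cosh (x : R) : Rabs (sinh x) <= cosh x.
Proof.
  unfold sinh, cosh. pose proof (exp_pos x). pose proof (exp_pos (- x)).
  apply Rabs_le. lra.
Qed.

(** Integration from [0] reproduces the weight [cosh (s * y)] with a gain of [/ s]: the weight has
    primitive [sinh (s * y) / s], and [sinh] is dominated by [cosh]. This gain is what makes the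
    Neumann series converge for every [mu]. *)
Lemma prim_bound_cosh (h : R -> C) (K s x : R) :
  0 < s -> (forall y, continuous h y) ->
  (forall y, Rabs y <= Rabs x -> Cmod (h y) <= K * cosh (s * y)) ->
  Cmod (prim h x) <= K / s * cosh (s * x).
Proof.
  intros Hs Hh Hb.
  assert (HK : 0 <= K).
  { pose proof (Hb 0) as H. rewrite Rabs_R0 in H. specialize (H (Rabs_pos x)).
    pose proof (Cmod_ge_0 (h 0)). pose proof (cosh_gt_0 (s * 0)). nra. }
  assert (HKs : 0 <= K / s) by (apply Rmult_le_pos; [lra | apply Rlt_le, Rinv_0_lt_compat; lra]).
  assert (EI : ex_RInt (V := C_R_NormedModule) h 0 x).
  { apply (ex_RInt_continuous (V := C_R_CompleteNormedModule)). intros; apply Hh. }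
  assert (S0 : sinh (s * 0) = 0) by (unfold sinh; rewrite Rmult_0_r, Ropp_0; lra).
  pose proof (Rabs_sinh_le_cosh (s * x)) as SC. apply Rabs_le_between in SC.
  pose proof (is_RInt_cosh K s) as IC.
  rewrite Cmod_norm. destruct (Rle_dec 0 x) as [L | L].
  - apply Rle_trans with (K / s * sinh (s * x) - K / s * sinh (s * 0)); [|rewrite S0; nra].
    eapply (norm_RInt_le (V := C_R_NormedModule) h (fun y => K * cosh (s * y)) 0 x); auto.
    + intros y Hy. rewrite <- Cmod_norm. apply Hb. rewrite !Rabs_pos_eq; lra.
    + apply (RInt_correct (V := C_R_CompleteNormedModule)). exact EI.
    + apply IC. lra.
  - unfold prim. rewrite <- (opp_RInt_swap (V := C_R_CompleteNormedModule)) by (now apply (ex_RInt_swap (V := C_R_NormedModule))).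
    rewrite (norm_opp (V := C_R_NormedModule)).
    apply Rle_trans with (K / s * sinh (s * 0) - K / s * sinh (s * x)); [|rewrite S0; nra].
    eapply (norm_RInt_le (V := C_R_NormedModule) h (fun y => K * cosh (s * y)) x 0); auto; try lra.
    + intros y Hy. rewrite <- Cmod_norm. apply Hb. rewrite !Rabs_left1; lra.
    + apply (RInt_correct (V := C_R_CompleteNormedModule)). now apply (ex_RInt_swap (V := C_R_NormedModule)).
    + apply IC. lra.
Qed.

Lemma Cder_inv (f : R -> C) (x : R) (l : C) :
  f x <> RtoC 0 -> Cder f x l -> Cder (fun y => (/ f y)%C) x (- l / (f x * f x))%C.
Proof.
  intros Hn Hf.
  pose proof (Cder_fst _ _ _ Hf) as F1. pose proof (Cder_snd _ _ _ Hf) as F2.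
  assert (D0 : fst (f x) ^ 2 + snd (f x) ^ 2 <> 0).
  { intros H. apply Hn. destruct (f x) as [a c]; simpl in H.
    assert (a = 0) by nra. assert (c = 0) by nra. subst. reflexivity. }
  set (D := fun y => fst (f y) ^ 2 + snd (f y) ^ 2).
  assert (HD : is_derive D x (2 * fst (f x) * fst l + 2 * snd (f x) * snd l)).
  { apply (is_derive_Rext (fun y => fst (f y) * fst (f y) + snd (f y) * snd (f y)) _ _
      ((fst l * fst (f x) + fst (f x) * fst l) + (snd l * snd (f x) + snd (f x) * snd l))).
    intros; unfold D; ring. ring.
    apply (is_derive_plus (V := R_NormedModule)); now apply is_derive_Rmult. }
  pose proof (is_derive_inv D x _ HD D0) as HI.
  apply Cder_of_components; unfold Cinv; cbn [fst snd].
  - refine (is_derive_Rext _ _ _ _ _ _ _ (is_derive_Rmult _ _ _ _ _ F1 HI)).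
    reflexivity. unfold D. destruct (f x) as [a c], l as [l1 l2].
    unfold Cdiv, Cmult, Cinv, Copp; simpl in *. field. repeat split; nra.
  - refine (is_derive_Rext _ _ _ _ _ _ _ (is_derive_Rmult _ _ _ _ _
      (is_derive_opp _ _ _ F2) HI)).
    reflexivity. unfold D. destruct (f x) as [a c], l as [l1 l2].
    unfold Cdiv, Cmult, Cinv, Copp; unfold opp; simpl in *. field. repeat split; nra.
Qed.

(** ** Geometrically convergent complex series *)

(** [Series] is total, so this has a value for every sequence; it is the sum of the series under the
    geometric bounds that accompany it below. *)
Definition CSer (a : nat -> C) : C := (Series (fun n => fst (a n)), Series (fun n => snd (a n))).

Lemma is_series_half (K : R) : is_series (fun n => K * (/ 2) ^ n) (2 * K).
Proof.
  replace (2 * K) with (scal K (/ (1 - / 2))) by (unfold scal; simpl; unfold mult; simpl; field).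
  apply (is_series_scal (V := R_NormedModule)). apply is_series_geom.
  rewrite Rabs_pos_eq; lra.
Qed.

Lemma Series_tail_half (a : nat -> R) (K : R) (N : nat) :
  (forall n, Rabs (a n) <= K * (/ 2) ^ n) ->
  Rabs (Series a - sum_n a N) <= K * (/ 2) ^ N.
Proof.
  intros H.
  assert (EA : ex_series (fun n => Rabs (a n))).
  { apply (ex_series_le (V := R_CompleteNormedModule) _ (fun n => K * (/ 2) ^ n)).
    - intros n. unfold norm; simpl. unfold abs; simpl. rewrite Rabs_Rabsolu. apply H.
    - eexists. apply is_series_half. }
  assert (ET : forall k, Rabs (a (S N + k)%nat) <= (K * (/ 2) ^ (S N)) * (/ 2) ^ k).
  { intros k. eapply Rle_trans; [apply H|]. rewrite pow_add. lra. }
  rewrite (Series_incr_n a (S N)); [|lia|now apply ex_series_Rabs].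
  simpl pred. rewrite sum_n_Reals.
  replace (sum_f_R0 a N + Series (fun k => a (S N + k)%nat) - sum_f_R0 a N)
    with (Series (fun k => a (S N + k)%nat)) by ring.
  assert (EAN : ex_series (fun k => Rabs (a (S N + k)%nat)))
    by exact (proj1 (ex_series_incr_n (fun n => Rabs (a n)) (S N)) EA).
  eapply Rle_trans; [apply Series_Rabs; exact EAN|].
  eapply Rle_trans.
  - apply (Series_le _ (fun k => (K * (/ 2) ^ (S N)) * (/ 2) ^ k)).
    + intros k. split; [apply Rabs_pos | apply ET].
    + eexists. apply is_series_half.
  - rewrite (is_series_unique _ _ (is_series_half _)). simpl. lra.
Qed.

Lemma fst_csum (a : nat -> C) (N : nat) : fst (sum_n a N) = sum_n (fun n => fst (a n)) N.
Proof.
  induction N as [|N IH].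
  - rewrite sum_n_0_C. symmetry. apply (sum_O (G := R_AbelianMonoid)).
  - rewrite sum_n_S_C, (sum_Sn (G := R_AbelianMonoid)), <- IH. reflexivity.
Qed.

Lemma snd_csum (a : nat -> C) (N : nat) : snd (sum_n a N) = sum_n (fun n => snd (a n)) N.
Proof.
  induction N as [|N IH].
  - rewrite sum_n_0_C. symmetry. apply (sum_O (G := R_AbelianMonoid)).
  - rewrite sum_n_S_C, (sum_Sn (G := R_AbelianMonoid)), <- IH. reflexivity.
Qed.

Lemma Cmod_fst_le (z : C) : Rabs (fst z) <= Cmod z.
Proof.
  apply Rle_trans with (1 := Rmax_l _ (Rabs (snd z))). apply Rmax_Cmod.
Qed.

Lemma Cmod_snd_le (z : C) : Rabs (snd z) <= Cmod z.
Proof.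
  apply Rle_trans with (1 := Rmax_r (Rabs (fst z)) _). apply Rmax_Cmod.
Qed.

Lemma Cmod_le_parts (z : C) : Cmod z <= Rabs (fst z) + Rabs (snd z).
Proof.
  destruct z as [a c]. cbn [fst snd].
  assert (E : (a, c) = (RtoC a + RtoC c * Ci)%C).
  { unfold RtoC, Ci, Cplus, Cmult; simpl. f_equal; ring. }
  rewrite E. eapply Rle_trans; [apply Cmod_triangle|].
  rewrite Cmod_mult, !Cmod_R, Cmod_Ci. lra.
Qed.

(** The terms after [N] of the majorant add up to [K * (/ 2) ^ N]; the factor 2 comes from treating
    real and imaginary parts separately. *)
Lemma CSer_tail (a : nat -> C) (K : R) (N : nat) :
  (forall n, Cmod (a n) <= K * (/ 2) ^ n) ->
  Cmod (CSer a - sum_n a N)%C <= 2 * K * (/ 2) ^ N.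
Proof.
  intros H. eapply Rle_trans; [apply Cmod_le_parts|].
  unfold CSer, Cminus, Cplus, Copp; cbn [fst snd]. rewrite fst_csum, snd_csum.
  assert (H1 : forall n, Rabs (fst (a n)) <= K * (/ 2) ^ n)
    by (intros n; eapply Rle_trans; [apply Cmod_fst_le | apply H]).
  assert (H2 : forall n, Rabs (snd (a n)) <= K * (/ 2) ^ n)
    by (intros n; eapply Rle_trans; [apply Cmod_snd_le | apply H]).
  pose proof (Series_tail_half _ K N H1) as T1. pose proof (Series_tail_half _ K N H2) as T2.
  unfold Rminus in *. lra.
Qed.

Lemma half_pow_small (K eps : R) : 0 < eps -> exists N, forall n, (N <= n)%nat -> K * (/ 2) ^ n < eps.
Proof.
  intros He. destruct (pow_lt_1_zero (/ 2)) with (y := eps / (Rabs K + 1)) as [N HN].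
  - rewrite Rabs_pos_eq; lra.
  - pose proof (Rabs_pos K). apply Rdiv_lt_0_compat; lra.
  - exists N. intros n Hn. specialize (HN n Hn).
    pose proof (Rabs_pos K) as P.
    assert (P2 : 0 < (/ 2) ^ n) by (apply pow_lt; lra).
    rewrite Rabs_pos_eq in HN by lra.
    apply Rle_lt_trans with ((Rabs K + 1) * (/ 2) ^ n).
    + pose proof (Rle_abs K). nra.
    + apply Rmult_lt_compat_l with (r := Rabs K + 1) in HN; [|lra].
      replace ((Rabs K + 1) * (eps / (Rabs K + 1))) with eps in HN by (field; lra). exact HN.
Qed.

Lemma C_eq_of_Cmod_le_eps (z w : C) : (forall eps, 0 < eps -> Cmod (z - w)%C <= eps) -> z = w.
Proof.
  intros H. assert (E : (z - w)%C = RtoC 0).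
  { apply Cmod_eq_0. apply Rle_antisym; [|apply Cmod_ge_0].
    apply le_epsilon. intros e He. specialize (H e He). lra. }
  replace z with ((z - w) + w)%C by ring. rewrite E. ring.
Qed.

Lemma CSer_unique (a : nat -> C) (K K' : R) (l : C) :
  (forall n, Cmod (a n) <= K * (/ 2) ^ n) ->
  (forall n, Cmod (l - sum_n a n)%C <= K' * (/ 2) ^ n) -> CSer a = l.
Proof.
  intros H Hl. apply C_eq_of_Cmod_le_eps. intros eps He.
  destruct (half_pow_small (2 * K + K') eps He) as [N HN]. specialize (HN N (le_n _)).
  replace (CSer a - l)%C with ((CSer a - sum_n a N) - (l - sum_n a N))%C by ring.
  eapply Rle_trans; [apply Cmod_triangle|]. rewrite Cmod_opp.
  pose proof (CSer_tail a K N H). specialize (Hl N). lra.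
Qed.

Lemma csum_ext (a c : nat -> C) (N : nat) :
  (forall n, (n <= N)%nat -> a n = c n) -> sum_n a N = sum_n c N :> C.
Proof. apply (sum_n_ext_loc (G := C_AbelianMonoid)). Qed.

Lemma csum_plus (a c : nat -> C) (N : nat) :
  sum_n (fun n => (a n + c n)%C) N = (sum_n a N + sum_n c N)%C :> C.
Proof. apply (sum_n_plus (G := C_AbelianMonoid)). Qed.

Lemma csum_scal (k : C) (a : nat -> C) (N : nat) :
  sum_n (fun n => (k * a n)%C) N = (k * sum_n a N)%C :> C.
Proof.
  induction N as [|N IH]; [now rewrite !sum_n_0_C|]. rewrite !sum_n_S_C, IH. ring.
Qed.

Lemma csum_bound (a : nat -> C) (c : nat -> R) (N : nat) :
  (forall n, (n <= N)%nat -> Cmod (a n) <= c n) -> Cmod (sum_n a N) <= sum_n c N.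
Proof.
  induction N as [|N IH]; intros H.
  - rewrite sum_n_0_C, (sum_O (G := R_AbelianMonoid)). auto.
  - rewrite sum_n_S_C, (sum_Sn (G := R_AbelianMonoid)).
    eapply Rle_trans; [apply Cmod_triangle|]. apply Rplus_le_compat; auto.
Qed.

Lemma sum_half_pow (K : R) (N : nat) : 0 <= K -> sum_n (fun n => K * (/ 2) ^ n) N <= 2 * K.
Proof.
  intros HK.
  assert (E : sum_n (fun n => K * (/ 2) ^ n) N = 2 * K - K * (/ 2) ^ N).
  { induction N as [|N IH].
    - rewrite (sum_O (G := R_AbelianMonoid)). simpl. ring.
    - rewrite (sum_Sn (G := R_AbelianMonoid)), IH. unfold plus; simpl. field. }
  rewrite E. assert (0 < (/ 2) ^ N) by (apply pow_lt; lra). nra.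
Qed.

Definition conv (a c : nat -> C) (n : nat) : C := sum_n (fun j => (a j * c (n - j)%nat)%C) n.

(** The triangle of indices with sum at most [N] is summed by rows instead of diagonals. *)
Lemma conv_partial_sums (a c : nat -> C) (N : nat) :
  sum_n (conv a c) N = sum_n (fun j => (a j * sum_n c (N - j))%C) N :> C.
Proof.
  induction N as [|N IH].
  - unfold conv. now rewrite !sum_n_0_C.
  - rewrite sum_n_S_C, IH. unfold conv. rewrite !sum_n_S_C, Nat.sub_diag.
    rewrite (csum_ext (fun j => (a j * sum_n c (S N - j))%C)
      (fun j => (a j * sum_n c (N - j) + a j * c (S N - j)%nat)%C)).
    + rewrite csum_plus, sum_n_0_C. ring.
    + intros n Hn. rewrite Nat.sub_succ_l by lia. rewrite sum_n_S_C. ring.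
Qed.

(** The decay [4^-j] of [a] against [2^-j] of [c] leaves a factor [2^-j] in each term of the
    convolution, so that no factor growing with [n] appears. *)
Lemma conv_bound (a c : nat -> C) (A K : R) (n : nat) :
  (forall j, Cmod (a j) <= A * ((/ 2) ^ j * (/ 2) ^ j)) ->
  (forall j, Cmod (c j) <= K * (/ 2) ^ j) ->
  Cmod (conv a c n) <= 2 * A * K * (/ 2) ^ n.
Proof.
  intros Ha Hc.
  assert (HA : 0 <= A) by (specialize (Ha 0%nat); simpl in Ha; pose proof (Cmod_ge_0 (a 0%nat)); lra).
  assert (HK : 0 <= K) by (specialize (Hc 0%nat); simpl in Hc; pose proof (Cmod_ge_0 (c 0%nat)); lra).
  assert (P : 0 < (/ 2) ^ n) by (apply pow_lt; lra).
  eapply Rle_trans; [apply (csum_bound _ (fun j => (A * K * (/ 2) ^ n) * (/ 2) ^ j))|].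
  - intros j Hj. rewrite Cmod_mult.
    eapply Rle_trans; [apply Rmult_le_compat; try apply Cmod_ge_0; [apply Ha | apply Hc]|].
    replace n with (j + (n - j))%nat at 2 by lia. rewrite pow_add. right; ring.
  - eapply Rle_trans; [apply sum_half_pow|]. apply Rmult_le_pos; [apply Rmult_le_pos; auto|lra]. lra.
Qed.

(* Mertens: the stronger decay of [a] absorbs the tails of [c]. *)
Lemma CSer_conv (a c : nat -> C) (A K : R) :
  (forall j, Cmod (a j) <= A * ((/ 2) ^ j * (/ 2) ^ j)) ->
  (forall j, Cmod (c j) <= K * (/ 2) ^ j) ->
  CSer (conv a c) = (CSer a * CSer c)%C.
Proof.
  intros Ha Hc.
  assert (HA : 0 <= A) by (specialize (Ha 0%nat); simpl in Ha; pose proof (Cmod_ge_0 (a 0%nat)); lra).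
  assert (HK : 0 <= K) by (specialize (Hc 0%nat); simpl in Hc; pose proof (Cmod_ge_0 (c 0%nat)); lra).
  assert (Ha' : forall j, Cmod (a j) <= A * (/ 2) ^ j).
  { intros j. eapply Rle_trans; [apply Ha|]. apply Rmult_le_compat_l; auto.
    assert (0 < (/ 2) ^ j) by (apply pow_lt; lra).
    assert ((/ 2) ^ j <= 1) by (rewrite <- (pow1 j); apply pow_incr; lra). nra. }
  apply (CSer_unique _ (2 * A * K) (2 * (A * (2 * K)) + 2 * A * Cmod (CSer c))).
  - intros n. now apply conv_bound.
  - intros N. assert (P : 0 < (/ 2) ^ N) by (apply pow_lt; lra).
    rewrite conv_partial_sums.
    (* The error is the tail of [a] times the whole sum of [c], plus the terms of [a] times tails of
       [c]. *)
    replace (CSer a * CSer c - sum_n (fun j => (a j * sum_n c (N - j))%C) N)%C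
      with ((CSer a - sum_n a N) * CSer c
        + sum_n (fun j => (a j * (CSer c - sum_n c (N - j)))%C) N)%C.
    2:{ rewrite (csum_ext (fun j => (a j * (CSer c - sum_n c (N - j)))%C)
          (fun j => (CSer c * a j + (- RtoC 1) * (a j * sum_n c (N - j)))%C)) by (intros; ring).
        rewrite csum_plus, !csum_scal. ring. }
    eapply Rle_trans; [apply Cmod_triangle|]. rewrite Cmod_mult.
    assert (B1 : Cmod (CSer a - sum_n a N)%C * Cmod (CSer c) <= 2 * A * (/ 2) ^ N * Cmod (CSer c)).
    { apply Rmult_le_compat_r; [apply Cmod_ge_0|]. now apply CSer_tail. }
    assert (B2 : Cmod (sum_n (fun j => (a j * (CSer c - sum_n c (N - j)))%C) N)
                 <= 2 * (A * (2 * K) * (/ 2) ^ N)).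
    { eapply Rle_trans; [apply (csum_bound _ (fun j => (A * (2 * K) * (/ 2) ^ N) * (/ 2) ^ j))|].
      - intros j Hj. rewrite Cmod_mult.
        eapply Rle_trans; [apply Rmult_le_compat; try apply Cmod_ge_0;
          [apply Ha | apply (CSer_tail c K); exact Hc]|].
        replace N with (j + (N - j))%nat at 2 by lia. rewrite pow_add. right; ring.
      - apply sum_half_pow. apply Rmult_le_pos; [apply Rmult_le_pos; lra|lra]. }
    lra.
Qed.

Lemma CSer_lin (a c : nat -> C) (k l : C) (K K' : R) :
  (forall n, Cmod (a n) <= K * (/ 2) ^ n) -> (forall n, Cmod (c n) <= K' * (/ 2) ^ n) ->
  CSer (fun n => (k * a n + l * c n)%C) = (k * CSer a + l * CSer c)%C.
Proof.
  intros Ha Hc.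
  apply (CSer_unique _ (Cmod k * K + Cmod l * K') (Cmod k * (2 * K) + Cmod l * (2 * K'))).
  - intros n. eapply Rle_trans; [apply Cmod_triangle|]. rewrite !Cmod_mult.
    specialize (Ha n). specialize (Hc n).
    pose proof (Cmod_ge_0 k). pose proof (Cmod_ge_0 l). nra.
  - intros n. rewrite csum_plus, !csum_scal.
    replace (k * CSer a + l * CSer c - (k * sum_n a n + l * sum_n c n))%C
      with (k * (CSer a - sum_n a n) + l * (CSer c - sum_n c n))%C by ring.
    eapply Rle_trans; [apply Cmod_triangle|]. rewrite !Cmod_mult.
    pose proof (CSer_tail a K n Ha). pose proof (CSer_tail c K' n Hc).
    pose proof (Cmod_ge_0 k). pose proof (Cmod_ge_0 l). nra.
Qed.

Lemma pow_div_fact_le_exp (x : R) (n : nat) : 0 <= x -> x ^ n / INR (fact n) <= exp x.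
Proof.
  intros Hx. eapply Rle_trans; [|apply (exp_ge_taylor x n Hx)].
  assert (P : forall k, 0 <= x ^ k / INR (fact k)).
  { intros k. apply Rmult_le_pos; [now apply pow_le|]. apply Rlt_le, Rinv_0_lt_compat, INR_fact_lt_0. }
  destruct n as [|n]; [simpl; lra|]. rewrite tech5.
  pose proof (cond_pos_sum (fun k => x ^ k / INR (fact k)) n P). lra.
Qed.

Definition expterm (z : C) (j : nat) : C := (z ^ j / RtoC (INR (fact j)))%C.

Lemma Cmod_Cpow (z : C) (n : nat) : Cmod (z ^ n)%C = Cmod z ^ n.
Proof. induction n as [|n IH]; simpl; [apply Cmod_1|]. now rewrite Cmod_mult, IH. Qed.

Lemma RtoC_fact_neq0 (j : nat) : RtoC (INR (fact j)) <> RtoC 0.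
Proof. intros H. apply RtoC_inj in H. now apply (INR_fact_neq_0 j). Qed.

(** A single Taylor term gives [(4 r)^j / j! <= exp (4 r)]. The resulting decay [4^-j] is what the
    Cauchy product asks of its first factor. *)
Lemma expterm_bound (z : C) (r : R) (j : nat) :
  Cmod z <= r -> Cmod (expterm z j) <= exp (4 * r) * ((/ 2) ^ j * (/ 2) ^ j).
Proof.
  intros Hz. pose proof (Cmod_ge_0 z) as Z0. unfold expterm.
  rewrite Cmod_div by apply RtoC_fact_neq0.
  rewrite Cmod_Cpow, Cmod_R, Rabs_pos_eq by apply pos_INR.
  pose proof (pow_div_fact_le_exp (4 * r) j ltac:(lra)) as H.
  pose proof (INR_fact_lt_0 j) as Fj.
  rewrite Rpow_mult_distr in H.
  assert (E : (/ 2) ^ j * (/ 2) ^ j = / 4 ^ j).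
  { rewrite <- Rpow_mult_distr, <- pow_inv. f_equal. lra. }
  rewrite E.
  assert (P4 : 0 < 4 ^ j) by (apply pow_lt; lra).
  apply Rle_trans with (r ^ j / INR (fact j)).
  - apply Rmult_le_compat_r; [apply Rlt_le, Rinv_0_lt_compat, Fj|]. apply pow_incr; lra.
  - apply (Rmult_le_reg_r (4 ^ j)); auto. rewrite Rmult_assoc, Rinv_l, Rmult_1_r by lra.
    eapply Rle_trans; [|exact H]. right. field. lra.
Qed.

Lemma expterm_RtoC (x : R) (j : nat) : expterm (RtoC x) j = RtoC (x ^ j / INR (fact j)).
Proof.
  unfold expterm. rewrite RtoC_div by apply INR_fact_neq_0. now rewrite RtoC_pow.
Qed.

Lemma CSer_exp_R (x : R) : CSer (expterm (RtoC x)) = RtoC (exp x).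
Proof.
  unfold CSer. change (RtoC (exp x)) with ((exp x, 0) : C). apply (f_equal2 (@pair R R)).
  - rewrite (Series_ext _ (fun n => scal (x ^ n) (/ INR (fact n)))).
    + apply is_series_unique. generalize (is_exp_Reals x). unfold is_pseries.
      apply is_series_ext. intros n. now rewrite pow_n_pow.
    + intros n. now rewrite expterm_RtoC.
  - rewrite (Series_ext _ (fun n => 0 * 0)).
    + rewrite Series_scal_l. ring.
    + intros n. rewrite expterm_RtoC. cbn. ring.
Qed.

(** ** The right inverse of [y'' - q y] and its Neumann series *)

(** Continuity, nonvanishing and bounds hold on the whole line, the equation only inside [(-b, b)].
    The continuation of [f] by its endpoint values has these properties, and integrals need no side
    conditions. *)
Record nonvanishing_solution (b : R) (q F F1 : R -> C) (m : R) : Prop := {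
  nvs_q : forall x, continuous q x;
  nvs_F : forall x, continuous F x;
  nvs_F1 : forall x, continuous F1 x;
  nvs_neq : forall x, F x <> RtoC 0;
  nvs_bound : forall x, Cmod (F x) <= m;
  nvs_inv_bound : forall x, Cmod (/ (F x * F x))%C <= m;
  nvs_der : forall x, -b < x < b -> Cder F x (F1 x);
  nvs_der1 : forall x, -b < x < b -> Cder F1 x (q x * F x)%C }.

Definition inv_sq (F : R -> C) (s : R) : C := (/ (F s * F s))%C.

(** Reduction of order: for [y = F w] the equation [y'' - q y = h] becomes [(F^2 w')' = F h], and
    two integrations from [0] give [w]. *)
Definition J (F h : R -> C) (x : R) : C :=
  (F x * prim (fun s => inv_sq F s * prim (fun r => F r * h r) s) x)%C.

Definition Jn (F : R -> C) (n : nat) (h : R -> C) : R -> C := Nat.iter n (J F) h.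

(** The solution vanishing at [0] whose Wronskian with [F] is 1. *)
Definition second_solution (F : R -> C) (x : R) : C := (F x * prim (inv_sq F) x)%C.

(** The equation is asked inside only, but [y] and [y1] are continuous everywhere, so that
    Wronskians are continuous up to the endpoints. *)
Definition solves (b : R) (q h y : R -> C) : Prop :=
  (forall x, continuous y x) /\
  exists y1 : R -> C, (forall x, continuous y1 x) /\
    forall x, -b < x < b -> Cder y x (y1 x) /\ Cder y1 x (q x * y x + h x)%C.

(** One constant serves all [s >= 1], so that the weight can be chosen later according to the size
    of [mu]. The class contains the bounded continuous functions and is stable under [J]. *)
Definition cosh_bounded (K : R) (h : R -> C) : Prop :=
  (forall x, continuous h x) /\ forall s x, 1 <= s -> Cmod (h x) <= K * cosh (s * x).

Lemma cosh_ge_1 (x : R) : 1 <= cosh x.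
Proof.
  unfold cosh. rewrite exp_Ropp. pose proof (exp_pos x) as P.
  assert (E : exp x * / exp x = 1) by (apply Rinv_r; lra).
  assert (0 < / exp x) by (now apply Rinv_0_lt_compat).
  pose proof (pow2_ge_0 (exp x - / exp x)). nra.
Qed.

Lemma cosh_ge_exp (x : R) : exp (Rabs x) / 2 <= cosh x.
Proof.
  unfold cosh. pose proof (exp_pos x). pose proof (exp_pos (- x)).
  unfold Rabs. destruct (Rcase_abs x); lra.
Qed.

Lemma exp_le (x y : R) : x <= y -> exp x <= exp y.
Proof. intros [H | ->]; [apply Rlt_le; now apply exp_increasing | lra]. Qed.

Lemma cosh_le_of_abs (x y : R) : Rabs x <= Rabs y -> cosh x <= cosh y.
Proof.
  intros H.
  assert (E : forall z, cosh z = (exp (Rabs z) + / exp (Rabs z)) / 2).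
  { intros z. unfold cosh. rewrite <- exp_Ropp. unfold Rabs.
    destruct (Rcase_abs z); rewrite ?Ropp_involutive; lra. }
  rewrite (E x), (E y).
  pose proof (exp_le _ _ H) as L. pose proof (exp_pos (Rabs x)) as P.
  assert (L1 : 1 <= exp (Rabs x)) by (rewrite <- exp_0; apply exp_le, Rabs_pos).
  set (u := exp (Rabs x)) in *. set (v := exp (Rabs y)) in *.
  assert (I : / u - / v = (v - u) * / (u * v)) by (field; lra).
  assert (/ (u * v) <= 1) by (rewrite <- Rinv_1; apply Rinv_le_contravar; nra).
  nra.
Qed.

Lemma continuous_C_eps {U : UniformSpace} (f : U -> C) (x : U) :
  (forall eps, 0 < eps -> locally x (fun y => Cmod (f y - f x)%C < eps)) -> continuous f x.
Proof.
  intros H. apply (filterlim_locally (U := C_UniformSpace)). intros eps.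
  generalize (H eps (cond_pos eps)). apply filter_imp. intros y Hy.
  pose proof (Cmod_fst_le (f y - f x)%C) as A. pose proof (Cmod_snd_le (f y - f x)%C) as B.
  split; unfold ball; simpl; unfold AbsRing_ball, abs, minus, plus, opp; simpl;
  unfold Cminus, Cplus, Copp in *; simpl in *; lra.
Qed.

Lemma continuous_C_locally {U : UniformSpace} (f : U -> C) (x : U) (eps : R) :
  continuous f x -> 0 < eps -> locally x (fun y => Cmod (f y - f x)%C < eps).
Proof.
  intros H He.
  assert (C1 : continuous (fun y => Cmod (f y - f x)%C) x).
  { apply continuous_Cmod, continuous_Cminus; auto. apply continuous_const. }
  assert (Z : Cmod (f x - f x)%C = 0).
  { replace (f x - f x)%C with (RtoC 0) by ring. apply Cmod_0. }
  generalize (proj1 (filterlim_locally _ _) C1 (mkposreal eps He)). apply filter_imp.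
  intros y. unfold ball; simpl. unfold AbsRing_ball, abs, minus, plus, opp; simpl.
  rewrite Z, Ropp_0, Rplus_0_r. intros A. rewrite Rabs_pos_eq in A; auto. apply Cmod_ge_0.
Qed.

Section RightInverse.

Context (b : R) (q F F1 : R -> C) (m : R) (HF : nonvanishing_solution b q F F1 m).

Lemma nvs_m_pos : 0 <= m.
Proof. pose proof (nvs_bound _ _ _ _ _ HF 0). pose proof (Cmod_ge_0 (F 0)). lra. Qed.

Lemma inv_sq_continuous (x : R) : continuous (inv_sq F) x.
Proof.
  apply continuous_Cinv.
  - apply Cmult_neq_0; apply (nvs_neq _ _ _ _ _ HF).
  - apply continuous_Cmult; apply (nvs_F _ _ _ _ _ HF).
Qed.

Lemma Fh_continuous (h : R -> C) : (forall x, continuous h x) ->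
  forall x, continuous (fun r => (F r * h r)%C) x.
Proof. intros Hh x. apply continuous_Cmult; auto. apply (nvs_F _ _ _ _ _ HF). Qed.

Lemma J_inner_continuous (h : R -> C) : (forall x, continuous h x) ->
  forall x, continuous (fun s => (inv_sq F s * prim (fun r => F r * h r) s)%C) x.
Proof.
  intros Hh x. apply continuous_Cmult; [apply inv_sq_continuous|].
  apply prim_continuous. now apply Fh_continuous.
Qed.

Lemma J_continuous (h : R -> C) (x : R) : (forall x, continuous h x) -> continuous (J F h) x.
Proof.
  intros Hh. apply continuous_Cmult; [apply (nvs_F _ _ _ _ _ HF)|].
  apply prim_continuous. now apply J_inner_continuous.
Qed.

(** Here [p] stands for [F^2 w']. In the second derivative the term [F1 * w'] cancels against the
    one from differentiating [/ F]. *)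
Lemma Cder_F_mult (w p : R -> C) (k : R -> C) (x : R) :
  -b < x < b -> Cder w x (inv_sq F x * p x)%C -> Cder p x (k x) ->
  Cder (fun y => (F y * w y)%C) x (F1 x * w x + / F x * p x)%C /\
  Cder (fun y => (F1 y * w y + / F y * p y)%C) x (q x * (F x * w x) + / F x * k x)%C.
Proof.
  intros Hx Hw Hp. pose proof (nvs_neq _ _ _ _ _ HF x) as Fx.
  pose proof (nvs_der _ _ _ _ _ HF x Hx) as D. pose proof (nvs_der1 _ _ _ _ _ HF x Hx) as D1.
  split.
  - generalize (Cder_mult _ _ _ _ _ D Hw). apply Cder_ext; [reflexivity|].
    unfold inv_sq. now field.
  - generalize (Cder_plus _ _ _ _ _ (Cder_mult _ _ _ _ _ D1 Hw)
      (Cder_mult _ _ _ _ _ (Cder_inv _ _ _ Fx D) Hp)).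
    apply Cder_ext; [reflexivity|]. unfold inv_sq. now field.
Qed.

Lemma invF_continuous (x : R) : continuous (fun y => (/ F y)%C) x.
Proof. apply continuous_Cinv; [apply (nvs_neq _ _ _ _ _ HF) | apply (nvs_F _ _ _ _ _ HF)]. Qed.

Lemma J_solves (h : R -> C) : (forall x, continuous h x) -> solves b q h (J F h).
Proof.
  intros Hh. split; [intros; now apply J_continuous|].
  set (p := prim (fun r => (F r * h r)%C)).
  set (w := prim (fun s => (inv_sq F s * p s)%C)).
  assert (Hp : forall x, Cder p x (F x * h x)%C) by (intros; apply prim_der; now apply Fh_continuous).
  assert (Hw : forall x, Cder w x (inv_sq F x * p x)%C).
  { intros. apply (prim_der (fun s => (inv_sq F s * p s)%C)). now apply J_inner_continuous. }
  exists (fun x => (F1 x * w x + / F x * p x)%C). split.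
  - intros x. apply continuous_Cplus; apply continuous_Cmult.
    apply (nvs_F1 _ _ _ _ _ HF). eapply Cder_continuous, Hw.
    apply invF_continuous. eapply Cder_continuous, Hp.
  - intros x Hx. destruct (Cder_F_mult w p (fun x => (F x * h x)%C) x Hx (Hw x) (Hp x)) as [A B].
    split; [exact A|]. revert B. apply Cder_ext; [reflexivity|].
    change (J F h x) with (F x * w x)%C. field. apply (nvs_neq _ _ _ _ _ HF).
Qed.

Lemma F_solves : solves b q (fun _ => RtoC 0) F.
Proof.
  split; [apply (nvs_F _ _ _ _ _ HF)|]. exists F1. split; [apply (nvs_F1 _ _ _ _ _ HF)|].
  intros x Hx. split; [now apply (nvs_der _ _ _ _ _ HF)|].
  generalize (nvs_der1 _ _ _ _ _ HF x Hx). apply Cder_ext; [reflexivity | ring].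
Qed.

Lemma second_solution_solves : solves b q (fun _ => RtoC 0) (second_solution F).
Proof.
  set (w := prim (inv_sq F)).
  assert (Hw : forall x, Cder w x (inv_sq F x)) by (intros; apply prim_der; apply inv_sq_continuous).
  assert (Cw : forall x, continuous w x) by (intros; eapply Cder_continuous, Hw).
  split; [intros; apply continuous_Cmult; auto; apply (nvs_F _ _ _ _ _ HF)|].
  exists (fun x => (F1 x * w x + / F x * RtoC 1)%C). split.
  - intros x. apply continuous_Cplus; apply continuous_Cmult; auto using continuous_const, invF_continuous.
    apply (nvs_F1 _ _ _ _ _ HF).
  - intros x Hx.
    destruct (Cder_F_mult w (fun _ => RtoC 1) (fun x => RtoC 0) x Hx) as [A B].
    + generalize (Hw x). apply Cder_ext; [reflexivity | ring].
    + apply Cder_const.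
    + split; [exact A|]. revert B. apply Cder_ext; [reflexivity|].
      change (second_solution F x) with (F x * w x)%C. ring.
Qed.

Lemma solves_lin (c d : C) (h k y z : R -> C) :
  solves b q h y -> solves b q k z ->
  solves b q (fun x => (c * h x + d * k x)%C) (fun x => (c * y x + d * z x)%C).
Proof.
  intros [Cy [y1 [Cy1 Dy]]] [Cz [z1 [Cz1 Dz]]]. split.
  - intros x. apply continuous_Cplus; apply continuous_Cmult; auto using continuous_const.
  - exists (fun x => (c * y1 x + d * z1 x)%C). split.
    + intros x. apply continuous_Cplus; apply continuous_Cmult; auto using continuous_const.
    + intros x Hx. destruct (Dy x Hx), (Dz x Hx). split.
      * apply Cder_plus; now apply Cder_scal.
      * generalize (Cder_plus _ _ _ _ _ (Cder_scal c _ _ _ H0) (Cder_scal d _ _ _ H2)).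
        apply Cder_ext; [reflexivity | ring].
Qed.

Lemma solves_ext (h k y z : R -> C) :
  (forall x, h x = k x) -> (forall x, y x = z x) -> solves b q h y -> solves b q k z.
Proof.
  intros Eh Ey [Cy [y1 [Cy1 Dy]]]. split.
  - intros x. now apply (continuous_C_ext y).
  - exists y1. split; auto. intros x Hx. destruct (Dy x Hx) as [A B]. split.
    + revert A. now apply Cder_ext.
    + revert B. apply Cder_ext; auto. now rewrite Eh, Ey.
Qed.

Lemma J_lin (c d : C) (h k : R -> C) (x : R) :
  (forall x, continuous h x) -> (forall x, continuous k x) ->
  J F (fun y => (c * h y + d * k y)%C) x = (c * J F h x + d * J F k x)%C.
Proof.
  intros Hh Hk. unfold J.
  transitivity (F x * prim (fun s => (c * (inv_sq F s * prim (fun r => F r * h r) s)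
      + d * (inv_sq F s * prim (fun r => F r * k r) s))%C) x)%C.
  - apply (f_equal (Cmult (F x))), (prim_ext _ _ x (Rabs x)); [lra|]. intros s _.
    transitivity (inv_sq F s * (c * prim (fun r => F r * h r) s + d * prim (fun r => F r * k r) s))%C;
      [|ring].
    rewrite <- prim_lin by (now apply Fh_continuous).
    apply (f_equal (Cmult (inv_sq F s))), (prim_ext _ _ s (Rabs s)); [lra|]. intros r _. ring.
  - rewrite prim_lin by (now apply J_inner_continuous). ring.
Qed.

Lemma J_ext_on (h k : R -> C) (B x : R) :
  Rabs x <= B -> (forall y, Rabs y <= B -> h y = k y) -> J F h x = J F k x.
Proof.
  intros Hx E. unfold J. apply (f_equal (Cmult (F x))), (prim_ext _ _ x B); [exact Hx|].
  intros s Hs. apply (f_equal (Cmult (inv_sq F s))), (prim_ext _ _ s B); [exact Hs|].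
  intros r Hr. now rewrite E.
Qed.

(** Each of the two integrations gains [/ s]; each of the factors [F], [inv_sq F] and [F] costs
    [m]. *)
Lemma J_bound (h : R -> C) (K s x : R) :
  0 < s -> (forall y, continuous h y) ->
  (forall y, Cmod (h y) <= K * cosh (s * y)) ->
  Cmod (J F h x) <= m ^ 3 / s ^ 2 * K * cosh (s * x).
Proof.
  intros Hs Hh Hb. pose proof nvs_m_pos as M0.
  assert (B1 : forall y, Cmod (prim (fun r => (F r * h r)%C) y) <= m * K / s * cosh (s * y)).
  { intros y. apply prim_bound_cosh; auto. now apply Fh_continuous.
    intros r _. rewrite Cmod_mult, Rmult_assoc.
    apply Rmult_le_compat; auto using Cmod_ge_0. apply (nvs_bound _ _ _ _ _ HF). }
  assert (B2 : forall y, Cmod (prim (fun s => (inv_sq F s * prim (fun r => F r * h r) s)%C) y)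
    <= m * (m * K / s) / s * cosh (s * y)).
  { intros y. apply prim_bound_cosh; auto. now apply J_inner_continuous.
    intros r _. rewrite Cmod_mult, (Rmult_assoc m).
    apply Rmult_le_compat; auto using Cmod_ge_0. apply (nvs_inv_bound _ _ _ _ _ HF). }
  unfold J. rewrite Cmod_mult.
  apply Rle_trans with (m * (m * (m * K / s) / s * cosh (s * x))).
  - apply Rmult_le_compat; auto using Cmod_ge_0. apply (nvs_bound _ _ _ _ _ HF).
  - right. field. lra.
Qed.

Lemma Jn_continuous (h : R -> C) (n : nat) : (forall y, continuous h y) ->
  forall y, continuous (Jn F n h) y.
Proof. intros Hh. induction n as [|n IH]; simpl; auto. intros y. now apply J_continuous. Qed.

Lemma Jn_lin (c d : C) (h k : R -> C) (n : nat) (x : R) :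
  (forall x, continuous h x) -> (forall x, continuous k x) ->
  Jn F n (fun y => (c * h y + d * k y)%C) x = (c * Jn F n h x + d * Jn F n k x)%C.
Proof.
  intros Hh Hk. revert x. induction n as [|n IH]; intros x; simpl; [reflexivity|].
  change (J F (Jn F n (fun y => (c * h y + d * k y)%C)) x
    = (c * J F (Jn F n h) x + d * J F (Jn F n k) x)%C).
  rewrite <- J_lin by (now apply Jn_continuous).
  apply (J_ext_on _ _ (Rabs x)); [lra|]. intros y _. apply IH.
Qed.

Lemma Jn_bound (h : R -> C) (K s : R) (n : nat) : 0 < s -> (forall y, continuous h y) ->
  (forall y, Cmod (h y) <= K * cosh (s * y)) ->
  forall x, Cmod (Jn F n h x) <= (m ^ 3 / s ^ 2) ^ n * K * cosh (s * x).
Proof.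
  intros Hs Hh Hb. induction n as [|n IH]; intros x.
  - rewrite pow_O, Rmult_1_l. apply Hb.
  - change (Jn F (S n) h x) with (J F (Jn F n h) x).
    eapply Rle_trans; [apply (J_bound _ ((m ^ 3 / s ^ 2) ^ n * K) s); auto|].
    + now apply Jn_continuous.
    + right. set (W := m ^ 3 / s ^ 2). simpl. ring.
Qed.

Lemma F_cosh_bounded : cosh_bounded m F.
Proof.
  split; [apply (nvs_F _ _ _ _ _ HF)|]. intros s x _.
  pose proof (nvs_bound _ _ _ _ _ HF x). pose proof (cosh_ge_1 (s * x)). pose proof nvs_m_pos. nra.
Qed.

Lemma second_solution_cosh_bounded : cosh_bounded (m * m) (second_solution F).
Proof.
  split; [apply second_solution_solves|]. intros s x Hs. unfold second_solution.
  rewrite Cmod_mult, Rmult_assoc. pose proof nvs_m_pos as M0.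
  apply Rmult_le_compat; auto using Cmod_ge_0; [apply (nvs_bound _ _ _ _ _ HF)|].
  apply Rle_trans with (m / s * cosh (s * x)).
  - apply prim_bound_cosh; try lra. apply inv_sq_continuous. intros y _.
    pose proof (nvs_inv_bound _ _ _ _ _ HF y). pose proof (cosh_ge_1 (s * y)). unfold inv_sq. nra.
  - apply Rmult_le_compat_r; [pose proof (cosh_ge_1 (s * x)); lra|].
    unfold Rdiv. rewrite <- (Rmult_1_r m) at 2. apply Rmult_le_compat_l; auto.
    rewrite <- Rinv_1. apply Rinv_le_contravar; lra.
Qed.

Lemma J_cosh_bounded (K : R) (h : R -> C) : cosh_bounded K h -> cosh_bounded (m ^ 3 * K) (J F h).
Proof.
  intros [Ch Bh]. split; [intros; now apply J_continuous|]. intros s x Hs.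
  eapply Rle_trans; [apply (J_bound h K s); auto; lra|].
  pose proof nvs_m_pos as M0.
  assert (K0 : 0 <= K).
  { pose proof (Bh 1 0 (Rle_refl 1)) as B. pose proof (Cmod_ge_0 (h 0)).
    pose proof (cosh_gt_0 (1 * 0)). nra. }
  apply Rmult_le_compat_r; [pose proof (cosh_ge_1 (s * x)); lra|].
  apply Rmult_le_compat_r; auto.
  unfold Rdiv. rewrite <- (Rmult_1_r (m ^ 3)) at 2.
  apply Rmult_le_compat_l; [now apply pow_le|].
  rewrite <- Rinv_1. apply Rinv_le_contravar; nra.
Qed.

Lemma cosh_bounded_lin (c d : C) (K L : R) (h k : R -> C) :
  cosh_bounded K h -> cosh_bounded L k ->
  cosh_bounded (Cmod c * K + Cmod d * L) (fun x => (c * h x + d * k x)%C).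
Proof.
  intros [Ch Bh] [Ck Bk]. split.
  - intros x. apply continuous_Cplus; apply continuous_Cmult; auto using continuous_const.
  - intros s x Hs. eapply Rle_trans; [apply Cmod_triangle|]. rewrite !Cmod_mult.
    specialize (Bh s x Hs). specialize (Bk s x Hs).
    pose proof (Cmod_ge_0 c). pose proof (Cmod_ge_0 d). nra.
Qed.

(* With the weight [cosh (s x)] the operator [r J] at least halves the weighted sup norm. *)
Lemma exists_weight (r : R) : 0 <= r -> exists s, 1 <= s /\ r * (m ^ 3 / s ^ 2) <= / 2.
Proof.
  intros Hr. pose proof nvs_m_pos as M0.
  assert (P : 0 <= r * m ^ 3) by (apply Rmult_le_pos; auto; now apply pow_le).
  exists (2 * (r * m ^ 3) + 1). split; [lra|].
  set (a := r * m ^ 3) in *.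
  replace (r * (m ^ 3 / (2 * a + 1) ^ 2)) with (a / (2 * a + 1) ^ 2) by (unfold a, Rdiv; ring).
  apply (Rmult_le_reg_r ((2 * a + 1) ^ 2)); [nra|].
  unfold Rdiv. rewrite Rmult_assoc, Rinv_l by nra. nra.
Qed.

Definition neumann_term (mu : C) (h : R -> C) (x : R) (n : nat) : C := (mu ^ n * Jn F n h x)%C.

(** This is [(1 - mu J)^-1 h]; for a solution [h] of [h'' = q h] it solves [y'' = (q + mu) y]. *)
Definition neumann (mu : C) (h : R -> C) (x : R) : C := CSer (neumann_term mu h x).

(** A bound [r] replaces [Cmod mu] in the condition on [s], so that one weight serves a whole disc
    of values of [mu]. *)
Lemma neumann_term_bound (mu : C) (h : R -> C) (K r s x : R) (n : nat) :
  Cmod mu <= r -> 1 <= s -> r * (m ^ 3 / s ^ 2) <= / 2 -> cosh_bounded K h ->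
  Cmod (neumann_term mu h x n) <= K * cosh (s * x) * (/ 2) ^ n.
Proof.
  intros Hmu Hs Hr [Ch Bh]. unfold neumann_term. rewrite Cmod_mult, Cmod_Cpow.
  pose proof nvs_m_pos as M0. pose proof (Cmod_ge_0 mu) as Mu0.
  assert (W : 0 <= m ^ 3 / s ^ 2).
  { apply Rmult_le_pos; [now apply pow_le|]. apply Rlt_le, Rinv_0_lt_compat. nra. }
  assert (KC : 0 <= K * cosh (s * x)).
  { eapply Rle_trans; [apply (Cmod_ge_0 (h x))|]. now apply Bh. }
  eapply Rle_trans.
  - apply Rmult_le_compat_l; [now apply pow_le|]. apply (Jn_bound h K s n); auto. lra.
  - replace (Cmod mu ^ n * ((m ^ 3 / s ^ 2) ^ n * K * cosh (s * x)))
      with ((Cmod mu * (m ^ 3 / s ^ 2)) ^ n * (K * cosh (s * x))) by (rewrite Rpow_mult_distr; ring).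
    rewrite (Rmult_comm (K * cosh (s * x))). apply Rmult_le_compat_r; auto.
    apply pow_incr. split; [now apply Rmult_le_pos|].
    eapply Rle_trans; [|exact Hr]. now apply Rmult_le_compat_r.
Qed.

Lemma neumann_term_continuous (mu : C) (h : R -> C) (n : nat) (x : R) :
  (forall y, continuous h y) -> continuous (fun y => neumann_term mu h y n) x.
Proof.
  intros Ch. apply continuous_Cmult; [apply continuous_const | now apply Jn_continuous].
Qed.

Lemma neumann_tail (mu : C) (h : R -> C) (K r s x : R) (n : nat) :
  Cmod mu <= r -> 1 <= s -> r * (m ^ 3 / s ^ 2) <= / 2 -> cosh_bounded K h ->
  Cmod (neumann mu h x - sum_n (neumann_term mu h x) n)%C <= 2 * K * cosh (s * x) * (/ 2) ^ n.
Proof.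
  intros. rewrite (Rmult_assoc 2). apply CSer_tail. intros j. now apply (neumann_term_bound mu h K r).
Qed.

Lemma neumann_continuous (mu : C) (h : R -> C) (K x : R) :
  cosh_bounded K h -> continuous (neumann mu h) x.
Proof.
  intros Hh. destruct (exists_weight (Cmod mu) (Cmod_ge_0 mu)) as [s [Hs Hr]].
  apply continuous_C_eps. intros eps He.
  (* [B] dominates the weight on the ball of radius 1 around [x], which makes the tail uniform
     there. *)
  set (B := cosh (s * (Rabs x + 1))).
  destruct (half_pow_small (2 * K * B) (eps / 4) ltac:(lra)) as [n Hn]. specialize (Hn n (le_n _)).
  assert (T : forall y, Rabs y <= Rabs x + 1 ->
     Cmod (neumann mu h y - sum_n (neumann_term mu h y) n)%C < eps / 4).
  { intros y Hy. eapply Rle_lt_trans; [apply (neumann_tail mu h K (Cmod mu) s); auto; lra|].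
    eapply Rle_lt_trans; [|exact Hn].
    apply Rmult_le_compat_r; [apply pow_le; lra|]. apply Rmult_le_compat_l.
    - destruct Hh as [_ Bh]. pose proof (Bh 1 0 (Rle_refl 1)) as B0.
      pose proof (Cmod_ge_0 (h 0)). pose proof (cosh_gt_0 (1 * 0)). nra.
    - apply cosh_le_of_abs. rewrite !Rabs_mult. apply Rmult_le_compat_l; [apply Rabs_pos|].
      pose proof (Rabs_pos x). rewrite (Rabs_pos_eq (Rabs x + 1)) by lra. exact Hy. }
  assert (CS : continuous (fun y => sum_n (neumann_term mu h y) n) x).
  { apply (continuous_csum (fun k y => neumann_term mu h y k)). intros k.
    apply neumann_term_continuous, Hh. }
  pose proof (continuous_C_locally _ x (eps / 4) CS ltac:(lra)) as L1.
  assert (L2 : locally x (fun y => Rabs y <= Rabs x + 1)).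
  { exists (mkposreal 1 Rlt_0_1). intros y Hy. unfold ball in Hy; simpl in Hy.
    unfold AbsRing_ball, abs, minus, plus, opp in Hy; simpl in Hy.
    pose proof (Rabs_triang_inv y x). unfold Rminus in *. lra. }
  generalize (filter_and _ _ L1 L2). apply filter_imp. intros y [A1 A2].
  replace (neumann mu h y - neumann mu h x)%C with
    ((neumann mu h y - sum_n (neumann_term mu h y) n) +
     ((sum_n (neumann_term mu h y) n - sum_n (neumann_term mu h x) n) -
      (neumann mu h x - sum_n (neumann_term mu h x) n)))%C by ring.
  pose proof (T y A2) as T1. pose proof (T x ltac:(lra)) as T2.
  eapply Rle_lt_trans; [apply Cmod_triangle|].
  pose proof (Cmod_triangle (sum_n (neumann_term mu h y) n - sum_n (neumann_term mu h x) n)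
    (- (neumann mu h x - sum_n (neumann_term mu h x) n))) as T3. rewrite Cmod_opp in T3.
  unfold Cminus in *. lra.
Qed.

Lemma J_csum (a : nat -> R -> C) (n : nat) (x : R) :
  (forall k y, continuous (a k) y) ->
  J F (fun y => sum_n (fun k => a k y) n) x = sum_n (fun k => J F (a k) x) n.
Proof.
  intros Ha. induction n as [|n IH].
  - rewrite sum_n_0_C. apply (J_ext_on _ _ (Rabs x)); [lra|]. intros y _. apply sum_n_0_C.
  - rewrite sum_n_S_C, <- IH.
    transitivity (J F (fun y => (RtoC 1 * sum_n (fun k => a k y) n + RtoC 1 * a (S n) y)%C) x).
    + apply (J_ext_on _ _ (Rabs x)); [lra|]. intros y _. rewrite sum_n_S_C. ring.
    + rewrite J_lin; auto; [ring|]. intros y. now apply continuous_csum.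
Qed.

Lemma J_neumann_term (mu : C) (h : R -> C) (n : nat) (x : R) :
  (forall y, continuous h y) ->
  (mu * J F (fun y => neumann_term mu h y n) x)%C = neumann_term mu h x (S n).
Proof.
  intros Ch. unfold neumann_term. change (Jn F (S n) h x) with (J F (Jn F n h) x).
  transitivity (mu * J F (fun y => (mu ^ n * Jn F n h y + RtoC 0 * Jn F n h y)%C) x)%C.
  - apply (f_equal (Cmult mu)), (J_ext_on _ _ (Rabs x)); [lra|]. intros y _. ring.
  - rewrite J_lin by (now apply Jn_continuous). simpl. ring.
Qed.

(** The partial sums satisfy [h + mu J S_n = S_(n+1)], and [J] is bounded in the weighted norm, so
    that both sides pass to the limit. *)
Lemma neumann_fixpoint (mu : C) (h : R -> C) (K x : R) :
  cosh_bounded K h -> neumann mu h x = (h x + mu * J F (neumann mu h) x)%C.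
Proof.
  intros Hh. destruct (exists_weight (Cmod mu) (Cmod_ge_0 mu)) as [s [Hs Hr]].
  assert (CN : forall y, continuous (neumann mu h) y) by (intros; now apply (neumann_continuous _ _ K)).
  assert (CT : forall n y, continuous (fun y => neumann_term mu h y n) y)
    by (intros; apply neumann_term_continuous, Hh).
  assert (CS : forall n y, continuous (fun y => sum_n (neumann_term mu h y) n) y)
    by (intros n y; now apply (continuous_csum (fun k y => neumann_term mu h y k))).
  apply C_eq_of_Cmod_le_eps. intros eps He.
  set (A := 2 * K * cosh (s * x)). set (B := Cmod mu * (m ^ 3 / s ^ 2) * A).
  destruct (half_pow_small (A + B) eps He) as [n Hn]. specialize (Hn n (le_n _)).
  assert (E : (h x + mu * J F (fun y => sum_n (neumann_term mu h y) n) x)%C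
    = sum_n (neumann_term mu h x) (S n)).
  { rewrite (J_csum (fun k y => neumann_term mu h y k)) by auto.
    rewrite <- csum_scal. rewrite (csum_ext _ (fun k => neumann_term mu h x (S k))).
    2:{ intros k _. apply J_neumann_term, Hh. }
    clear. induction n as [|n IH].
    - rewrite sum_n_S_C, !sum_n_0_C. unfold neumann_term. simpl. ring.
    - rewrite sum_n_S_C, (sum_n_S_C _ (S n)), <- IH. ring. }
  assert (T : Cmod (J F (fun y => (RtoC 1 * neumann mu h y +
      (- RtoC 1) * sum_n (neumann_term mu h y) n)%C) x)
      <= m ^ 3 / s ^ 2 * (2 * K * (/ 2) ^ n) * cosh (s * x)).
  { apply J_bound; [lra| |].
    - intros y. apply continuous_Cplus; apply continuous_Cmult; auto using continuous_const.
    - intros y. replace (RtoC 1 * neumann mu h y + - RtoC 1 * sum_n (neumann_term mu h y) n)%C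
        with (neumann mu h y - sum_n (neumann_term mu h y) n)%C by ring.
      eapply Rle_trans; [apply (neumann_tail mu h K (Cmod mu) s); auto; lra|]. right; ring. }
  rewrite J_lin in T by auto.
  pose proof (neumann_tail mu h K (Cmod mu) s x (S n) (Rle_refl _) Hs Hr Hh) as T2.
  rewrite <- E in T2.
  replace (neumann mu h x - (h x + mu * J F (neumann mu h) x))%C with
    ((neumann mu h x - (h x + mu * J F (fun y => sum_n (neumann_term mu h y) n) x))
     - mu * (RtoC 1 * J F (neumann mu h) x + - RtoC 1 * J F (fun y => sum_n (neumann_term mu h y) n) x))%C
    by ring.
  eapply Rle_trans; [apply Cmod_triangle|]. rewrite Cmod_opp, Cmod_mult.
  assert (T3 : Cmod mu * Cmod (RtoC 1 * J F (neumann mu h) x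
      + - RtoC 1 * J F (fun y => sum_n (neumann_term mu h y) n) x)%C <= B * (/ 2) ^ n).
  { eapply Rle_trans; [apply Rmult_le_compat_l; [apply Cmod_ge_0 | exact T]|].
    right. unfold B, A. ring. }
  assert (T4 : 2 * K * cosh (s * x) * (/ 2) ^ S n <= A * (/ 2) ^ n).
  { fold A. assert (0 <= A).
    { apply Rle_trans with (2 * Cmod (h x)); [pose proof (Cmod_ge_0 (h x)); lra|].
      unfold A. destruct Hh as [_ Bh]. specialize (Bh s x Hs). lra. }
    apply Rmult_le_compat_l; auto. simpl. assert (0 < (/ 2) ^ n) by (apply pow_lt; lra). lra. }
  lra.
Qed.

(** Regularity is read off the fixpoint equation: the sum is [h] plus a multiple of a value of [J],
    and [J] produces solutions. The series is never differentiated term by term. *)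
Lemma neumann_solves (mu : C) (h g : R -> C) (K : R) :
  cosh_bounded K h -> solves b q g h ->
  solves b q (fun x => (g x + mu * neumann mu h x)%C) (neumann mu h).
Proof.
  intros Hh Hs.
  assert (CN : forall y, continuous (neumann mu h) y) by (intros; now apply (neumann_continuous _ _ K)).
  generalize (solves_lin (RtoC 1) mu g (neumann mu h) h _ Hs (J_solves _ CN)).
  apply solves_ext; intros x; [ring|]. rewrite (neumann_fixpoint mu h K x Hh). ring.
Qed.

Lemma neumann_lin (mu c d : C) (h k : R -> C) (K L x : R) :
  cosh_bounded K h -> cosh_bounded L k ->
  neumann mu (fun y => (c * h y + d * k y)%C) x = (c * neumann mu h x + d * neumann mu k x)%C.
Proof.
  intros Hh Hk. destruct (exists_weight (Cmod mu) (Cmod_ge_0 mu)) as [s [Hs Hr]].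
  unfold neumann. rewrite <- (CSer_lin _ _ c d (K * cosh (s * x)) (L * cosh (s * x))).
  - unfold CSer. f_equal; apply Series_ext; intros n; unfold neumann_term;
    rewrite Jn_lin by (apply Hh || apply Hk); f_equal; ring.
  - intros n. now apply (neumann_term_bound mu h K (Cmod mu) s x n (Rle_refl _)).
  - intros n. now apply (neumann_term_bound mu k L (Cmod mu) s x n (Rle_refl _)).
Qed.

(** ** Heat-type polynomials *)

(** On the segment these are the transmuted heat polynomials without their factorials: [h = F] gives
    the one of index [2 * n] divided by [(2 * n)!], and [h = second_solution F] the one of index
    [2 * n + 1] divided by [(2 * n + 1)!]. *)
Definition heat (h : R -> C) (n : nat) (x t : R) : C :=
  conv (fun j => RtoC (t ^ j / INR (fact j))) (fun k => Jn F k h x) n.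

Definition heat_term (mu : C) (h : R -> C) (x t : R) (n : nat) : C := (mu ^ n * heat h n x t)%C.

Definition heat_series (mu : C) (h : R -> C) (x t : R) : C := CSer (heat_term mu h x t).

(** Distributing [mu^n = mu^j mu^(n-j)] makes the generating series of the polynomials the Cauchy
    product of the exponential series of [mu t] and the Neumann series. *)
Lemma heat_term_conv (mu : C) (h : R -> C) (x t : R) (n : nat) :
  heat_term mu h x t n = conv (expterm (mu * RtoC t)) (neumann_term mu h x) n.
Proof.
  unfold heat_term, heat, conv. rewrite <- csum_scal. apply csum_ext. intros j Hj.
  unfold expterm, neumann_term. rewrite RtoC_div by apply INR_fact_neq_0.
  replace n with (j + (n - j))%nat at 1 by lia. rewrite Cpow_add_r, Cpow_mult_l, RtoC_pow.
  field. apply RtoC_fact_neq0.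
Qed.

Lemma heat_term_bound (mu : C) (h : R -> C) (K r s tau x t : R) (n : nat) :
  Cmod mu <= r -> 1 <= s -> r * (m ^ 3 / s ^ 2) <= / 2 -> cosh_bounded K h ->
  0 <= t <= tau ->
  Cmod (heat_term mu h x t n) <= 2 * exp (4 * (r * tau)) * (K * cosh (s * x)) * (/ 2) ^ n.
Proof.
  intros Hmu Hs Hr Hh Ht. rewrite heat_term_conv. apply conv_bound; intros j.
  - apply expterm_bound. rewrite Cmod_mult, Cmod_R, Rabs_pos_eq by lra.
    apply Rmult_le_compat; try lra. apply Cmod_ge_0.
  - now apply (neumann_term_bound mu h K r).
Qed.

Lemma heat_series_tail (mu : C) (h : R -> C) (K r s tau x t : R) (n : nat) :
  Cmod mu <= r -> 1 <= s -> r * (m ^ 3 / s ^ 2) <= / 2 -> cosh_bounded K h ->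
  0 <= t <= tau ->
  Cmod (heat_series mu h x t - sum_n (heat_term mu h x t) n)%C
    <= 2 * (2 * exp (4 * (r * tau)) * (K * cosh (s * x))) * (/ 2) ^ n.
Proof.
  intros Hmu Hs Hr Hh Ht. apply CSer_tail. intros j. now apply (heat_term_bound mu h K r).
Qed.

(** Separation of variables. The first factor is the complex exponential of [mu t]; it does not
    depend on [h], so two series whose Neumann sums agree at [x] agree there for all [t]. *)
Lemma heat_series_prod (mu : C) (h : R -> C) (K x t : R) :
  cosh_bounded K h ->
  heat_series mu h x t = (CSer (expterm (mu * RtoC t)) * neumann mu h x)%C.
Proof.
  intros Hh. destruct (exists_weight (Cmod mu) (Cmod_ge_0 mu)) as [s [Hs Hr]].
  unfold neumann. rewrite <- (CSer_conv _ _ (exp (4 * Cmod (mu * RtoC t))) (K * cosh (s * x))).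
  - unfold heat_series, CSer. f_equal; apply Series_ext; intros n; now rewrite heat_term_conv.
  - intros j. apply expterm_bound. lra.
  - intros j. now apply (neumann_term_bound mu h K (Cmod mu) s x j (Rle_refl _)).
Qed.

Lemma heat_series_R (mu : R) (h : R -> C) (K x t : R) :
  cosh_bounded K h ->
  heat_series (RtoC mu) h x t = (RtoC (exp (mu * t)) * neumann (RtoC mu) h x)%C.
Proof.
  intros Hh. rewrite (heat_series_prod _ _ K) by auto. now rewrite <- RtoC_mult, CSer_exp_R.
Qed.

Lemma heat_series_0 (mu : C) (h : R -> C) (K x : R) :
  cosh_bounded K h -> heat_series mu h x 0 = neumann mu h x.
Proof.
  intros Hh. rewrite (heat_series_prod _ _ K) by auto.
  replace (mu * RtoC 0)%C with (RtoC 0) by ring. rewrite CSer_exp_R, exp_0. ring.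
Qed.

End RightInverse.

(** ** Dirichlet problem with a large spectral coefficient *)

Lemma Cmod_sqr (z : C) : Cmod z ^ 2 = fst z ^ 2 + snd z ^ 2.
Proof. unfold Cmod. rewrite pow2_sqrt; nra. Qed.

Lemma dot_le_Cmod (w z : C) : fst w * fst z + snd w * snd z <= Cmod w * Cmod z.
Proof.
  pose proof (Cmod_sqr w) as W. pose proof (Cmod_sqr z) as Z.
  pose proof (Cmod_ge_0 w). pose proof (Cmod_ge_0 z).
  destruct (Rle_dec (fst w * fst z + snd w * snd z) 0) as [L | L]; [nra|].
  apply Rsqr_incr_0; [|lra|nra]. unfold Rsqr.
  replace (Cmod w * Cmod z * (Cmod w * Cmod z)) with (Cmod w ^ 2 * Cmod z ^ 2) by ring.
  rewrite W, Z. pose proof (pow2_ge_0 (fst w * snd z - snd w * fst z)). nra.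
Qed.

(* The mean value theorem is applied to the component of [G] along its increment. *)
Lemma Cder_increment_bound (G g : R -> C) (a c M : R) :
  a <= c -> (forall x, continuous G x) ->
  (forall x, a < x < c -> Cder G x (g x) /\ Cmod (g x) <= M) ->
  Cmod (G c - G a)%C <= (c - a) * M.
Proof.
  intros Hac HG Hg. destruct (Req_dec a c) as [<- | Hne].
  { replace (G a - G a)%C with (RtoC 0) by ring. rewrite Cmod_0. lra. }
  set (w := (G c - G a)%C).
  set (phi := fun x => fst w * fst (G x) + snd w * snd (G x)).
  (* The mean value theorem may return an endpoint, where [G] has no known derivative; there [dphi]
     takes the desired bound as its default value. *)
  pose (dphi := fun x => if Rlt_dec a x then if Rlt_dec x c
    then fst w * fst (g x) + snd w * snd (g x) else Cmod w * M else Cmod w * M).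
  assert (DB : forall x, dphi x <= Cmod w * M).
  { intros x. unfold dphi. destruct (Rlt_dec a x); [|lra]. destruct (Rlt_dec x c); [|lra].
    eapply Rle_trans; [apply dot_le_Cmod|]. apply Rmult_le_compat_l; [apply Cmod_ge_0|].
    now apply Hg. }
  destruct (MVT_gen phi a c dphi) as [z [_ E]].
  - intros x. rewrite Rmin_left, Rmax_right by lra. intros Hx. destruct (Hg x Hx) as [D _].
    unfold dphi. destruct (Rlt_dec a x); [|lra]. destruct (Rlt_dec x c); [|lra].
    apply (is_derive_plus (V := R_NormedModule)).
    + apply (is_derive_scal (fun y => fst (G y))). now apply Cder_fst.
    + apply (is_derive_scal (fun y => snd (G y))). now apply Cder_snd.
  - intros x _. apply continuity_pt_filterlim.
    apply (continuous_plus (V := R_NormedModule)); apply continuous_Rmult;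
    try apply continuous_const; [now apply continuous_fst_C | now apply continuous_snd_C].
  - specialize (DB z). pose proof (Cmod_sqr w) as W. pose proof (Cmod_ge_0 w) as W0.
    assert (E2 : phi c - phi a = fst w ^ 2 + snd w ^ 2).
    { unfold phi, w, Cminus, Cplus, Copp; cbn [fst snd]. ring. }
    rewrite E2, <- W in E.
    destruct (Req_dec (Cmod w) 0) as [Z | NZ].
    + rewrite Z in *.
      destruct (Hg ((a + c) / 2) ltac:(lra)) as [_ B]. pose proof (Cmod_ge_0 (g ((a + c) / 2))). nra.
    + apply (Rmult_le_reg_l (Cmod w)); [lra|]. nra.
Qed.

(** * Complex exponentials and hyperbolic functions *)

Definition cexp (z : C) : C := (exp (fst z) * cos (snd z), exp (fst z) * sin (snd z)).

Lemma cexp_add (z w : C) : cexp (z + w)%C = (cexp z * cexp w)%C.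
Proof.
  unfold cexp, Cplus, Cmult; cbn [fst snd]. rewrite exp_plus, cos_plus, sin_plus.
  apply (f_equal2 (@pair R R)); ring.
Qed.

Lemma cexp_0 : cexp (RtoC 0) = RtoC 1.
Proof. unfold cexp; simpl. rewrite exp_0, cos_0, sin_0. unfold RtoC. f_equal; ring. Qed.

Lemma Cmod_cexp (z : C) : Cmod (cexp z) = exp (fst z).
Proof.
  pose proof (exp_pos (fst z)) as P. pose proof (sin2_cos2 (snd z)) as S. unfold Rsqr in S.
  unfold cexp, Cmod; cbn [fst snd].
  replace ((exp (fst z) * cos (snd z)) ^ 2 + (exp (fst z) * sin (snd z)) ^ 2) with (exp (fst z) ^ 2).
  - apply sqrt_pow2. lra.
  - transitivity (exp (fst z) ^ 2 * (sin (snd z) * sin (snd z) + cos (snd z) * cos (snd z))).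
    rewrite S; ring. ring.
Qed.

Definition expk (k : C) (x : R) : C := cexp (k * RtoC x)%C.

Lemma expk_der (k : C) (x : R) : Cder (expk k) x (k * expk k x)%C.
Proof.
  destruct k as [xi eta]. unfold expk, cexp.
  apply (Cder_ext (fun y => (exp (xi * y) * cos (eta * y), exp (xi * y) * sin (eta * y))) _ _
    (exp (xi * x) * (xi * cos (eta * x) - eta * sin (eta * x)),
     exp (xi * x) * (xi * sin (eta * x) + eta * cos (eta * x)))).
  - intros y. unfold Cmult, RtoC; cbn [fst snd].
    replace (xi * y - eta * 0) with (xi * y) by ring.
    replace (xi * 0 + eta * y) with (eta * y) by ring. reflexivity.
  - unfold Cmult, RtoC; cbn [fst snd].
    replace (xi * x - eta * 0) with (xi * x) by ring.
    replace (xi * 0 + eta * x) with (eta * x) by ring. apply (f_equal2 (@pair R R)); ring.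
  - apply Cder_pair; auto_derive; auto; ring.
Qed.

Lemma expk_add (k : C) (x y : R) : expk k (x + y) = (expk k x * expk k y)%C.
Proof. unfold expk. rewrite <- cexp_add. f_equal. rewrite RtoC_plus. ring. Qed.

Lemma Cmod_expk (k : C) (x : R) : Cmod (expk k x) = exp (fst k * x).
Proof. unfold expk. rewrite Cmod_cexp. destruct k. unfold Cmult, RtoC; simpl. f_equal. ring. Qed.

Definition csinh (k : C) (x : R) : C := ((expk k x - expk k (- x)) / RtoC 2)%C.
Definition ccosh (k : C) (x : R) : C := ((expk k x + expk k (- x)) / RtoC 2)%C.

Lemma RtoC_2_neq0 : RtoC 2 <> RtoC 0.
Proof. intros H. apply RtoC_inj in H. lra. Qed.

Lemma Cder_comp_affine (f : R -> C) (c d x : R) (l : C) :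
  Cder f (c * x + d) l -> Cder (fun y => f (c * y + d)) x (RtoC c * l)%C.
Proof.
  intros H. pose proof (Cder_fst _ _ _ H) as H1. pose proof (Cder_snd _ _ _ H) as H2.
  assert (A : is_derive (fun y => c * y + d) x c) by (auto_derive; auto; ring).
  apply Cder_of_components.
  - generalize (is_derive_comp (fun y => fst (f y)) (fun y => c * y + d) x _ _ H1 A).
    apply is_derive_Rext; [reflexivity|]. unfold scal; simpl. unfold mult; simpl. ring.
  - generalize (is_derive_comp (fun y => snd (f y)) (fun y => c * y + d) x _ _ H2 A).
    apply is_derive_Rext; [reflexivity|]. unfold scal; simpl. unfold mult; simpl. ring.
Qed.

Lemma expk_neg_der (k : C) (x : R) : Cder (fun y => expk k (- y)) x (- (k * expk k (- x)))%C.
Proof.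
  generalize (Cder_comp_affine (expk k) (-1) 0 x _ (expk_der k (-1 * x + 0))).
  replace (-1 * x + 0) with (- x) by ring. apply Cder_ext.
  - intros y. f_equal. ring.
  - replace (RtoC (-1)) with (- RtoC 1)%C by (unfold RtoC, Copp; simpl; f_equal; ring). ring.
Qed.

Lemma csinh_der (k : C) (x : R) : Cder (csinh k) x (k * ccosh k x)%C.
Proof.
  generalize (Cder_scal (/ RtoC 2)%C _ _ _ (Cder_minus _ _ _ _ _ (expk_der k x) (expk_neg_der k x))).
  apply Cder_ext; intros; unfold csinh, ccosh; field; apply RtoC_2_neq0.
Qed.

Lemma ccosh_der (k : C) (x : R) : Cder (ccosh k) x (k * csinh k x)%C.
Proof.
  generalize (Cder_scal (/ RtoC 2)%C _ _ _ (Cder_plus _ _ _ _ _ (expk_der k x) (expk_neg_der k x))).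
  apply Cder_ext; intros; unfold csinh, ccosh; field; apply RtoC_2_neq0.
Qed.

Lemma csinh_0 (k : C) : csinh k 0 = RtoC 0.
Proof. unfold csinh. rewrite Ropp_0. unfold Cdiv. ring. Qed.

Lemma csinh_add (k : C) (x y : R) :
  csinh k (x + y) = (csinh k x * ccosh k y + ccosh k x * csinh k y)%C.
Proof.
  unfold csinh, ccosh. rewrite Ropp_plus_distr, !expk_add. field.
Qed.

Lemma csinh_upper (k : C) (x : R) : Cmod (csinh k x) <= exp (Rabs (fst k) * Rabs x).
Proof.
  unfold csinh. rewrite Cmod_div by apply RtoC_2_neq0. rewrite Cmod_R, (Rabs_pos_eq 2) by lra.
  pose proof (Cmod_triangle (expk k x) (- expk k (- x))) as T. rewrite Cmod_opp, !Cmod_expk in T.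
  assert (A : forall z, Rabs z <= Rabs x -> exp (fst k * z) <= exp (Rabs (fst k) * Rabs x)).
  { intros z Hz. apply exp_le. eapply Rle_trans; [apply Rle_abs|]. rewrite Rabs_mult.
    apply Rmult_le_compat_l; auto using Rabs_pos. }
  pose proof (A x (Rle_refl _)). pose proof (A (- x)). rewrite Rabs_Ropp in H0.
  specialize (H0 (Rle_refl _)). unfold Cminus. lra.
Qed.

(** For [q = 0] the Dirichlet eigenvalues are the squares of the nonzero zeros of [sinh (2 b k)],
    namely [2 b k = i n pi]. Away from them either the real part of [2 b k] is not small or its
    imaginary part is not near a multiple of [pi]. *)
Definition off_spectrum (b : R) (k : C) : Prop :=
  1 <= 2 * b * Rabs (fst k) \/ 1 / 2 <= Rabs (sin (2 * b * snd k)).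

(** In the first case one exponential is at least twice the other in modulus. In the second the
    imaginary part alone suffices: it is [cosh (2 b xi) sin (2 b eta)] for [k = xi + i eta]. *)
Lemma csinh_lower (b : R) (k : C) : 0 < b -> off_spectrum b k ->
  exp (2 * b * Rabs (fst k)) / 4 <= Cmod (csinh k (2 * b)).
Proof.
  intros Hb Hk. unfold csinh. unfold off_spectrum in Hk. rewrite Cmod_div by apply RtoC_2_neq0.
  rewrite Cmod_R, (Rabs_pos_eq 2) by lra.
  set (A := 2 * b * Rabs (fst k)) in *.
  enough (exp A / 2 <= Cmod (expk k (2 * b) - expk k (- (2 * b)))%C) by lra.
  destruct Hk as [Hk | Hk].
  - assert (E1 : exp (- A) <= exp A / 2).
    { rewrite exp_Ropp. pose proof (exp_ineq1_le A). pose proof (exp_pos A).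
      apply (Rmult_le_reg_r (exp A)); [lra|]. rewrite Rinv_l by lra.
      assert (2 <= exp A) by lra. nra. }
    unfold A, Rabs in *. destruct (Rcase_abs (fst k)).
    + pose proof (Cmod_triangle (- (expk k (2 * b) - expk k (- (2 * b)))) (expk k (2 * b))) as T.
      replace (- (expk k (2 * b) - expk k (- (2 * b))) + expk k (2 * b))%C
        with (expk k (- (2 * b))) in T by ring.
      rewrite Cmod_opp, !Cmod_expk in T.
      replace (fst k * - (2 * b)) with (2 * b * - fst k) in T by ring.
      replace (fst k * (2 * b)) with (- (2 * b * - fst k)) in T by ring. lra.
    + pose proof (Cmod_triangle (expk k (2 * b) - expk k (- (2 * b))) (expk k (- (2 * b)))) as T.
      replace (expk k (2 * b) - expk k (- (2 * b)) + expk k (- (2 * b)))%C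
        with (expk k (2 * b)) in T by ring.
      rewrite !Cmod_expk in T.
      replace (fst k * - (2 * b)) with (- (2 * b * fst k)) in T by ring.
      replace (fst k * (2 * b)) with (2 * b * fst k) in T by ring. lra.
  - eapply Rle_trans; [|apply Cmod_snd_le].
    assert (E : snd (expk k (2 * b) - expk k (- (2 * b)))%C
      = 2 * cosh (2 * b * fst k) * sin (2 * b * snd k)).
    { destruct k as [xi eta]. unfold expk, cexp, Cminus, Cplus, Copp, Cmult, RtoC, cosh; cbn [fst snd].
      replace (xi * (2 * b) - eta * 0) with (2 * b * xi) by ring.
      replace (xi * - (2 * b) - eta * 0) with (- (2 * b * xi)) by ring.
      replace (xi * 0 + eta * (2 * b)) with (2 * b * eta) by ring.
      replace (xi * 0 + eta * - (2 * b)) with (- (2 * b * eta)) by ring. rewrite sin_neg. lra. }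
    rewrite E, !Rabs_mult, (Rabs_pos_eq 2), (Rabs_pos_eq (cosh _)) by (try lra; apply Rlt_le, cosh_gt_0).
    pose proof (cosh_ge_exp (2 * b * fst k)) as CE. rewrite Rabs_mult, (Rabs_pos_eq (2 * b)) in CE by lra.
    fold A in CE. pose proof (exp_pos A). nra.
Qed.

(** * A priori bounds and solvability *)

Section Dirichlet.

Context (b : R) (hb : 0 < b) (q F F1 : R -> C) (m : R) (HF : nonvanishing_solution b q F F1 m).
Context (Q : R) (HQ : forall x, -b <= x <= b -> Cmod (q x) <= Q).

(* [csinh k (x + b)] and [csinh k (b - x)] are the left and right factors of the Green function. *)
Lemma green_bound (k : C) (g y : R -> C) (B : R) :
  k <> RtoC 0 -> off_spectrum b k -> (forall x, continuous g x) ->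
  (forall x, continuous y x) ->
  (exists y1 : R -> C, (forall x, continuous y1 x) /\
     forall x, -b < x < b -> Cder y x (y1 x) /\ Cder y1 x (k * k * y x + g x)%C) ->
  y (- b) = RtoC 0 -> y b = RtoC 0 ->
  (forall x, -b <= x <= b -> Cmod (g x) <= B) ->
  forall x, -b <= x <= b -> Cmod (y x) <= 16 * b / Cmod k * B.
Proof.
  intros Hk Gk Cg Cy [y1 [Cy1 Dy]] Yl Yr HB x Hx.
  set (L := fun s => csinh k (1 * s + b)). set (L1 := fun s => (k * ccosh k (1 * s + b))%C).
  set (T := fun s => csinh k (-1 * s + b)). set (T1 := fun s => (- (k * ccosh k (-1 * s + b)))%C).
  assert (N1 : RtoC (-1) = (- RtoC 1)%C) by (unfold RtoC, Copp; simpl; f_equal; ring).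
  assert (DL : forall s, Cder L s (L1 s)).
  { intros s. generalize (Cder_comp_affine _ 1 b s _ (csinh_der k (1 * s + b))).
    apply Cder_ext; [reflexivity | unfold L1; ring]. }
  assert (DL1 : forall s, Cder L1 s (k * k * L s)%C).
  { intros s. generalize (Cder_scal k _ _ _ (Cder_comp_affine _ 1 b s _ (ccosh_der k (1 * s + b)))).
    apply Cder_ext; [reflexivity | unfold L; ring]. }
  assert (DT : forall s, Cder T s (T1 s)).
  { intros s. generalize (Cder_comp_affine _ (-1) b s _ (csinh_der k (-1 * s + b))).
    apply Cder_ext; [reflexivity | unfold T1; rewrite N1; ring]. }
  assert (DT1 : forall s, Cder T1 s (k * k * T s)%C).
  { intros s.
    generalize (Cder_scal (- k)%C _ _ _ (Cder_comp_affine _ (-1) b s _ (ccosh_der k (-1 * s + b)))).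
    apply Cder_ext; [intros; unfold T1; ring | unfold T; rewrite N1; ring]. }
  assert (CL : forall s, continuous L s) by (intros; eapply Cder_continuous, DL).
  assert (CL1 : forall s, continuous L1 s) by (intros; eapply Cder_continuous, DL1).
  assert (CT : forall s, continuous T s) by (intros; eapply Cder_continuous, DT).
  assert (CT1 : forall s, continuous T1 s) by (intros; eapply Cder_continuous, DT1).
  (* Wronskians of [y] with the two factors. Their derivatives are [L g] and [T g], and each
     vanishes at the endpoint where its factor and [y] both vanish. *)
  set (W1 := fun s => (L s * y1 s - L1 s * y s)%C). set (W2 := fun s => (T s * y1 s - T1 s * y s)%C).
  assert (DW1 : forall s, -b < s < b -> Cder W1 s (L s * g s)%C).
  { intros s Hs. destruct (Dy s Hs) as [D1 D2].
    generalize (Cder_minus _ _ _ _ _ (Cder_mult _ _ _ _ _ (DL s) D2) (Cder_mult _ _ _ _ _ (DL1 s) D1)).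
    apply Cder_ext; [reflexivity | ring]. }
  assert (DW2 : forall s, -b < s < b -> Cder W2 s (T s * g s)%C).
  { intros s Hs. destruct (Dy s Hs) as [D1 D2].
    generalize (Cder_minus _ _ _ _ _ (Cder_mult _ _ _ _ _ (DT s) D2) (Cder_mult _ _ _ _ _ (DT1 s) D1)).
    apply Cder_ext; [reflexivity | ring]. }
  assert (CW1 : forall s, continuous W1 s)
    by (intros; apply continuous_Cminus; apply continuous_Cmult; auto).
  assert (CW2 : forall s, continuous W2 s)
    by (intros; apply continuous_Cminus; apply continuous_Cmult; auto).
  set (xi := Rabs (fst k)). assert (Xi : 0 <= xi) by apply Rabs_pos.
  assert (BL : forall s, -b <= s <= x -> Cmod (L s) <= exp (xi * (x + b))).
  { intros s Hs. eapply Rle_trans; [apply csinh_upper|]. apply exp_le. fold xi.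
    rewrite Rabs_pos_eq by lra. apply Rmult_le_compat_l; lra. }
  assert (BT : forall s, x <= s <= b -> Cmod (T s) <= exp (xi * (b - x))).
  { intros s Hs. eapply Rle_trans; [apply csinh_upper|]. apply exp_le. fold xi.
    rewrite Rabs_pos_eq by lra. apply Rmult_le_compat_l; lra. }
  assert (B0 : 0 <= B) by (eapply Rle_trans; [apply Cmod_ge_0 | apply (HB x Hx)]).
  assert (EL0 : L (- b) = RtoC 0).
  { unfold L. replace (1 * - b + b) with 0 by ring. apply csinh_0. }
  assert (ET0 : T b = RtoC 0).
  { unfold T. replace (-1 * b + b) with 0 by ring. apply csinh_0. }
  assert (I1 : Cmod (W1 x) <= 2 * b * (exp (xi * (x + b)) * B)).
  { replace (W1 x) with (W1 x - W1 (- b)%R)%C by (unfold W1 at 2; rewrite EL0, Yl; ring).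
    eapply Rle_trans; [apply (Cder_increment_bound W1 (fun s => (L s * g s)%C) (- b) x
      (exp (xi * (x + b)) * B)); [lra | auto |]|].
    - intros s Hs. split; [apply DW1; lra|]. rewrite Cmod_mult.
      apply Rmult_le_compat; auto using Cmod_ge_0. apply BL; lra. apply HB; lra.
    - apply Rmult_le_compat_r; [|lra]. apply Rmult_le_pos; auto. apply Rlt_le, exp_pos. }
  assert (I2 : Cmod (W2 x) <= 2 * b * (exp (xi * (b - x)) * B)).
  { rewrite <- Cmod_opp.
    replace (- W2 x)%C with (W2 b - W2 x)%C by (unfold W2 at 1; rewrite ET0, Yr; ring).
    eapply Rle_trans; [apply (Cder_increment_bound W2 (fun s => (T s * g s)%C) x b
      (exp (xi * (b - x)) * B)); [lra | auto |]|].
    - intros s Hs. split; [apply DW2; lra|]. rewrite Cmod_mult.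
      apply Rmult_le_compat; auto using Cmod_ge_0. apply BT; lra. apply HB; lra.
    - apply Rmult_le_compat_r; [|lra]. apply Rmult_le_pos; auto. apply Rlt_le, exp_pos. }
  (* Eliminating [y1] leaves [y] times the Wronskian of the two factors, which the addition formula
     makes constant in [x]. *)
  assert (E : (- (k * csinh k (2 * b) * y x))%C = (T x * W1 x - L x * W2 x)%C).
  { unfold W1, W2, T1, L1. replace (2 * b) with ((1 * x + b) + (-1 * x + b)) by ring.
    rewrite csinh_add. fold (L x) (T x). ring. }
  (* The growth of the two factors multiplies to [exp (2 b xi)], independent of [x]; the lower bound
     of [csinh] compensates it exactly. *)
  assert (M : Cmod k * Cmod (csinh k (2 * b)) * Cmod (y x) <= 4 * b * exp (2 * b * xi) * B).
  { rewrite <- !Cmod_mult, <- Cmod_opp, E. eapply Rle_trans; [apply Cmod_triangle|].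
    rewrite Cmod_opp, !Cmod_mult.
    replace (2 * b * xi) with (xi * (b - x) + xi * (x + b)) by ring. rewrite exp_plus.
    pose proof (BL x ltac:(lra)) as BLx. pose proof (BT x ltac:(lra)) as BTx.
    pose proof (Cmod_ge_0 (T x)) as T0. pose proof (Cmod_ge_0 (L x)) as L0.
    pose proof (Cmod_ge_0 (W1 x)) as W10. pose proof (Cmod_ge_0 (W2 x)) as W20.
    pose proof (Rmult_le_compat _ _ _ _ T0 W10 BTx I1) as P1.
    pose proof (Rmult_le_compat _ _ _ _ L0 W20 BLx I2) as P2.
    eapply Rle_trans; [apply Rplus_le_compat; [exact P1 | exact P2]|]. right; ring. }
  pose proof (csinh_lower b k hb Gk) as LB. fold xi in LB.
  assert (K0 : 0 < Cmod k) by now apply Cmod_gt_0.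
  pose proof (exp_pos (2 * b * xi)) as EP. pose proof (Cmod_ge_0 (y x)) as Y0.
  set (e := exp (2 * b * xi)) in *.
  assert (M2 : Cmod k * (e / 4) * Cmod (y x) <= 4 * b * e * B).
  { eapply Rle_trans; [|exact M]. apply Rmult_le_compat_r; auto. apply Rmult_le_compat_l; lra. }
  apply (Rmult_le_reg_l (Cmod k * (e / 4))); [apply Rmult_lt_0_compat; lra|].
  eapply Rle_trans; [exact M2|]. right. field. lra.
Qed.

(** The term [q y] is moved to the right-hand side. At a maximum of [Cmod y] it contributes at most
    half of that maximum, because [32 * b * Q <= Cmod k]; absorbing it doubles the constant of the
    case [q = 0]. *)
Lemma apriori_bound (k : C) (h y : R -> C) (B : R) :
  k <> RtoC 0 -> off_spectrum b k -> 32 * b * Q <= Cmod k -> (forall x, continuous h x) ->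
  solves b q (fun x => (k * k * y x + h x)%C) y ->
  y (- b) = RtoC 0 -> y b = RtoC 0 ->
  (forall x, -b <= x <= b -> Cmod (h x) <= B) ->
  forall x, -b <= x <= b -> Cmod (y x) <= 32 * b / Cmod k * B.
Proof.
  intros Hk Gk HkQ Ch [Cy [y1 [Cy1 Dy]]] Yl Yr HB.
  assert (K0 : 0 < Cmod k) by now apply Cmod_gt_0.
  destruct (continuity_ab_maj (fun x => Cmod (y x)) (- b) b) as [xm [Hm Hxm]]; [lra| |].
  { intros x _. apply continuity_pt_filterlim. now apply continuous_Cmod. }
  assert (H : Cmod (y xm) <= 16 * b / Cmod k * (Q * Cmod (y xm) + B)).
  { apply (green_bound k (fun x => (q x * y x + h x)%C) y); auto.
    - intros x. apply continuous_Cplus; auto. apply continuous_Cmult; auto.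
      apply (nvs_q _ _ _ _ _ HF).
    - exists y1. split; auto. intros x Hx. destruct (Dy x Hx) as [A D]. split; auto.
      revert D. apply Cder_ext; [reflexivity | ring].
    - intros x Hx. eapply Rle_trans; [apply Cmod_triangle|]. rewrite Cmod_mult.
      apply Rplus_le_compat; auto. apply Rmult_le_compat; auto using Cmod_ge_0. }
  intros x Hx. apply Rle_trans with (1 := Hm x Hx).
  apply (Rmult_le_reg_l (Cmod k)); auto.
  apply (Rmult_le_compat_l (Cmod k)) in H; [|lra].
  replace (Cmod k * (16 * b / Cmod k * (Q * Cmod (y xm) + B)))
    with (16 * b * Q * Cmod (y xm) + 16 * b * B) in H by (field; lra).
  replace (Cmod k * (32 * b / Cmod k * B)) with (32 * b * B) by (field; lra).
  pose proof (Cmod_ge_0 (y xm)). nra.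
Qed.

Definition homogeneous (A B : C) (x : R) : C := (A * F x + B * second_solution F x)%C.

Lemma homogeneous_cosh_bounded (A B : C) :
  cosh_bounded (Cmod A * m + Cmod B * (m * m)) (homogeneous A B).
Proof.
  apply cosh_bounded_lin.
  - exact (F_cosh_bounded _ _ _ _ _ HF).
  - exact (second_solution_cosh_bounded _ _ _ _ _ HF).
Qed.

Lemma homogeneous_solves (A B : C) : solves b q (fun _ => RtoC 0) (homogeneous A B).
Proof.
  generalize (solves_lin b q A B _ _ _ _ (F_solves _ _ _ _ _ HF) (second_solution_solves _ _ _ _ _ HF)).
  apply solves_ext; [intros; ring | reflexivity].
Qed.

Lemma J_zero (x : R) : J F (fun _ => RtoC 0) x = RtoC 0.
Proof.
  transitivity (J F (fun y => (RtoC 0 * F y + RtoC 0 * F y)%C) x).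
  - apply (J_ext_on _ _ _ (Rabs x)); [lra|]. intros; ring.
  - rewrite (J_lin _ _ _ _ _ HF) by apply (nvs_F _ _ _ _ _ HF). ring.
Qed.

(** After division by [F] the value at [0] determines [A] and the derivative at [0] determines
    [B]. *)
Lemma homogeneous_zero (A B : C) :
  (forall x, -b <= x <= b -> homogeneous A B x = RtoC 0) -> A = RtoC 0 /\ B = RtoC 0.
Proof.
  intros H. pose proof (nvs_neq _ _ _ _ _ HF) as NZ.
  assert (E : forall x, -b <= x <= b -> (A + B * prim (inv_sq F) x)%C = RtoC 0).
  { intros x Hx. specialize (H x Hx). unfold homogeneous, second_solution in H.
    replace (A + B * prim (inv_sq F) x)%C with
      ((A * F x + B * (F x * prim (inv_sq F) x)) / F x)%C by (field; apply NZ).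
    rewrite H. unfold Cdiv. ring. }
  assert (A0 : A = RtoC 0).
  { specialize (E 0 ltac:(lra)). rewrite prim_0 in E. rewrite <- E. ring. }
  split; auto. subst A.
  pose proof (prim_der (inv_sq F) 0 (inv_sq_continuous _ _ _ _ _ HF)) as D.
  pose proof (Cder_scal B _ _ _ D) as D1.
  assert (D2 : Cder (fun y => (B * prim (inv_sq F) y)%C) 0 (RtoC 0)).
  { apply (Cder_ext_interval (fun _ => RtoC 0) _ (- b) b); [lra | | apply Cder_const].
    intros y Hy. rewrite <- (E y) by lra. ring. }
  pose proof (Cder_unique _ _ _ _ D1 D2) as U. unfold inv_sq in U.
  replace B with (B * / (F 0 * F 0) * (F 0 * F 0))%C by (field; apply NZ).
  rewrite U. ring.
Qed.

(** The a priori bound with zero right-hand side makes the Neumann sum vanish on the segment; the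
    fixpoint equation then leaves [homogeneous A B = 0] there. *)
Lemma dirichlet_unique (k A B : C) :
  k <> RtoC 0 -> off_spectrum b k -> 32 * b * Q <= Cmod k ->
  neumann F (k * k) (homogeneous A B) (- b) = RtoC 0 ->
  neumann F (k * k) (homogeneous A B) b = RtoC 0 ->
  A = RtoC 0 /\ B = RtoC 0.
Proof.
  intros Hk Gk HkQ Yl Yr.
  pose proof (homogeneous_cosh_bounded A B) as CB.
  pose proof (neumann_solves _ _ _ _ _ HF (k * k)%C _ _ _ CB (homogeneous_solves A B)) as S.
  set (y := neumann F (k * k) (homogeneous A B)) in *.
  assert (Z : forall x, -b <= x <= b -> y x = RtoC 0).
  { intros x Hx. apply Cmod_eq_0. apply Rle_antisym; [|apply Cmod_ge_0].
    rewrite <- (Rmult_0_r (32 * b / Cmod k)).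
    apply (apriori_bound k (fun _ => RtoC 0) y); auto.
    - intros; apply continuous_const.
    - revert S. apply solves_ext; [intros; ring | reflexivity].
    - intros; rewrite Cmod_0; lra. }
  apply homogeneous_zero. intros x Hx.
  pose proof (neumann_fixpoint _ _ _ _ _ HF (k * k)%C _ _ x CB) as E. fold y in E.
  rewrite Z in E by auto.
  rewrite (J_ext_on F y (fun _ => RtoC 0) b x) in E.
  - rewrite J_zero in E. rewrite E. ring.
  - apply Rabs_le. lra.
  - intros z Hz. apply Z. now apply Rabs_le_between.
Qed.

(** The map from the coefficients to the two boundary values is linear on a plane, so uniqueness
    gives a nonzero determinant and Cramer's rule gives the solution. *)
Lemma dirichlet_solvable (k cl cr : C) :
  k <> RtoC 0 -> off_spectrum b k -> 32 * b * Q <= Cmod k ->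
  exists A B, neumann F (k * k) (homogeneous A B) (- b) = cl /\
    neumann F (k * k) (homogeneous A B) b = cr.
Proof.
  intros Hk Gk HkQ.
  assert (LIN : forall A B x, neumann F (k * k) (homogeneous A B) x =
    (A * neumann F (k * k) F x + B * neumann F (k * k) (second_solution F) x)%C).
  { intros A B x. apply (neumann_lin _ _ _ _ _ HF _ _ _ _ _ m (m * m)).
    - exact (F_cosh_bounded _ _ _ _ _ HF).
    - exact (second_solution_cosh_bounded _ _ _ _ _ HF). }
  pose proof (fun A B => dirichlet_unique k A B Hk Gk HkQ) as U.
  set (u := neumann F (k * k) F) in *. set (v := neumann F (k * k) (second_solution F)) in *.
  (* With a zero determinant the pairs [(v b, - u b)] and [(v (- b), - u (- b))] lie in the kernel,
     hence vanish; then [(1, 0)] lies in the kernel as well, which is absurd. *)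
  assert (D : (u (- b)%R * v b - u b * v (- b)%R)%C <> RtoC 0).
  { intros D0.
    assert (Z1 : v b = RtoC 0 /\ (- u b)%C = RtoC 0).
    { apply U; rewrite LIN.
      - rewrite <- D0. ring.
      - ring. }
    assert (Z2 : v (- b) = RtoC 0 /\ (- u (- b)%R)%C = RtoC 0).
    { apply U; rewrite LIN.
      - ring.
      - replace (v (- b)%R * u b + - u (- b)%R * v b)%C
          with (- (u (- b)%R * v b - u b * v (- b)%R))%C by ring.
        rewrite D0. ring. }
    destruct Z1 as [V1 U1], Z2 as [V2 U2].
    destruct (U (RtoC 1) (RtoC 0)) as [O _].
    - rewrite LIN. replace (u (- b)%R) with (- (- u (- b)%R))%C by ring. rewrite U2. ring.
    - rewrite LIN. replace (u b) with (- (- u b))%C by ring. rewrite U1. ring.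
    - apply RtoC_inj in O. lra. }
  exists ((cl * v b - cr * v (- b)%R) / (u (- b)%R * v b - u b * v (- b)%R))%C,
    ((cr * u (- b)%R - cl * u b) / (u (- b)%R * v b - u b * v (- b)%R))%C.
  rewrite !LIN. split; field; exact D.
Qed.

End Dirichlet.

(** ** Weierstrass approximation *)

(* Expectation of [phi (S_n)] for a binomial variable [S_n] with success probability [x]. *)
Fixpoint bernstein (n : nat) (phi : nat -> C) (x : R) : C :=
  match n with
  | O => phi O
  | S p => (RtoC x * bernstein p (fun k => phi (S k)) x + RtoC (1 - x) * bernstein p phi x)%C
  end.

(** The second moment about [a] is the variance plus the squared distance of [a] from the mean. The
    centre must be arbitrary for the induction: a success in one trial shifts it to [a - 1]. *)
Lemma bernstein_bound (n : nat) (phi : nat -> C) (a alpha beta x : R) :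
  0 <= x <= 1 ->
  (forall k, (k <= n)%nat -> Cmod (phi k) <= alpha + beta * (INR k - a) ^ 2) ->
  Cmod (bernstein n phi x) <= alpha + beta * (INR n * (x * (1 - x)) + (INR n * x - a) ^ 2).
Proof.
  intros Hx. revert phi a. induction n as [|n IH]; intros phi a H.
  - simpl bernstein. eapply Rle_trans; [now apply H|]. right. simpl. ring.
  - simpl bernstein. eapply Rle_trans; [apply Cmod_triangle|].
    rewrite !Cmod_mult, !Cmod_R, !Rabs_pos_eq by lra.
    assert (H1 := IH (fun k => phi (S k)) (a - 1)).
    assert (H2 := IH phi a). rewrite S_INR.
    eapply Rle_trans.
    + apply Rplus_le_compat; apply Rmult_le_compat_l; try lra.
      * apply H1. intros k Hk. eapply Rle_trans; [apply H; lia|]. rewrite S_INR. right; ring.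
      * apply H2. intros k Hk. apply H. lia.
    + right. ring.
Qed.

Lemma bernstein_minus_const (n : nat) (phi : nat -> C) (c : C) (x : R) :
  bernstein n (fun k => (phi k - c)%C) x = (bernstein n phi x - c)%C.
Proof.
  revert phi. induction n as [|n IH]; intros phi; simpl; [reflexivity|].
  rewrite !IH. rewrite RtoC_minus. ring.
Qed.

Definition cpoly (d : nat -> C) (n : nat) (x : R) : C := sum_n (fun j => (d j * RtoC (x ^ j))%C) n.

Lemma cpoly_shift (d : nat -> C) (n : nat) (x : R) :
  (RtoC x * cpoly d n x)%C = cpoly (fun j => match j with O => RtoC 0 | S i => d i end) (S n) x.
Proof.
  unfold cpoly. induction n as [|n IH].
  - rewrite sum_n_S_C, !sum_n_0_C. simpl. rewrite Rmult_1_r. ring.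
  - rewrite (sum_n_S_C _ (S n)), <- IH, sum_n_S_C. simpl. rewrite !RtoC_mult. ring.
Qed.

Lemma cpoly_extend (d : nat -> C) (n : nat) (x : R) :
  cpoly d n x = cpoly (fun j => if Nat.leb j n then d j else RtoC 0) (S n) x.
Proof.
  unfold cpoly. rewrite sum_n_S_C. replace (Nat.leb (S n) n) with false.
  - rewrite (csum_ext _ (fun j => ((if Nat.leb j n then d j else RtoC 0) * RtoC (x ^ j))%C)); [cring|].
    intros j Hj. apply Nat.leb_le in Hj. now rewrite Hj.
  - symmetry. apply Nat.leb_gt. lia.
Qed.

Lemma cpoly_lin (c e : C) (d d' : nat -> C) (n : nat) (x : R) :
  (c * cpoly d n x + e * cpoly d' n x)%C = cpoly (fun j => (c * d j + e * d' j)%C) n x.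
Proof.
  unfold cpoly. rewrite <- !csum_scal, <- csum_plus. apply csum_ext. intros; cring.
Qed.

Lemma bernstein_cpoly (n : nat) (phi : nat -> C) :
  exists d, forall x, bernstein n phi x = cpoly d n x.
Proof.
  revert phi. induction n as [|n IH]; intros phi.
  - exists phi. intros x. unfold cpoly. rewrite sum_n_0_C. simpl. ring.
  - destruct (IH phi) as [d Hd]. destruct (IH (fun k => phi (S k))) as [e He].
    eexists. intros x. simpl. rewrite Hd, He.
    transitivity (RtoC 1 * (RtoC 1 * (RtoC x * cpoly e n x) + (- RtoC 1) * (RtoC x * cpoly d n x))
      + RtoC 1 * cpoly d n x)%C.
    + rewrite RtoC_minus. ring.
    + rewrite !cpoly_shift, (cpoly_extend d), !cpoly_lin. reflexivity.
Qed.

(** Bernstein's argument: the difference of two values of [g] is at most [eps / 2] for close points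
    and [2 * M] otherwise, so it is always at most [eps / 2] plus a multiple of the squared
    distance, whose expectation is a variance. *)
Lemma weierstrass (g : R -> C) (eps : R) : (forall x, continuous g x) -> 0 < eps ->
  exists n d, forall x, 0 <= x <= 1 -> Cmod (g x - cpoly d n x)%C <= eps.
Proof.
  intros Cg He.
  destruct (continuity_ab_maj (fun x => Cmod (g x)) 0 1) as [xm [Hm _]]; [lra| |].
  { intros x _. apply continuity_pt_filterlim. now apply continuous_Cmod. }
  set (M := Cmod (g xm)) in *. assert (M0 : 0 <= M) by apply Cmod_ge_0.
  assert (E4 : 0 < eps / 4) by lra.
  assert (Cfst : forall x, 0 <= x <= 1 -> continuity_pt (fun x => fst (g x)) x).
  { intros x _. apply continuity_pt_filterlim. now apply continuous_fst_C. }
  destruct (Heine_cor2 Cfst (mkposreal (eps / 4) E4)) as [d1 H1].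
  assert (Csnd : forall x, 0 <= x <= 1 -> continuity_pt (fun x => snd (g x)) x).
  { intros x _. apply continuity_pt_filterlim. now apply continuous_snd_C. }
  destruct (Heine_cor2 Csnd (mkposreal (eps / 4) E4)) as [d2 H2].
  simpl in H1, H2.
  set (dl := Rmin d1 d2). assert (D0 : 0 < dl) by (apply Rmin_pos; apply cond_pos).
  set (K := 2 * M / dl ^ 2).
  assert (K0 : 0 <= K) by (apply Rmult_le_pos; [lra | apply Rlt_le, Rinv_0_lt_compat; nra]).
  assert (KB : forall x y, 0 <= x <= 1 -> 0 <= y <= 1 ->
    Cmod (g y - g x)%C <= eps / 2 + K * (y - x) ^ 2).
  { intros x y Hx Hy. destruct (Rlt_dec (Rabs (y - x)) dl) as [L | L].
    - assert (Cmod (g y - g x)%C <= eps / 2); [|pose proof (pow2_ge_0 (y - x)); nra].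
      eapply Rle_trans; [apply Cmod_le_parts|]. unfold Cminus, Cplus, Copp; cbn [fst snd].
      assert (L1 : Rabs (y - x) < d1) by (pose proof (Rmin_l d1 d2); unfold dl in L; lra).
      assert (L2 : Rabs (y - x) < d2) by (pose proof (Rmin_r d1 d2); unfold dl in L; lra).
      specialize (H1 y x Hy Hx L1). specialize (H2 y x Hy Hx L2). unfold Rminus in *. lra.
    - assert (Cmod (g y - g x)%C <= 2 * M).
      { eapply Rle_trans; [apply Cmod_triangle|]. rewrite Cmod_opp.
        pose proof (Hm x Hx). pose proof (Hm y Hy). simpl in *. fold M in H, H0. lra. }
      assert (dl ^ 2 <= (y - x) ^ 2).
      { rewrite <- (pow2_abs (y - x)). apply pow_incr. lra. }
      assert (2 * M <= K * (y - x) ^ 2).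
      { replace (2 * M) with (K * dl ^ 2) by (unfold K; field; lra). now apply Rmult_le_compat_l. }
      lra. }
  destruct (archimed_cor1 (eps / 2 / (K + 1))) as [n [Hn Pn]].
  { apply Rdiv_lt_0_compat; lra. }
  assert (N0 : 0 < INR n) by now apply lt_0_INR.
  destruct (bernstein_cpoly n (fun k => g (INR k / INR n))) as [d Hd].
  exists n, d. intros x Hx. rewrite <- Hd, <- Cmod_opp.
  replace (- (g x - bernstein n (fun k => g (INR k / INR n)%R) x))%C
    with (bernstein n (fun k => g (INR k / INR n)%R) x - g x)%C by ring.
  rewrite <- bernstein_minus_const.
  (* With the centre at the mean only the variance is left, and it contributes at most
     [K / INR n]. *)
  eapply Rle_trans; [apply (bernstein_bound n _ (INR n * x) (eps / 2) (K / INR n ^ 2)); auto|].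
  - intros k Hk. eapply Rle_trans; [apply KB; auto|].
    + split; [apply Rmult_le_pos; [apply pos_INR | now apply Rlt_le, Rinv_0_lt_compat]|].
      apply (Rmult_le_reg_r (INR n)); auto. unfold Rdiv. rewrite Rmult_assoc, Rinv_l, !Rmult_1_r, Rmult_1_l by lra.
      now apply le_INR.
    + right. field. lra.
  - replace (INR n * x - INR n * x) with 0 by ring.
    replace (K / INR n ^ 2 * (INR n * (x * (1 - x)) + 0 ^ 2)) with (K * / INR n * (x * (1 - x)))
      by (field; lra).
    assert (A : K * / INR n <= eps / 2).
    { apply Rle_trans with ((K + 1) * / INR n).
      - apply Rmult_le_compat_r; [now apply Rlt_le, Rinv_0_lt_compat | lra].
      - apply (Rmult_lt_compat_l (K + 1)) in Hn; [|lra].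
        replace ((K + 1) * (eps / 2 / (K + 1))) with (eps / 2) in Hn by (field; lra). lra. }
    assert (B : 0 <= K * / INR n) by (apply Rmult_le_pos; auto; now apply Rlt_le, Rinv_0_lt_compat).
    assert (0 <= x * (1 - x) <= 1) by nra. nra.
Qed.

(** ** Maximum principle *)

Lemma continuous_slice_x {V : UniformSpace} (g : R * R -> V) (x t : R) :
  continuous g (x, t) -> continuous (fun y => g (y, t)) x.
Proof.
  intros H. apply (continuous_comp (fun y : R => (y, t)) g); [|exact H].
  apply continuous_pair_C; [apply continuous_id | apply continuous_const].
Qed.

Lemma continuous_slice_t {V : UniformSpace} (g : R * R -> V) (x t : R) :
  continuous g (x, t) -> continuous (fun s => g (x, s)) t.
Proof.
  intros H. apply (continuous_comp (fun s : R => (x, s)) g); [|exact H].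
  apply continuous_pair_C; [apply continuous_const | apply continuous_id].
Qed.

(** One variable at a time: the maximum over [t] is continuous in [x], by uniform continuity of [g]
    on a rectangle, and so attains its own maximum. *)
Lemma rectangle_max (g : R * R -> R) (a b c d : R) : a <= b -> c <= d ->
  (forall p, continuous g p) ->
  exists p0, (a <= fst p0 <= b /\ c <= snd p0 <= d) /\
    forall p, a <= fst p <= b /\ c <= snd p <= d -> g p <= g p0.
Proof.
  intros Hab Hcd Cg.
  assert (SM : forall x, exists y, (c <= y <= d) /\ forall t, c <= t <= d -> g (x, t) <= g (x, y)).
  { intros x. destruct (continuity_ab_maj (fun t => g (x, t)) c d Hcd) as [y [Hy Hy']].
    - intros t _. apply continuity_pt_filterlim, (continuous_slice_t g), Cg.
    - exists y. split; auto. }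
  (* The least upper bound turns the maximal value into a function of [x] without a choice of
     maximizers. *)
  set (mu := fun x => real (Lub_Rbar (fun z => exists t, c <= t <= d /\ z = g (x, t)))).
  assert (Emu : forall x y, c <= y <= d -> (forall t, c <= t <= d -> g (x, t) <= g (x, y)) -> mu x = g (x, y)).
  { intros x y Hy H. unfold mu. rewrite (is_lub_Rbar_unique _ (Finite (g (x, y)))); [reflexivity|].
    split.
    - intros z [t [Ht ->]]. simpl. now apply H.
    - intros M HM. apply HM. now exists y. }
  assert (Cmu : forall x, a <= x <= b -> continuity_pt mu x).
  { intros x Hx. apply continuity_pt_filterlim. apply (filterlim_locally (U := R_UniformSpace)). intros eps.
    (* The margin of 1 in [x] admits points beyond an endpoint, since continuity at [a] and [b] is
       two-sided. *)
    destruct (uniform_continuity_2d (fun u v => g (u, v)) (a - 1) (b + 1) c d) with (eps := eps) as [dl Hd].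
    { intros u v _ _. apply continuity_2d_pt_filterlim.
      apply (continuous_ext g (fun z => g (fst z, snd z))); [now intros [? ?] | apply (Cg (u, v))]. }
    exists (mkposreal (Rmin dl 1) (Rmin_pos _ _ (cond_pos dl) Rlt_0_1)). intros y Hy.
    unfold ball in *; simpl in *. unfold AbsRing_ball, abs, minus, plus, opp in *; simpl in *.
    pose proof (Rmin_l dl 1). pose proof (Rmin_r dl 1).
    pose proof (Rabs_def2 _ _ Hy) as Hy2.
    destruct (SM x) as [tx [Htx Mx]]. destruct (SM y) as [ty [Hty My]].
    rewrite (Emu x tx Htx Mx), (Emu y ty Hty My).
    assert (P : forall t, c <= t <= d -> Rabs (g (y, t) - g (x, t)) < eps).
    { intros t Ht. apply Hd; try lra. unfold Rminus. lra. rewrite Rminus_diag, Rabs_R0. apply cond_pos. }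
    pose proof (Rabs_def2 _ _ (P tx Htx)). pose proof (Rabs_def2 _ _ (P ty Hty)).
    specialize (Mx ty Hty). specialize (My tx Htx). apply Rabs_def1; lra. }
  destruct (continuity_ab_maj mu a b Hab Cmu) as [x0 [Hx0 Ix0]].
  destruct (SM x0) as [y0 [Hy0 M0]]. exists (x0, y0). split; [simpl; auto|].
  intros [x t] [Hx Ht]; simpl in *. destruct (SM x) as [y [Hy My]].
  apply Rle_trans with (1 := My t Ht). rewrite <- (Emu x y Hy My), <- (Emu x0 y0 Hy0 M0). auto.
Qed.

Lemma left_max_derive (p : R -> R) (x r c : R) : 0 < r ->
  (forall y, x - r < y <= x -> p y <= p x) -> is_derive p x c -> 0 <= c.
Proof.
  intros Hr H D. apply is_derive_Reals in D.
  destruct (Rle_dec 0 c) as [L | L]; [exact L|]. exfalso.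
  destruct (D (- c)) as [dl Hd]; [lra|]. pose proof (cond_pos dl) as Pd.
  set (h := - (Rmin dl r / 2)).
  assert (Rm : 0 < Rmin dl r) by (now apply Rmin_pos).
  pose proof (Rmin_l dl r). pose proof (Rmin_r dl r).
  assert (Hh : h < 0) by (unfold h; lra).
  specialize (Hd h ltac:(lra)). rewrite Rabs_left in Hd by lra.
  specialize (Hd ltac:(unfold h; lra)). apply Rabs_def2 in Hd.
  specialize (H (x + h) ltac:(unfold h; lra)).
  assert (0 <= (p (x + h) - p x) / h).
  { replace ((p (x + h) - p x) / h) with ((p x - p (x + h)) * / (- h)) by (field; lra).
    apply Rmult_le_pos; [lra|]. apply Rlt_le, Rinv_0_lt_compat. lra. }
  lra.
Qed.

(** If [c] were positive, [p1], which vanishes at [x], would be positive just to the right, and the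
    mean value theorem would push [p] above its maximum. *)
Lemma max_second_derive (p p1 : R -> R) (x r c : R) : 0 < r ->
  (forall y, x - r < y < x + r -> p y <= p x) ->
  (forall y, x - r < y < x + r -> is_derive p y (p1 y)) -> is_derive p1 x c -> c <= 0.
Proof.
  intros Hr H D D1.
  assert (Z : p1 x = 0).
  { pose proof (proj1 (is_derive_Reals _ _ _) (D x ltac:(lra))) as Dx.
    pose proof (deriv_maximum p (x - r) (x + r) x (exist _ _ Dx) ltac:(lra) ltac:(lra)) as E.
    simpl in E. apply E. intros y Hy1 Hy2. apply H. lra. }
  apply is_derive_Reals in D1.
  destruct (Rle_dec c 0) as [L | L]; [exact L|]. exfalso.
  destruct (D1 c) as [dl Hd]; [lra|]. pose proof (cond_pos dl) as Pd.
  set (h := Rmin dl r / 2).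
  assert (Rm : 0 < Rmin dl r) by (now apply Rmin_pos).
  pose proof (Rmin_l dl r). pose proof (Rmin_r dl r).
  destruct (MVT_cor2 p p1 x (x + h)) as [z [E Hz]]; [unfold h; lra| |].
  - intros y Hy. apply is_derive_Reals, D. unfold h in *; lra.
  - specialize (Hd (z - x) ltac:(lra)). rewrite Rabs_pos_eq in Hd by lra.
    specialize (Hd ltac:(unfold h in *; lra)). apply Rabs_def2 in Hd.
    replace (x + (z - x)) with z in Hd by ring. rewrite Z, Rminus_0_r in Hd.
    assert (P : 0 < p1 z).
    { apply (Rmult_lt_reg_r (/ (z - x))); [apply Rinv_0_lt_compat; lra|]. unfold Rdiv in Hd. lra. }
    specialize (H (x + h) ltac:(unfold h; lra)).
    assert (0 < h) by (unfold h; lra). nra.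
Qed.

Definition dot (z w : C) : R := fst z * fst w + snd z * snd w.

Lemma dot_diag (z : C) : dot z z = Cmod z ^ 2.
Proof. rewrite Cmod_sqr. unfold dot. ring. Qed.

Lemma is_derive_dot (f g : R -> C) (x : R) (l m : C) :
  Cder f x l -> Cder g x m -> is_derive (fun y => dot (f y) (g y)) x (dot l (g x) + dot (f x) m).
Proof.
  intros Hf Hg.
  pose proof (Cder_fst _ _ _ Hf) as F1. pose proof (Cder_snd _ _ _ Hf) as F2.
  pose proof (Cder_fst _ _ _ Hg) as G1. pose proof (Cder_snd _ _ _ Hg) as G2.
  refine (is_derive_Rext _ _ _ _ _ _ _ (is_derive_plus _ _ _ _ _
      (is_derive_Rmult _ _ _ _ _ F1 G1) (is_derive_Rmult _ _ _ _ _ F2 G2))).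
  reflexivity. unfold dot, plus; simpl. ring.
Qed.

Definition interior_solution (b tau : R) (q : R -> C) (v : R -> R -> C) : Prop :=
  forall x t, -b < x < b -> 0 < t < tau -> exists (v1 : R -> C) (v2 vt : C),
    (forall y, -b < y < b -> Cder (fun z => v z t) y (v1 y)) /\
    Cder v1 x v2 /\ Cder (v x) t vt /\ (v2 - q x * v x t)%C = vt.

(** Maximizing over times up to some [t < tau] keeps the top edge inside the domain of the equation.
    A maximum on that edge is only a left maximum in time, which still makes the time derivative
    nonnegative. *)
Lemma maximum_principle_below (b tau : R) (q : R -> C) (Q delta : R) (v : R -> R -> C) :
  0 < b -> 0 < tau -> (forall x, -b < x < b -> Cmod (q x) <= Q) ->
  (forall p, continuous (fun p : R * R => v (fst p) (snd p)) p) ->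
  interior_solution b tau q v ->
  (forall x, -b <= x <= b -> Cmod (v x 0) <= delta) ->
  (forall t, 0 <= t <= tau -> Cmod (v (- b) t) <= delta /\ Cmod (v b t) <= delta) ->
  forall x t, -b <= x <= b -> 0 <= t < tau -> Cmod (v x t) <= exp ((Q + 1) * tau) * delta.
Proof.
  intros Hb Htau HQ Cv Sv H0 Hl x t Hx Ht.
  assert (Q0 : 0 <= Q) by (eapply Rle_trans; [apply Cmod_ge_0 | apply (HQ 0); lra]).
  assert (D0 : 0 <= delta) by (eapply Rle_trans; [apply Cmod_ge_0 | apply (H0 0); lra]).
  set (lam := Q + 1).
  set (w := fun p : R * R => exp (- (2 * lam * snd p)) * Cmod (v (fst p) (snd p)) ^ 2).
  assert (Cw : forall p, continuous w p).
  { intros p. apply continuous_Rmult.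
    - apply (continuous_Rcomp (U := prod_UniformSpace R_UniformSpace R_UniformSpace)
        (fun p => snd p) (fun s => exp (- (2 * lam * s)))).
      + apply (continuous_snd (U := R_UniformSpace) (V := R_UniformSpace)).
      + apply derivable_continuous_pt, ex_derive_Reals_0. auto_derive; auto.
    - apply (continuous_Rcomp (U := prod_UniformSpace R_UniformSpace R_UniformSpace)
        (fun p => Cmod (v (fst p) (snd p))) (fun s => s ^ 2)).
      + apply continuous_Cmod, Cv.
      + apply derivable_continuous_pt, derivable_pt_pow. }
  destruct (rectangle_max w (- b) b 0 t) as [[x0 t0] [[Hx0 Ht0] Hmax]]; auto; try lra.
  simpl in Hx0, Ht0.
  assert (E1 : forall s, 0 <= s -> exp (- (2 * lam * s)) <= 1).
  { intros s Hs. rewrite <- exp_0. apply exp_le. unfold lam. nra. }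
  assert (K : w (x0, t0) <= delta ^ 2).
  { destruct (Rle_dec (w (x0, t0)) (delta ^ 2)) as [L | L]; [exact L|]. exfalso.
    assert (NB : ~ Cmod (v x0 t0) <= delta).
    { intros A. apply L. unfold w; simpl fst; simpl snd.
      pose proof (E1 t0 ltac:(lra)). pose proof (exp_pos (- (2 * lam * t0))).
      assert (Cmod (v x0 t0) ^ 2 <= delta ^ 2) by (apply pow_incr; split; [apply Cmod_ge_0 | auto]).
      pose proof (pow2_ge_0 (Cmod (v x0 t0))). nra. }
    assert (T0 : 0 < t0).
    { destruct (Req_dec t0 0) as [-> | ?]; [|lra]. exfalso. apply NB. now apply H0. }
    assert (X1 : x0 <> - b) by (intros ->; apply NB; apply Hl; lra).
    assert (X2 : x0 <> b) by (intros ->; apply NB; apply Hl; lra).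
    destruct (Sv x0 t0 ltac:(lra) ltac:(lra)) as (v1 & v2 & vt & S1 & S2 & S3 & S4).
    set (z := v x0 t0) in *.
    assert (Z0 : 0 < Cmod z ^ 2) by (apply pow_lt; lra).
    assert (Sp : 2 * (dot (v1 x0) (v1 x0) + dot v2 z) <= 0).
    { set (r := Rmin (x0 + b) (b - x0)).
      assert (Rm : 0 < r) by (apply Rmin_pos; lra).
      pose proof (Rmin_l (x0 + b) (b - x0)) as R1. pose proof (Rmin_r (x0 + b) (b - x0)) as R2. fold r in R1, R2.
      apply (max_second_derive (fun y => dot (v y t0) (v y t0)) (fun y => 2 * dot (v1 y) (v y t0)) x0 r); auto.
      - intros y Hy. rewrite !dot_diag. pose proof (Hmax (y, t0) ltac:(simpl; lra)) as A.
        unfold w in A; simpl fst in A; simpl snd in A.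
        apply Rmult_le_reg_l in A; auto. apply exp_pos.
      - intros y Hy. generalize (is_derive_dot _ _ _ _ _ (S1 y ltac:(lra)) (S1 y ltac:(lra))).
        apply is_derive_Rext; [reflexivity | unfold dot; ring].
      - apply (is_derive_scal (fun y => dot (v1 y) (v y t0))).
        generalize (is_derive_dot _ _ _ _ _ S2 (S1 x0 ltac:(lra))).
        apply is_derive_Rext; [reflexivity | fold z; ring]. }
    assert (Tp : 0 <= exp (- (2 * lam * t0)) * (2 * (dot vt z - lam * dot z z))).
    { apply (left_max_derive (fun s => exp (- (2 * lam * s)) * dot (v x0 s) (v x0 s)) t0 t0 _ T0).
      - intros s Hs. rewrite !dot_diag. apply (Hmax (x0, s)). simpl. lra.
      - assert (De : is_derive (fun s => exp (- (2 * lam * s))) t0 (- (2 * lam) * exp (- (2 * lam * t0))))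
          by (auto_derive; auto; ring).
        generalize (is_derive_Rmult _ _ _ _ _ De (is_derive_dot _ _ _ _ _ S3 S3)).
        apply is_derive_Rext; [reflexivity | fold z; unfold dot; ring]. }
    assert (Tp' : 0 <= dot vt z - lam * dot z z).
    { pose proof (exp_pos (- (2 * lam * t0))). apply (Rmult_le_reg_l (2 * exp (- (2 * lam * t0)))); lra. }
    rewrite <- S4 in Tp'.
    assert (Eq : dot (v2 - q x0 * z)%C z = dot v2 z - dot (q x0 * z)%C z)
      by (unfold dot, Cminus, Cplus, Copp; simpl; ring).
    rewrite Eq, dot_diag in Tp'.
    (* By [Sp] the value [dot v2 z] is at most 0, so the equation turns [Tp'] into
       [(Q + 1) * Cmod z ^ 2 <= Q * Cmod z ^ 2], against [Z0]. *)
    assert (Bq : - dot (q x0 * z)%C z <= Q * Cmod z ^ 2).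
    { replace (- dot (q x0 * z)%C z) with (dot (- (q x0 * z))%C z) by (unfold dot, Copp; simpl; ring).
      eapply Rle_trans; [apply dot_le_Cmod|]. rewrite Cmod_opp, Cmod_mult.
      pose proof (HQ x0 ltac:(lra)). pose proof (Cmod_ge_0 z). nra. }
    rewrite dot_diag in Sp. pose proof (pow2_ge_0 (Cmod (v1 x0))). unfold lam in Tp'. nra. }
  pose proof (Hmax (x, t) ltac:(simpl; lra)) as A. unfold w at 1 in A; simpl fst in A; simpl snd in A.
  apply Rsqr_incr_0; [|apply Cmod_ge_0 | apply Rmult_le_pos; auto; apply Rlt_le, exp_pos].
  unfold Rsqr.
  assert (EE : 1 <= exp (lam * tau) ^ 2 * exp (- (2 * lam * t))).
  { simpl. rewrite Rmult_1_r, <- !exp_plus, <- exp_0. apply exp_le. unfold lam. nra. }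
  pose proof (exp_pos (- (2 * lam * t))) as EP.
  pose proof (pow2_ge_0 (Cmod (v x t))). pose proof (pow2_ge_0 (exp (lam * tau))).
  apply Rle_trans with (exp (lam * tau) ^ 2 * (exp (- (2 * lam * t)) * Cmod (v x t) ^ 2)).
  - rewrite <- Rmult_assoc. nra.
  - apply Rle_trans with (exp (lam * tau) ^ 2 * delta ^ 2); [|right; ring].
    apply Rmult_le_compat_l; auto. lra.
Qed.

(** The final time, where no equation is assumed, is reached by continuity from earlier times. *)
Lemma maximum_principle (b tau : R) (q : R -> C) (Q delta : R) (v : R -> R -> C) :
  0 < b -> 0 < tau -> (forall x, -b < x < b -> Cmod (q x) <= Q) ->
  (forall p, continuous (fun p : R * R => v (fst p) (snd p)) p) ->
  interior_solution b tau q v ->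
  (forall x, -b <= x <= b -> Cmod (v x 0) <= delta) ->
  (forall t, 0 <= t <= tau -> Cmod (v (- b) t) <= delta /\ Cmod (v b t) <= delta) ->
  forall x t, -b <= x <= b -> 0 <= t <= tau -> Cmod (v x t) <= exp ((Q + 1) * tau) * delta.
Proof.
  intros Hb Htau HQ Cv Sv H0 Hl x t Hx Ht.
  pose proof (maximum_principle_below b tau q Q delta v Hb Htau HQ Cv Sv H0 Hl x) as B.
  destruct (Rlt_dec t tau) as [L | L]; [apply B; lra|].
  apply le_epsilon. intros e He.
  assert (Ct : continuous (fun s => v x s) t)
    by (apply (continuous_slice_t (fun p : R * R => v (fst p) (snd p))), Cv).
  destruct (continuous_C_locally _ t e Ct He) as [d Hd].
  set (s := t - Rmin d t / 2). pose proof (cond_pos d) as Pd.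
  assert (Rm : 0 < Rmin d t) by (apply Rmin_pos; lra).
  pose proof (Rmin_l d t). pose proof (Rmin_r d t).
  assert (Hs : Cmod (v x s - v x t)%C < e).
  { apply Hd. unfold ball; simpl. unfold AbsRing_ball, abs, minus, plus, opp; simpl.
    rewrite Rabs_left; unfold s; lra. }
  pose proof (B s Hx ltac:(unfold s; lra)) as Bs.
  replace (v x t) with (v x s - (v x s - v x t))%C by ring.
  eapply Rle_trans; [apply Cmod_triangle|]. rewrite Cmod_opp. lra.
Qed.

(** ** Averages over roots of unity *)

(** The radius puts [2 b Cmod k] midway between the consecutive zeros [N pi] and [(N + 1) pi] of the
    sine. If [2 b] times the real part is below 1 in modulus, [2 b] times the modulus of the
    imaginary part lies within 1/4 of that midpoint, because the midpoint exceeds 4, and the sine is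
    then close to 1 in modulus. *)
Lemma circle_off_spectrum (b : R) (k : C) (N : nat) : 0 < b -> (1 <= N)%nat ->
  Cmod k = (INR N * PI + PI / 2) / (2 * b) -> off_spectrum b k.
Proof.
  intros Hb HN Hk. unfold off_spectrum.
  pose proof PI2_3_2 as P3. assert (N1 : 1 <= INR N) by (now apply (le_INR 1)).
  set (R0 := INR N * PI + PI / 2) in *.
  assert (HR : 4 < R0) by (unfold R0, Rdiv in *; nra).
  set (a := 2 * b * Rabs (fst k)). set (c := 2 * b * Rabs (snd k)).
  assert (A0 : 0 <= a) by (unfold a; pose proof (Rabs_pos (fst k)); nra).
  assert (C0 : 0 <= c) by (unfold c; pose proof (Rabs_pos (snd k)); nra).
  assert (S : a ^ 2 + c ^ 2 = R0 ^ 2).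
  { unfold a, c. rewrite !Rpow_mult_distr, !pow2_abs.
    replace R0 with (2 * b * Cmod k) by (rewrite Hk; field; lra).
    rewrite (Rpow_mult_distr (2 * b) (Cmod k)), Cmod_sqr. ring. }
  destruct (Rle_dec 1 a) as [L | L]; [now left|]. right.
  set (d := R0 - c).
  assert (D : 0 <= d < 1 / 4).
  { assert (E : d * (R0 + c) = a ^ 2) by (unfold d; rewrite <- (Rplus_0_r (a ^ 2)); nra).
    assert (a ^ 2 < 1) by nra. assert (0 <= a ^ 2) by nra. split; nra. }
  assert (CR : cos R0 = 0).
  { apply cos_eq_0_1. exists (Z.of_nat N). rewrite <- INR_IZR_INZ. reflexivity. }
  assert (SR : sin R0 ^ 2 = 1).
  { pose proof (sin2_cos2 R0) as T. unfold Rsqr in T. rewrite CR in T. lra. }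
  assert (SC : sin (2 * b * snd k) ^ 2 = sin c ^ 2).
  { unfold c, Rabs. destruct (Rcase_abs (snd k)); [|reflexivity].
    replace (2 * b * - snd k) with (- (2 * b * snd k)) by ring. rewrite sin_neg. ring. }
  assert (E : sin c ^ 2 = cos d ^ 2).
  { replace c with (R0 - d) by (unfold d; ring). rewrite sin_minus, CR, Rmult_0_l, Rminus_0_r.
    rewrite Rpow_mult_distr, SR. ring. }
  assert (SD : 0 <= sin d <= d).
  { split; [apply sin_ge_0; lra|]. destruct (Req_dec d 0) as [Z | Z].
    - rewrite Z, sin_0. lra.
    - apply Rlt_le, sin_lt_x. lra. }
  pose proof (sin2_cos2 d) as T. unfold Rsqr in T.
  destruct (Rle_dec (1 / 2) (Rabs (sin (2 * b * snd k)))) as [G | G]; [exact G|]. exfalso.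
  pose proof (Rabs_pos (sin (2 * b * snd k))).
  assert (Rabs (sin (2 * b * snd k)) ^ 2 < 1 / 4) by nra.
  rewrite pow2_abs, SC, E in H0. nra.
Qed.

Lemma exp_pow_nat (x : R) (n : nat) : exp x ^ n = exp (INR n * x).
Proof.
  induction n as [|n IH].
  - simpl. now rewrite Rmult_0_l, exp_0.
  - rewrite S_INR, Rmult_plus_distr_r, exp_plus, Rmult_1_l. simpl. rewrite IH. ring.
Qed.

(** The [M + 1] points lie on a half circle; their squares, the values of [mu], are [rho^2] times
    the roots of unity of order [M + 1]. *)
Definition circle_point (rho : R) (M j : nat) : C :=
  (RtoC rho * cexp (0, (PI * INR j / INR (S M))%R))%C.

Lemma Cmod_circle_point (rho : R) (M j : nat) : 0 < rho -> Cmod (circle_point rho M j) = rho.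
Proof.
  intros H. unfold circle_point. rewrite Cmod_mult, Cmod_cexp, Cmod_R, Rabs_pos_eq by lra.
  simpl. rewrite exp_0. ring.
Qed.

Lemma cexp_pow (z : C) (n : nat) : (cexp z ^ n)%C = cexp (RtoC (INR n) * z)%C.
Proof.
  induction n as [|n IH].
  - simpl. replace (RtoC 0 * z)%C with (RtoC 0) by ring. now rewrite cexp_0.
  - rewrite S_INR, RtoC_plus. simpl Cpow. rewrite IH, <- cexp_add. f_equal. ring.
Qed.

Lemma geom_csum (z : C) (n : nat) :
  ((RtoC 1 - z) * sum_n (fun j => (z ^ j)%C) n)%C = (RtoC 1 - z ^ S n)%C.
Proof.
  induction n as [|n IH].
  - rewrite sum_n_0_C. simpl. ring.
  - rewrite sum_n_S_C, Cmult_plus_distr_l, IH. simpl. ring.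
Qed.

(** A geometric sum with ratio [z = exp (2 pi i n / (M + 1))]: the power [z^(M+1)] is 1, while [z]
    is not, as [0 < n <= M]. *)
Lemma circle_power_sum (rho : R) (M n : nat) : (0 < n <= M)%nat ->
  sum_n (fun j => ((circle_point rho M j * circle_point rho M j) ^ n)%C) M = RtoC 0 :> C.
Proof.
  intros Hn. assert (M0 : 0 < INR (S M)) by (apply lt_0_INR; lia).
  set (th := 2 * PI * INR n / INR (S M)). set (z := cexp (0, th)).
  assert (E : forall j, ((circle_point rho M j * circle_point rho M j) ^ n)%C
      = (RtoC rho ^ (2 * n) * z ^ j)%C).
  { intros j. unfold circle_point, z. set (e := cexp (0, (PI * INR j / INR (S M))%R)).
    replace (RtoC rho * e * (RtoC rho * e))%C with (RtoC rho ^ 2 * e ^ 2)%C by (simpl; ring).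
    rewrite Cpow_mult_l, <- !Cpow_mult_r. apply (f_equal (Cmult _)).
    unfold e. rewrite !cexp_pow. f_equal. unfold Cmult, RtoC; cbn [fst snd].
    apply (f_equal2 (@pair R R)); [ring|]. rewrite mult_INR. unfold th. simpl (INR 2). field. lra. }
  rewrite (csum_ext _ _ M (fun j _ => E j)), csum_scal.
  assert (Th : 0 < th / 2 < PI).
  { pose proof PI_RGT_0. unfold th. assert (N0 : 0 < INR n) by (apply lt_0_INR; lia).
    assert (INR n < INR (S M)) by (apply lt_INR; lia). split.
    - apply Rdiv_lt_0_compat; [|lra]. apply Rdiv_lt_0_compat; nra.
    - apply (Rmult_lt_reg_r (INR (S M))); auto.
      replace (2 * PI * INR n / INR (S M) / 2 * INR (S M)) with (PI * INR n) by (field; lra). nra. }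
  assert (Z1 : (RtoC 1 - z)%C <> RtoC 0).
  { intros H. apply (f_equal (fun w : C => fst w)) in H. unfold z, cexp in H.
    cbn [fst snd Cminus Cplus Copp RtoC] in H. rewrite exp_0 in H.
    replace th with (2 * (th / 2)) in H by field. rewrite cos_2a_sin in H.
    pose proof (sin_gt_0 (th / 2) (proj1 Th) (proj2 Th)). nra. }
  assert (ZM : (z ^ S M)%C = RtoC 1).
  { unfold z. rewrite cexp_pow. unfold cexp, Cmult, RtoC; cbn [fst snd].
    replace (INR (S M) * 0 - 0 * th) with 0 by ring.
    replace (INR (S M) * th + 0 * 0) with (0 + 2 * INR n * PI) by (unfold th; field; lra).
    rewrite exp_0, cos_period, sin_period, cos_0, sin_0. apply (f_equal2 (@pair R R)); ring. }
  pose proof (geom_csum z M) as G. rewrite ZM in G.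
  assert (S0 : sum_n (fun j => (z ^ j)%C) M = RtoC 0 :> C).
  { replace (sum_n (fun j => (z ^ j)%C) M : C) with
      ((RtoC 1 - z) * sum_n (fun j => (z ^ j)%C) M / (RtoC 1 - z))%C by (field; exact Z1).
    rewrite G. unfold Cdiv. ring. }
  change (sum_n (Cpow z) M) with (sum_n (fun j => (z ^ j)%C) M). rewrite S0. ring.
Qed.

Lemma csum_exchange (a : nat -> nat -> C) (n k : nat) :
  sum_n (fun i => sum_n (fun j => a i j) k) n = sum_n (fun j => sum_n (fun i => a i j) n) k :> C.
Proof.
  induction n as [|n IH].
  - rewrite sum_n_0_C. apply csum_ext. intros j _. now rewrite sum_n_0_C.
  - rewrite sum_n_S_C, IH, <- csum_plus. apply csum_ext. intros j _. now rewrite sum_n_S_C.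
Qed.

(** The factor [mu] removes the constant term, so that only the powers from 1 to [K + 1 <= M] occur,
    and each of them sums to zero. *)
Lemma circle_poly_sum (rho : R) (M K : nat) (c : nat -> C) : (K < M)%nat ->
  sum_n (fun j => let mu := (circle_point rho M j * circle_point rho M j)%C in
    (mu * sum_n (fun n => (mu ^ n * c n)%C) K)%C) M = RtoC 0 :> C.
Proof.
  intros HK. cbv zeta.
  rewrite (csum_ext _ (fun j => sum_n (fun n =>
    (c n * (circle_point rho M j * circle_point rho M j) ^ S n)%C) K)).
  2:{ intros j _. rewrite <- csum_scal. apply csum_ext. intros n _. simpl. cring. }
  rewrite csum_exchange.
  rewrite (csum_ext _ (fun n => (RtoC 0 * c n)%C)).
  - rewrite csum_scal. ring.
  - intros n Hn. rewrite csum_scal, circle_power_sum by lia. cring.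
Qed.

(** ** Uniform limits of heat-type polynomials *)

Section Approximation.

Context (b : R) (hb : 0 < b) (tau : R) (htau : 0 < tau)
  (q F F1 : R -> C) (m : R) (HF : nonvanishing_solution b q F F1 m).
Context (Q : R) (HQ : forall x, -b <= x <= b -> Cmod (q x) <= Q).

Definition heat_comb (a c : nat -> C) (N : nat) (x t : R) : C :=
  sum_n (fun n => (a n * heat F F n x t + c n * heat F (second_solution F) n x t)%C) N.

Definition heat_span (v : R -> R -> C) : Prop :=
  exists N a c, forall x t, v x t = heat_comb a c N x t.

Definition heat_limit (v : R -> R -> C) : Prop :=
  forall eps, 0 < eps -> exists p, heat_span p /\
    forall x t, -b <= x <= b -> 0 <= t <= tau -> Cmod (v x t - p x t)%C <= eps.

Lemma heat_comb_extend (a c : nat -> C) (N N' : nat) : (N <= N')%nat ->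
  exists a' c', forall x t, heat_comb a c N x t = heat_comb a' c' N' x t.
Proof.
  induction 1 as [|N' H IH].
  - now exists a, c.
  - destruct IH as (a' & c' & E).
    exists (fun n => if Nat.leb n N' then a' n else RtoC 0), (fun n => if Nat.leb n N' then c' n else RtoC 0).
    intros x t. rewrite E. unfold heat_comb. rewrite sum_n_S_C.
    replace (Nat.leb (S N') N') with false by (symmetry; apply Nat.leb_gt; lia).
    rewrite (csum_ext _ (fun n => ((if Nat.leb n N' then a' n else RtoC 0) * heat F F n x t
      + (if Nat.leb n N' then c' n else RtoC 0) * heat F (second_solution F) n x t)%C)); [cring|].
    intros n Hn. apply Nat.leb_le in Hn. now rewrite Hn.
Qed.

Lemma heat_span_lin (k l : C) (v w : R -> R -> C) :
  heat_span v -> heat_span w -> heat_span (fun x t => (k * v x t + l * w x t)%C).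
Proof.
  intros (N & a & c & E) (N' & a' & c' & E').
  destruct (heat_comb_extend a c N (Nat.max N N')) as (a1 & c1 & E1); [lia|].
  destruct (heat_comb_extend a' c' N' (Nat.max N N')) as (a2 & c2 & E2); [lia|].
  exists (Nat.max N N'), (fun n => (k * a1 n + l * a2 n)%C), (fun n => (k * c1 n + l * c2 n)%C).
  intros x t. rewrite E, E', E1, E2. unfold heat_comb.
  rewrite <- !csum_scal, <- csum_plus. apply csum_ext. intros; cring.
Qed.

Lemma heat_limit_lin (k l : C) (v w : R -> R -> C) :
  heat_limit v -> heat_limit w -> heat_limit (fun x t => (k * v x t + l * w x t)%C).
Proof.
  intros Hv Hw eps He.
  pose proof (Cmod_ge_0 k) as K0. pose proof (Cmod_ge_0 l) as L0.
  destruct (Hv (eps / 2 / (Cmod k + 1))) as [p [Sp Bp]].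
  { repeat apply Rdiv_lt_0_compat; lra. }
  destruct (Hw (eps / 2 / (Cmod l + 1))) as [p' [Sp' Bp']].
  { repeat apply Rdiv_lt_0_compat; lra. }
  exists (fun x t => (k * p x t + l * p' x t)%C). split; [now apply heat_span_lin|].
  intros x t Hx Ht.
  replace (k * v x t + l * w x t - (k * p x t + l * p' x t))%C
    with (k * (v x t - p x t) + l * (w x t - p' x t))%C by ring.
  eapply Rle_trans; [apply Cmod_triangle|]. rewrite !Cmod_mult.
  assert (A : forall z d, 0 <= z -> 0 <= d -> d <= eps / 2 / (z + 1) -> z * d <= eps / 2).
  { intros z d Hz Hd B. apply (Rmult_le_compat_l (z + 1)) in B; [|lra].
    replace ((z + 1) * (eps / 2 / (z + 1))) with (eps / 2) in B by (field; lra). nra. }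
  pose proof (A _ _ K0 (Cmod_ge_0 _) (Bp x t Hx Ht)).
  pose proof (A _ _ L0 (Cmod_ge_0 _) (Bp' x t Hx Ht)). lra.
Qed.

Lemma heat_lin (k l : C) (h g : R -> C) (n : nat) (x t : R) :
  (forall y, continuous h y) -> (forall y, continuous g y) ->
  heat F (fun y => (k * h y + l * g y)%C) n x t = (k * heat F h n x t + l * heat F g n x t)%C.
Proof.
  intros Ch Cg. unfold heat, conv. rewrite <- !csum_scal, <- csum_plus. apply csum_ext.
  intros j _. rewrite (Jn_lin _ _ _ _ _ HF) by auto. cring.
Qed.

(** The partial sums lie in the span, and the tail is uniform on the rectangle because the weight is
    largest at [x = b] and the exponential bound at [t = tau]. *)
Lemma heat_series_limit (mu A B : C) : heat_limit (heat_series F mu (homogeneous F A B)).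
Proof.
  intros eps He.
  pose proof (homogeneous_cosh_bounded _ _ _ _ _ HF A B) as CB.
  set (K := Cmod A * m + Cmod B * (m * m)) in *.
  destruct (exists_weight _ _ _ _ _ HF (Cmod mu) (Cmod_ge_0 mu)) as [s [Hs Hr]].
  destruct (half_pow_small (2 * (2 * exp (4 * (Cmod mu * tau)) * (K * cosh (s * b)))) eps He) as [n Hn].
  specialize (Hn n (le_n _)).
  exists (fun x t => sum_n (heat_term F mu (homogeneous F A B) x t) n). split.
  - exists n, (fun j => (mu ^ j * A)%C), (fun j => (mu ^ j * B)%C).
    intros x t. apply csum_ext. intros j _. unfold heat_term, homogeneous.
    rewrite heat_lin; [cring | apply (nvs_F _ _ _ _ _ HF)|].
    intros y. apply (second_solution_solves _ _ _ _ _ HF).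
  - intros x t Hx Ht. eapply Rle_trans.
    { apply (heat_series_tail _ _ _ _ _ HF mu _ K (Cmod mu) s tau x t n (Rle_refl _) Hs Hr CB Ht). }
    apply Rlt_le. eapply Rle_lt_trans; [|exact Hn].
    apply Rmult_le_compat_r; [apply pow_le; lra|].
    pose proof (exp_pos (4 * (Cmod mu * tau))).
    assert (K0 : 0 <= K).
    { unfold K. pose proof (nvs_m_pos _ _ _ _ _ HF). pose proof (Cmod_ge_0 A). pose proof (Cmod_ge_0 B).
      assert (0 <= m * m) by nra. nra. }
    assert (CC : cosh (s * x) <= cosh (s * b)).
    { apply cosh_le_of_abs. rewrite !Rabs_mult. apply Rmult_le_compat_l; [apply Rabs_pos|].
      rewrite (Rabs_pos_eq b) by lra. apply Rabs_le. lra. }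
    apply Rmult_le_compat_l; [lra|]. apply Rmult_le_compat_l; [lra|]. now apply Rmult_le_compat_l.
Qed.

Lemma heat_limit_csum (D : R -> R -> Prop) (z : nat -> R -> R -> C) (e : R) (n : nat) :
  (forall j, exists v, heat_limit v /\ forall x t, D x t -> Cmod (v x t - z j x t)%C <= e) ->
  exists v, heat_limit v /\
    forall x t, D x t -> Cmod (v x t - sum_n (fun j => z j x t) n)%C <= INR (S n) * e.
Proof.
  intros H. induction n as [|n IH].
  - destruct (H 0%nat) as (v & V1 & V2). exists v. split; auto.
    intros x t Hx. rewrite sum_n_0_C. simpl. rewrite Rmult_1_l. auto.
  - destruct IH as (w & W1 & W2). destruct (H (S n)) as (v & V1 & V2).
    exists (fun x t => (RtoC 1 * w x t + RtoC 1 * v x t)%C). split; [now apply heat_limit_lin|].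
    intros x t Hx. rewrite sum_n_S_C, (S_INR (S n)).
    replace (RtoC 1 * w x t + RtoC 1 * v x t - (sum_n (fun j => z j x t) n + z (S n) x t))%C
      with ((w x t - sum_n (fun j => z j x t) n) + (v x t - z (S n) x t))%C by ring.
    eapply Rle_trans; [apply Cmod_triangle|]. specialize (W2 x t Hx). specialize (V2 x t Hx). lra.
Qed.

Definition parabolic_boundary (x t : R) : Prop :=
  (-b <= x <= b /\ t = 0) \/ ((x = - b \/ x = b) /\ 0 <= t <= tau).

Definition twice_differentiable (g : R -> C) : Prop :=
  exists g1 g2 : R -> C, (forall x, Cder g x (g1 x)) /\ (forall x, Cder g1 x (g2 x)) /\
    forall x, continuous g2 x.

(* With [y = (mu - L)^-1 g] one has [mu y = g + (mu - L)^-1 (L g)], where [L g = g'' - q g]. *)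
Lemma resolvent_estimate (k A B : C) (g g1 g2 gc p : R -> C) (Kp M : R) :
  k <> RtoC 0 -> off_spectrum b k -> 32 * b * Q <= Cmod k ->
  (forall x, Cder g x (g1 x)) -> (forall x, Cder g1 x (g2 x)) -> (forall x, continuous g2 x) ->
  g (- b) = RtoC 0 -> g b = RtoC 0 ->
  (forall x, continuous gc x) -> (forall x, -b <= x <= b -> gc x = g x) ->
  cosh_bounded Kp p -> solves b q gc p ->
  neumann F (k * k) (homogeneous F A B) (- b) = neumann F (k * k) p (- b) ->
  neumann F (k * k) (homogeneous F A B) b = neumann F (k * k) p b ->
  (forall x, -b <= x <= b -> Cmod (g2 x - q x * gc x)%C <= M) ->
  forall x, -b <= x <= b ->
    Cmod (k * k * neumann F (k * k) (homogeneous F A B) x -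
      (g x + k * k * neumann F (k * k) p x))%C <= 32 * b / Cmod k * M.
Proof.
  intros Hk Gk HkQ D1 D2 C2 Gl Gr Cgc Egc CBp Sp El Er HM x Hx.
  pose proof (homogeneous_cosh_bounded _ _ _ _ _ HF A B) as CB.
  pose proof (neumann_solves _ _ _ _ _ HF (k * k)%C _ _ _ CB (homogeneous_solves _ _ _ _ _ HF A B)) as S1.
  pose proof (neumann_solves _ _ _ _ _ HF (k * k)%C _ _ _ CBp Sp) as S2.
  set (y := neumann F (k * k) (homogeneous F A B)) in *. set (P := neumann F (k * k) p) in *.
  set (Lg := fun x => (g2 x - q x * gc x)%C) in *.
  assert (CLg : forall x, continuous Lg x).
  { intros z. apply continuous_Cminus; auto. apply continuous_Cmult; auto. apply (nvs_q _ _ _ _ _ HF). }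
  assert (S3 : solves b q Lg gc).
  { split; auto. exists g1. split; [intros; eapply Cder_continuous, D2|]. intros z Hz. split.
    - apply (Cder_ext_interval g gc (- b) b); auto. intros w Hw. symmetry. apply Egc. lra.
    - generalize (D2 z). apply Cder_ext; [reflexivity | unfold Lg; ring]. }
  (* With [mu = k * k], the function [mu (y - P) - gc] satisfies [L z = mu z - L gc] inside and
     vanishes at both ends, so the a priori bound applies to it. *)
  assert (S4 := solves_lin b q (k * k)%C (- RtoC 1)%C _ _ _ _
    (solves_lin b q (RtoC 1) (- RtoC 1)%C _ _ _ _ S1 S2) S3).
  cbv beta in S4.
  rewrite <- (Egc x Hx).
  replace (k * k * y x - (gc x + k * k * P x))%C with
    (k * k * (RtoC 1 * y x + - RtoC 1 * P x) + - RtoC 1 * gc x)%C by ring.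
  apply (apriori_bound b hb q F F1 m HF Q HQ k (fun x => (- Lg x)%C)
    (fun x => (k * k * (RtoC 1 * y x + - RtoC 1 * P x) + - RtoC 1 * gc x)%C)); auto.
  - intros; now apply continuous_Copp.
  - revert S4. apply solves_ext; [intros z; ring | reflexivity].
  - rewrite El, (Egc (- b)), Gl by lra. ring.
  - rewrite Er, (Egc b), Gr by lra. ring.
  - intros z Hz. rewrite Cmod_opp. exact (HM z Hz).
Qed.

Lemma csum_const (c : C) (n : nat) : sum_n (fun _ => c) n = (RtoC (INR (S n)) * c)%C :> C.
Proof.
  induction n as [|n IH].
  - rewrite sum_n_0_C. simpl. ring.
  - rewrite sum_n_S_C, IH, (S_INR (S n)), RtoC_plus. ring.
Qed.

Definition clamp (lo hi x : R) : R := Rmax lo (Rmin hi x).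

Lemma clamp_in (lo hi x : R) : lo <= hi -> lo <= clamp lo hi x <= hi.
Proof. intros H. unfold clamp, Rmax, Rmin. repeat destruct (Rle_dec _ _); lra. Qed.

Lemma clamp_id (lo hi x : R) : lo <= x <= hi -> clamp lo hi x = x.
Proof. intros H. unfold clamp, Rmax, Rmin. repeat destruct (Rle_dec _ _); lra. Qed.

Lemma clamp_continuous (lo hi x : R) : lo <= hi -> continuous (clamp lo hi) x.
Proof.
  intros H. apply (filterlim_locally (U := R_UniformSpace)). intros eps. exists eps. intros y.
  unfold ball; simpl. unfold AbsRing_ball, abs, minus, plus, opp; simpl.
  intros Hy. apply Rle_lt_trans with (2 := Hy).
  unfold clamp, Rmax, Rmin, Rabs. repeat destruct (Rle_dec _ _); repeat destruct (Rcase_abs _); lra.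
Qed.

(** Each node contributes a series whose boundary values are [g] plus [mu] times the series of [p]:
    up to the resolvent error at [t = 0], and exactly on the sides, where [g] vanishes and the
    Neumann sums are matched. Averaging over the nodes then nearly removes the series of [p]. *)
Lemma heat_limit_initial (g : R -> C) (eps : R) :
  twice_differentiable g -> g (- b) = RtoC 0 -> g b = RtoC 0 -> 0 < eps ->
  exists w, heat_limit w /\ forall x t, parabolic_boundary x t -> Cmod (w x t - g x)%C <= eps.
Proof.
  intros (g1 & g2 & D1 & D2 & C2) Gl Gr He.
  (* Clamping keeps [g] on the segment and makes it bounded on the line, as [cosh_bounded] needs. *)
  set (gc := fun x => g (clamp (- b) b x)).
  assert (Cg : forall x, continuous g x) by (intros; eapply Cder_continuous, D1).
  assert (Cgc : forall x, continuous gc x).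
  { intros x. apply (continuous_comp (clamp (- b) b) g); auto. apply clamp_continuous; lra. }
  assert (Egc : forall x, -b <= x <= b -> gc x = g x) by (intros x Hx; unfold gc; now rewrite clamp_id).
  assert (CBg : exists Kg, cosh_bounded Kg gc).
  { destruct (continuity_ab_maj (fun x => Cmod (g x)) (- b) b) as [xm [Hm _]]; [lra| |].
    { intros x _. apply continuity_pt_filterlim. now apply continuous_Cmod. }
    exists (Cmod (g xm)). split; auto. intros s x _.
    pose proof (Hm _ (clamp_in (- b) b x ltac:(lra))) as A. simpl in A. fold (gc x) in A.
    pose proof (cosh_ge_1 (s * x)). pose proof (Cmod_ge_0 (g xm)). nra. }
  destruct CBg as [Kg CBg].
  set (p := J F gc). pose proof (J_cosh_bounded _ _ _ _ _ HF Kg gc CBg) as CBp. fold p in CBp.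
  set (Kp := m ^ 3 * Kg) in *.
  pose proof (J_solves _ _ _ _ _ HF gc Cgc) as Sp. fold p in Sp.
  assert (HB : exists B, 0 <= B /\ forall x, -b <= x <= b -> Cmod (g2 x - q x * gc x)%C <= B).
  { destruct (continuity_ab_maj (fun x => Cmod (g2 x - q x * gc x)%C) (- b) b) as [xm [Hm _]]; [lra| |].
    { intros x _. apply continuity_pt_filterlim. apply (continuous_Cmod (fun x => (g2 x - q x * gc x)%C)).
      apply continuous_Cminus; auto. apply continuous_Cmult; auto. apply (nvs_q _ _ _ _ _ HF). }
    eexists. split; [|exact Hm]. apply Cmod_ge_0. }
  destruct HB as (B & B0 & HB).
  (* The radius must serve two purposes: the a priori bound must apply, and the resolvent error must
     not exceed [eps / 2]. *)
  assert (HN : exists N, (1 <= N)%nat /\ 32 * b * Q <= (INR N * PI + PI / 2) / (2 * b) /\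
    32 * b * B <= eps / 2 * ((INR N * PI + PI / 2) / (2 * b))).
  { assert (Q0 : 0 <= Q) by (eapply Rle_trans; [apply Cmod_ge_0 | apply (HQ 0); lra]).
    destruct (INR_unbounded (2 * b * (32 * b * Q + 32 * b * B / (eps / 2)))) as [N HN].
    exists (S N). split; [lia|]. pose proof PI2_3_2. pose proof (pos_INR N). rewrite S_INR.
    assert (E : 32 * b * Q + 32 * b * B / (eps / 2) <= ((INR N + 1) * PI + PI / 2) / (2 * b)).
    { apply (Rmult_le_reg_l (2 * b)); [lra|].
      replace (2 * b * (((INR N + 1) * PI + PI / 2) / (2 * b))) with ((INR N + 1) * PI + PI / 2) by (field; lra).
      unfold Rdiv in *. nra. }
    assert (0 <= 32 * b * B / (eps / 2)).
    { apply Rmult_le_pos; [nra | apply Rlt_le, Rinv_0_lt_compat; lra]. }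
    assert (0 <= 32 * b * Q) by nra. split; [lra|].
    apply Rle_trans with (eps / 2 * (32 * b * B / (eps / 2))); [right; field; lra|].
    apply Rmult_le_compat_l; lra. }
  destruct HN as (N & N1 & HN1 & HN2). set (rho := (INR N * PI + PI / 2) / (2 * b)) in *.
  assert (Rho : 0 < rho).
  { unfold rho. pose proof PI2_3_2. pose proof (pos_INR N).
    apply Rdiv_lt_0_compat; [|lra]. unfold Rdiv in *. nra. }
  destruct (exists_weight _ _ _ _ _ HF (rho * rho) ltac:(nra)) as [s [Hs Hr]].
  set (T := 2 * (2 * exp (4 * (rho * rho * tau)) * (Kp * cosh (s * b)))).
  destruct (half_pow_small (rho * rho * T) (eps / 2) ltac:(lra)) as [K HK]. specialize (HK K (le_n _)).
  (* [K] truncates the series of [p] uniformly on the circle already fixed; [S M = K + 2] nodes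
     annihilate all powers up to [K + 1]. *)
  set (M := S K). set (mu := fun j => (circle_point rho M j * circle_point rho M j)%C).
  assert (Cmu : forall j, Cmod (mu j) = rho * rho).
  { intros j. unfold mu. rewrite Cmod_mult, Cmod_circle_point; auto. }
  assert (Kp0 : 0 <= Kp).
  { destruct CBp as [_ Bp]. pose proof (Bp 1 0 (Rle_refl 1)). pose proof (Cmod_ge_0 (p 0)).
    pose proof (cosh_gt_0 (1 * 0)). nra. }
  (* The truncations sum to zero over the nodes, so each term may be replaced by its tail. *)
  assert (SUM : forall x t, -b <= x <= b -> 0 <= t <= tau ->
    Cmod (sum_n (fun j => (mu j * heat_series F (mu j) p x t)%C) M) <= INR (S M) * (eps / 2)).
  { intros x t Hx Ht.
    assert (Z : sum_n (fun j => (mu j * sum_n (fun n => (mu j ^ n * heat F p n x t)%C) K)%C) M = RtoC 0 :> C)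
      by exact (circle_poly_sum rho M K (fun n => heat F p n x t) (Nat.lt_succ_diag_r K)).
    replace (sum_n (fun j => (mu j * heat_series F (mu j) p x t)%C) M : C) with
      (sum_n (fun j => (mu j * (heat_series F (mu j) p x t - sum_n (heat_term F (mu j) p x t) K))%C) M : C).
    - eapply Rle_trans; [apply (csum_bound _ (fun _ => eps / 2))|].
      + intros j _. rewrite Cmod_mult, Cmu. apply Rlt_le. eapply Rle_lt_trans; [|exact HK].
        rewrite (Rmult_assoc (rho * rho)). apply Rmult_le_compat_l; [nra|].
        eapply Rle_trans; [apply (heat_series_tail _ _ _ _ _ HF (mu j) p Kp (rho * rho) s tau); auto; rewrite Cmu; lra|].
        apply Rmult_le_compat_r; [apply pow_le; lra|].
        pose proof (exp_pos (4 * (rho * rho * tau))).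
        assert (CC : cosh (s * x) <= cosh (s * b)).
        { apply cosh_le_of_abs. rewrite !Rabs_mult. apply Rmult_le_compat_l; [apply Rabs_pos|].
          rewrite (Rabs_pos_eq b) by lra. apply Rabs_le. lra. }
        apply Rmult_le_compat_l; [lra|]. apply Rmult_le_compat_l; [lra|]. now apply Rmult_le_compat_l.
      + rewrite sum_n_const. lra.
    - rewrite (csum_ext _ (fun j => (mu j * heat_series F (mu j) p x t +
        (- RtoC 1) * (mu j * sum_n (fun n => (mu j ^ n * heat F p n x t)%C) K))%C)).
      + rewrite csum_plus, csum_scal. rewrite Z. cring.
      + intros j _. unfold heat_term. cring. }
  destruct (heat_limit_csum parabolic_boundary
    (fun j x t => (g x + mu j * heat_series F (mu j) p x t)%C) (eps / 2) M) as (w & Lw & Bw).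
  { intros j. set (k := circle_point rho M j).
    assert (Ck : Cmod k = rho) by (unfold k; now apply Cmod_circle_point).
    assert (K0 : k <> RtoC 0) by (intros E; rewrite E, Cmod_0 in Ck; lra).
    assert (Gk : off_spectrum b k) by (now apply (circle_off_spectrum b k N)).
    destruct (dirichlet_solvable b hb q F F1 m HF Q HQ k (neumann F (k * k) p (- b)) (neumann F (k * k) p b)
      K0 Gk ltac:(lra)) as (A & A' & El & Er).
    pose proof (homogeneous_cosh_bounded _ _ _ _ _ HF A A') as CB.
    (* The summand with coefficient 0 only gives the function the shape of [heat_limit_lin]. *)
    exists (fun x t => (k * k * heat_series F (k * k) (homogeneous F A A') x t
      + RtoC 0 * heat_series F (k * k) (homogeneous F A A') x t)%C). split.
    - apply heat_limit_lin; apply heat_series_limit.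
    - intros x t [[Hx ->] | [Hx Ht]].
      + rewrite (heat_series_0 _ _ _ _ _ HF _ _ _ x CB). unfold mu. fold k.
        rewrite (heat_series_0 _ _ _ _ _ HF _ _ _ x CBp).
        assert (E := resolvent_estimate k A A' g g1 g2 gc p Kp B K0 Gk ltac:(lra) D1 D2 C2 Gl Gr
          Cgc Egc CBp Sp El Er HB x Hx).
        match type of E with Cmod ?z <= _ => match goal with |- Cmod ?z' <= _ => replace z' with z by ring end end.
        eapply Rle_trans; [exact E|]. rewrite Ck.
        apply (Rmult_le_reg_l rho); auto.
        replace (rho * (32 * b / rho * B)) with (32 * b * B) by (field; lra). lra.
      + unfold mu. fold k. rewrite (heat_series_prod _ _ _ _ _ HF _ _ _ x t CB),
          (heat_series_prod _ _ _ _ _ HF _ _ _ x t CBp).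
        assert (Z : g x = RtoC 0 /\ neumann F (k * k) (homogeneous F A A') x = neumann F (k * k) p x)
          by (destruct Hx as [-> | ->]; auto).
        destruct Z as [Z1 Z2]. rewrite Z1, Z2.
        match goal with |- Cmod ?z' <= _ => replace z' with (RtoC 0) by ring end.
        rewrite Cmod_0. lra. }
  assert (M0 : 0 < INR (S M)) by (apply lt_0_INR; lia).
  exists (fun x t => (RtoC (/ INR (S M)) * w x t + RtoC 0 * w x t)%C).
  split; [now apply heat_limit_lin|].
  intros x t Hxt. specialize (Bw x t Hxt). rewrite csum_plus, csum_const in Bw.
  assert (Hxt' : -b <= x <= b /\ 0 <= t <= tau)
    by (destruct Hxt as [[? ->] | [[-> | ->] ?]]; lra).
  pose proof (SUM x t (proj1 Hxt') (proj2 Hxt')) as BY.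
  set (Y := sum_n (fun j => (mu j * heat_series F (mu j) p x t)%C) M : C) in *.
  replace (RtoC (/ INR (S M)) * w x t + RtoC 0 * w x t - g x)%C with
    (RtoC (/ INR (S M)) * ((w x t - (RtoC (INR (S M)) * g x + Y)) + Y))%C.
  - rewrite Cmod_mult, Cmod_R, Rabs_pos_eq by (now apply Rlt_le, Rinv_0_lt_compat).
    apply (Rmult_le_reg_l (INR (S M))); auto. rewrite <- Rmult_assoc, Rinv_r, Rmult_1_l by lra.
    eapply Rle_trans; [apply Cmod_triangle|]. lra.
  - rewrite RtoC_inv by lra. field. intros E. apply RtoC_inj in E. lra.
Qed.

(** With [s = exp (mu0 (t - tau))] the admissible time factors are the powers [s^(j+1)]. A
    polynomial in [s] without constant term is needed, so [l / s] is approximated and the result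
    multiplied by [s], which is at most 1. *)
Lemma heat_limit_lateral (kappa l : R -> C) (eps : R) :
  (forall t, continuous l t) -> Cmod (kappa (- b)) <= 1 -> Cmod (kappa b) <= 1 -> 0 < eps ->
  exists w, heat_limit w /\ forall x t, x = - b \/ x = b -> 0 <= t <= tau ->
    Cmod (w x t - kappa x * l t)%C <= eps.
Proof.
  intros Cl Kl Kr He.
  (* Large enough for the a priori bound and for the first alternative of [off_spectrum]; all later
     parameters [k] are at least [k1]. *)
  set (k1 := Rmax (32 * b * Q) (1 / (2 * b))).
  assert (B2 : 0 < 1 / (2 * b)) by (apply Rdiv_lt_0_compat; lra).
  assert (K1 : 32 * b * Q <= k1) by apply Rmax_l.
  assert (K2 : 1 / (2 * b) <= k1) by apply Rmax_r.
  set (mu0 := k1 * k1). assert (M0 : 0 < mu0) by (unfold mu0; nra).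
  set (s0 := exp (- (mu0 * tau))). assert (S0 : 0 < s0) by apply exp_pos.
  (* This is [l t / s] in the variable [s]. The cut-off at [s0], the value of [s] at time 0, makes
     it continuous on the whole line. *)
  set (psi := fun s => (l (tau + / mu0 * ln (Rmax s0 s))%R * / RtoC (Rmax s0 s))%C).
  assert (Cmax : forall s, continuous (fun s => Rmax s0 s) s).
  { intros s. apply (filterlim_locally (U := R_UniformSpace)). intros e. exists e. intros y.
    unfold ball; simpl. unfold AbsRing_ball, abs, minus, plus, opp; simpl.
    intros Hy. apply Rle_lt_trans with (2 := Hy).
    unfold Rmax, Rabs. repeat destruct (Rle_dec _ _); repeat destruct (Rcase_abs _); lra. }
  assert (Cpsi : forall s, continuous psi s).
  { intros s. assert (P : 0 < Rmax s0 s) by (pose proof (Rmax_l s0 s); lra).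
    apply continuous_Cmult.
    - apply (continuous_comp (fun s => tau + / mu0 * ln (Rmax s0 s)) l); [|apply Cl].
      apply (continuous_Rcomp (fun s => Rmax s0 s) (fun y => tau + / mu0 * ln y)); [apply Cmax|].
      apply derivable_continuous_pt, ex_derive_Reals_0. auto_derive. lra.
    - apply continuous_Cinv.
      + intros E. apply RtoC_inj in E. lra.
      + apply continuous_RtoC, Cmax. }
  destruct (weierstrass psi eps Cpsi He) as (n & d & Hd).
  set (mu := fun j => INR (S j) * mu0).
  (* The error is 0: the Dirichlet values are matched exactly, and only the Weierstrass error
     remains. *)
  destruct (heat_limit_csum (fun x t => x = - b \/ x = b)
    (fun j x t => (kappa x * d j * RtoC (exp (mu j * (t - tau))))%C) 0 n) as (w & Lw & Bw).
  { intros j. set (k := sqrt (mu j)).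
    assert (MJ : mu0 <= mu j).
    { unfold mu. rewrite S_INR. pose proof (pos_INR j). nra. }
    assert (Kk : k1 <= k).
    { unfold k. rewrite <- (sqrt_square k1) by lra. apply sqrt_le_1_alt. exact MJ. }
    assert (Ek : (RtoC k * RtoC k)%C = RtoC (mu j)).
    { rewrite <- RtoC_mult. f_equal. apply sqrt_sqrt. lra. }
    assert (Ck : Cmod (RtoC k) = k) by (rewrite Cmod_R; apply Rabs_pos_eq; lra).
    assert (K0 : RtoC k <> RtoC 0) by (intros E; apply RtoC_inj in E; lra).
    assert (Gk : off_spectrum b (RtoC k)).
    { left. simpl. rewrite Rabs_pos_eq by lra.
      apply Rle_trans with (2 * b * (1 / (2 * b))); [right; field; lra|].
      apply Rmult_le_compat_l; lra. }
    destruct (dirichlet_solvable b hb q F F1 m HF Q HQ (RtoC k)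
      (kappa (- b)%R * d j * RtoC (exp (- (mu j * tau))))%C (kappa b * d j * RtoC (exp (- (mu j * tau))))%C
      K0 Gk ltac:(lra)) as (A & A' & El & Er).
    rewrite Ek in El, Er.
    exists (heat_series F (RtoC (mu j)) (homogeneous F A A')). split; [apply heat_series_limit|].
    intros x t Hx.
    rewrite (heat_series_R _ _ _ _ _ HF _ _ _ x t (homogeneous_cosh_bounded _ _ _ _ _ HF A A')).
    assert (E : neumann F (RtoC (mu j)) (homogeneous F A A') x
      = (kappa x * d j * RtoC (exp (- (mu j * tau))))%C) by (destruct Hx as [-> | ->]; auto).
    rewrite E. replace (mu j * (t - tau)) with (mu j * t + - (mu j * tau)) by ring.
    rewrite exp_plus, RtoC_mult.
    match goal with |- Cmod ?z' <= _ => replace z' with (RtoC 0) by ring end. rewrite Cmod_0. lra. }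
  exists w. split; auto. intros x t Hx Ht. specialize (Bw x t Hx). rewrite Rmult_0_r in Bw.
  set (s := exp (mu0 * (t - tau))).
  assert (Hs : s0 <= s <= 1).
  { unfold s, s0. split; [apply exp_le; nra|]. rewrite <- exp_0. apply exp_le. nra. }
  specialize (Hd s ltac:(lra)).
  assert (Ps : (RtoC s * psi s)%C = l t).
  { unfold psi. rewrite Rmax_right by lra. unfold s at 2. rewrite ln_exp.
    replace (tau + / mu0 * (mu0 * (t - tau))) with t by (field; lra).
    field. intros E. apply RtoC_inj in E. lra. }
  assert (Es : sum_n (fun j => (kappa x * d j * RtoC (exp (mu j * (t - tau))))%C) n
    = (kappa x * (RtoC s * cpoly d n s))%C).
  { unfold cpoly. rewrite <- !csum_scal. apply csum_ext. intros j _.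
    assert (E : exp (mu j * (t - tau)) = s * s ^ j).
    { change (s * s ^ j) with (s ^ S j). unfold s. rewrite exp_pow_nat. f_equal. unfold mu. ring. }
    rewrite E, RtoC_mult. cring. }
  rewrite Es in Bw.
  assert (Kx : Cmod (kappa x) <= 1) by (destruct Hx as [-> | ->]; auto).
  replace (w x t - kappa x * l t)%C with
    ((w x t - kappa x * (RtoC s * cpoly d n s)) + - (kappa x * (RtoC s * (psi s - cpoly d n s))))%C.
  - eapply Rle_trans; [apply Cmod_triangle|]. rewrite Cmod_opp, !Cmod_mult, Cmod_R, Rabs_pos_eq by lra.
    pose proof (Cmod_ge_0 (kappa x)). pose proof (Cmod_ge_0 (psi s - cpoly d n s)%C).
    assert (s * Cmod (psi s - cpoly d n s)%C <= eps) by nra.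
    assert (0 <= s * Cmod (psi s - cpoly d n s)%C) by nra. nra.
  - rewrite <- Ps. ring.
Qed.

End Approximation.

(** ** Transmuted heat polynomials *)

Lemma csum_shift (a : nat -> C) (n : nat) :
  sum_n a (S n) = (a 0%nat + sum_n (fun j => a (S j)) n)%C :> C.
Proof.
  induction n as [|n IH].
  - now rewrite sum_n_S_C, !sum_n_0_C.
  - rewrite sum_n_S_C, IH, (sum_n_S_C _ n). ring.
Qed.

Lemma prim_scal (c : C) (h : R -> C) (x : R) : (forall y, continuous h y) ->
  prim (fun y => (c * h y)%C) x = (c * prim h x)%C.
Proof.
  intros Ch. transitivity (prim (fun y => (c * h y + RtoC 0 * h y)%C) x).
  - apply (prim_ext _ _ x (Rabs x)); [lra|]. intros; ring.
  - rewrite prim_lin by auto. ring.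
Qed.

Section Polynomials.

Context (b : R) (hb : 0 < b) (q F F1 : R -> C) (m : R) (HF : nonvanishing_solution b q F F1 m).
Context (f : R -> C) (Ef : forall x, -b <= x <= b -> F x = f x).

Lemma sq_weight_even (n : nat) (s : R) : Nat.even n = true -> -b <= s <= b ->
  sq_weight f n s = (F s * F s)%C.
Proof. intros E Hs. unfold sq_weight. rewrite E, Ef by auto. simpl. ring. Qed.

Lemma sq_weight_odd (n : nat) (s : R) : Nat.even n = false -> -b <= s <= b ->
  sq_weight f n s = inv_sq F s.
Proof.
  intros E Hs. unfold sq_weight, inv_sq. rewrite E, Ef by auto. f_equal. simpl. ring.
Qed.

Lemma even_double (n : nat) : Nat.even (2 * n) = true.
Proof. rewrite Nat.even_mul. reflexivity. Qed.

Lemma even_S_double (n : nat) : Nat.even (S (2 * n)) = false.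
Proof. now rewrite Nat.even_succ, <- Nat.negb_even, even_double. Qed.

Lemma X_succ (n : nat) (x : R) :
  X f (S n) x = (RtoC (INR (S n)) * prim (fun s => X f n s * sq_weight f (S n) s) x)%C.
Proof. reflexivity. Qed.

Lemma Xtilde_succ (n : nat) (x : R) :
  Xtilde f (S n) x = (RtoC (INR (S n)) * prim (fun s => Xtilde f n s * sq_weight f n s) x)%C.
Proof. simpl. rewrite Nat.sub_0_r. reflexivity. Qed.

Lemma RtoC_fact_succ (n : nat) : RtoC (INR (fact (S n))) = (RtoC (INR (S n)) * RtoC (INR (fact n)))%C.
Proof. rewrite <- RtoC_mult, <- mult_INR. reflexivity. Qed.

Lemma in_segment_abs (x : R) : -b <= x <= b -> Rabs x <= b.
Proof. intros; now apply Rabs_le. Qed.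

Lemma abs_in_segment (x : R) : Rabs x <= b -> -b <= x <= b.
Proof. intros; now apply Rabs_le_between. Qed.

(** Two steps of the recursion carry the weights [f^2] and [f^-2] in this order, which is one
    application of [J] after multiplication by [F]. *)
Lemma Xtilde_even (n : nat) (x : R) : -b <= x <= b ->
  (F x * Xtilde f (2 * n) x)%C = (RtoC (INR (fact (2 * n))) * Jn F n F x)%C.
Proof.
  pose proof (nvs_F _ _ _ _ _ HF) as CF.
  revert x. induction n as [|n IH]; intros x Hx.
  - simpl. ring.
  - replace (2 * S n)%nat with (S (S (2 * n))) by lia.
    assert (CJ := Jn_continuous _ _ _ _ _ HF F n CF).
    assert (O : forall y, -b <= y <= b -> Xtilde f (S (2 * n)) y
      = (RtoC (INR (fact (S (2 * n)))) * prim (fun r => F r * Jn F n F r) y)%C).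
    { intros y Hy. rewrite Xtilde_succ, RtoC_fact_succ, <- Cmult_assoc. apply (f_equal (Cmult _)).
      rewrite <- prim_scal by (now apply (Fh_continuous _ _ _ _ _ HF)).
      apply (prim_ext _ _ y b); [now apply in_segment_abs|]. intros s Hs. apply abs_in_segment in Hs.
      rewrite sq_weight_even by (auto; apply even_double).
      transitivity (F s * (F s * Xtilde f (2 * n) s))%C; [ring|]. rewrite IH by auto. ring. }
    rewrite Xtilde_succ, (RtoC_fact_succ (S (2 * n))).
    change (Jn F (S n) F x) with (J F (Jn F n F) x). unfold J.
    transitivity (F x * (RtoC (INR (S (S (2 * n)))) * (RtoC (INR (fact (S (2 * n)))) *
      prim (fun s => inv_sq F s * prim (fun r => F r * Jn F n F r) s) x)))%C; [|ring].
    apply (f_equal (Cmult _)), (f_equal (Cmult _)).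
    rewrite <- prim_scal by (now apply (J_inner_continuous _ _ _ _ _ HF)).
    apply (prim_ext _ _ x b); [now apply in_segment_abs|]. intros s Hs. apply abs_in_segment in Hs.
    rewrite sq_weight_odd by (auto; apply even_S_double). rewrite O by auto. ring.
Qed.

(** The same pairing of weights, started one step later: the first integral of [f^-2] times [F] is
    the second solution. *)
Lemma X_odd (n : nat) (x : R) : -b <= x <= b ->
  (F x * X f (S (2 * n)) x)%C = (RtoC (INR (fact (S (2 * n)))) * Jn F n (second_solution F) x)%C.
Proof.
  pose proof (second_solution_solves _ _ _ _ _ HF) as [CP _].
  revert x. induction n as [|n IH]; intros x Hx.
  - rewrite X_succ. simpl. unfold second_solution.
    transitivity (F x * prim (inv_sq F) x)%C; [|ring].
    transitivity (F x * prim (fun s => RtoC 1 * sq_weight f 1 s)%C x)%C; [ring|].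
    apply (f_equal (Cmult _)). apply (prim_ext _ _ x b); [now apply in_segment_abs|].
    intros s Hs. apply abs_in_segment in Hs. rewrite sq_weight_odd by auto. ring.
  - assert (CJ := Jn_continuous _ _ _ _ _ HF _ n CP).
    replace (2 * S n)%nat with (S (S (2 * n))) by lia. set (k := S (2 * n)) in *.
    assert (Ek : Nat.even (S k) = true) by (unfold k; rewrite Nat.even_succ_succ; apply even_double).
    assert (O : forall y, -b <= y <= b -> X f (S k) y
      = (RtoC (INR (fact (S k))) * prim (fun r => F r * Jn F n (second_solution F) r) y)%C).
    { intros y Hy. rewrite X_succ, RtoC_fact_succ, <- Cmult_assoc. apply (f_equal (Cmult _)).
      rewrite <- prim_scal by (now apply (Fh_continuous _ _ _ _ _ HF)).
      apply (prim_ext _ _ y b); [now apply in_segment_abs|]. intros s Hs. apply abs_in_segment in Hs.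
      rewrite sq_weight_even by auto.
      transitivity (F s * (F s * X f k s))%C; [ring|]. rewrite IH by auto. ring. }
    rewrite X_succ, (RtoC_fact_succ (S k)).
    change (Jn F (S n) (second_solution F) x) with (J F (Jn F n (second_solution F)) x). unfold J.
    transitivity (F x * (RtoC (INR (S (S k))) * (RtoC (INR (fact (S k))) *
      prim (fun s => inv_sq F s * prim (fun r => F r * Jn F n (second_solution F) r) s) x)))%C; [|ring].
    apply (f_equal (Cmult _)), (f_equal (Cmult _)).
    rewrite <- prim_scal by (now apply (J_inner_continuous _ _ _ _ _ HF)).
    apply (prim_ext _ _ x b); [now apply in_segment_abs|]. intros s Hs. apply abs_in_segment in Hs.
    rewrite sq_weight_odd; [rewrite O by auto; ring | | auto].
    unfold k. rewrite Nat.even_succ_succ. apply even_S_double.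
Qed.

Lemma transmuted_even (n : nat) (x t : R) : -b <= x <= b ->
  transmuted_heat_poly f (2 * n) x t = (RtoC (INR (fact (2 * n))) * heat F F n x t)%C.
Proof.
  intros Hx. unfold transmuted_heat_poly.
  replace (2 * n / 2)%nat with n by (symmetry; rewrite Nat.mul_comm; apply Nat.div_mul; lia).
  apply (f_equal (Cmult _)). unfold heat, conv. apply csum_ext. intros j Hj.
  replace (2 * n - 2 * j)%nat with (2 * (n - j))%nat by lia.
  unfold formal_power. rewrite <- Nat.negb_even, even_double. simpl negb. cbv iota.
  rewrite <- Ef by auto. rewrite Xtilde_even by auto.
  rewrite RtoC_div by apply INR_fact_neq_0. field. split; apply RtoC_fact_neq0.
Qed.

Lemma transmuted_odd (n : nat) (x t : R) : -b <= x <= b ->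
  transmuted_heat_poly f (S (2 * n)) x t
    = (RtoC (INR (fact (S (2 * n)))) * heat F (second_solution F) n x t)%C.
Proof.
  intros Hx. unfold transmuted_heat_poly.
  replace (S (2 * n) / 2)%nat with n by (apply (Nat.div_unique _ 2 n 1); lia).
  apply (f_equal (Cmult _)). unfold heat, conv. apply csum_ext. intros j Hj.
  replace (S (2 * n) - 2 * j)%nat with (S (2 * (n - j)))%nat by lia.
  unfold formal_power. rewrite <- Nat.negb_even, even_S_double. simpl negb. cbv iota.
  rewrite <- Ef by auto. rewrite X_odd by auto.
  rewrite RtoC_div by apply INR_fact_neq_0. field. split; apply RtoC_fact_neq0.
Qed.

Lemma csum_pairs (g : nat -> C) (N : nat) :
  sum_n g (S (2 * N)) = sum_n (fun n => (g (2 * n)%nat + g (S (2 * n)))%C) N :> C.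
Proof.
  induction N as [|N IH].
  - rewrite sum_n_S_C, !sum_n_0_C. reflexivity.
  - rewrite (sum_n_S_C _ N). assert (E : (2 * S N = S (S (2 * N)))%nat) by lia. rewrite !E.
    rewrite (sum_n_S_C g (S (S (2 * N)))), (sum_n_S_C g (S (2 * N))), IH. ring.
Qed.

Lemma heat_comb_transmuted (a c : nat -> C) (N : nat) : exists d : nat -> C,
  forall x t, -b <= x <= b ->
  heat_comb F a c N x t = sum_n (fun n => (d n * transmuted_heat_poly f n x t)%C) (S (2 * N)).
Proof.
  exists (fun n => ((if Nat.even n then a (Nat.div2 n) else c (Nat.div2 n)) / RtoC (INR (fact n)))%C).
  intros x t Hx. rewrite csum_pairs. unfold heat_comb. apply csum_ext. intros n _.
  rewrite even_double, even_S_double, transmuted_even, transmuted_odd by auto.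
  rewrite Nat.div2_double, Nat.div2_succ_double.
  set (k := fact (2 * n)). set (l := fact (S (2 * n))).
  change ((a n * heat F F n x t + c n * heat F (second_solution F) n x t)%C =
    (a n / RtoC (INR k) * (RtoC (INR k) * heat F F n x t) +
     c n / RtoC (INR l) * (RtoC (INR l) * heat F (second_solution F) n x t))%C).
  field. split; apply RtoC_fact_neq0.
Qed.

Lemma continuous_heat (h : R -> C) (n : nat) (p : R * R) : (forall y, continuous h y) ->
  continuous (fun p : R * R => heat F h n (fst p) (snd p)) p.
Proof.
  intros Ch. unfold heat, conv.
  apply (continuous_csum (U := prod_UniformSpace R_UniformSpace R_UniformSpace)
    (fun j p => (RtoC (snd p ^ j / INR (fact j)) * Jn F (n - j) h (fst p))%C)).
  intros j. apply continuous_Cmult.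
  - apply continuous_RtoC.
    apply (continuous_Rcomp (U := prod_UniformSpace R_UniformSpace R_UniformSpace)
      (fun p => snd p) (fun s => s ^ j / INR (fact j))).
    + apply (continuous_snd (U := R_UniformSpace) (V := R_UniformSpace)).
    + apply derivable_continuous_pt, ex_derive_Reals_0. auto_derive; auto.
  - apply (continuous_comp (fun p : R * R => fst p) (Jn F (n - j) h)).
    + apply (continuous_fst (U := R_UniformSpace) (V := R_UniformSpace)).
    + now apply (Jn_continuous _ _ _ _ _ HF).
Qed.

Lemma continuous_heat_span (v : R -> R -> C) (p : R * R) : heat_span F v ->
  continuous (fun p : R * R => v (fst p) (snd p)) p.
Proof.
  intros (N & a & c & E).
  apply (continuous_C_ext (fun p : R * R => heat_comb F a c N (fst p) (snd p))); [intros; now rewrite E|].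
  apply (continuous_csum (U := prod_UniformSpace R_UniformSpace R_UniformSpace)
    (fun n p => (a n * heat F F n (fst p) (snd p) + c n * heat F (second_solution F) n (fst p) (snd p))%C)).
  intros n. apply continuous_Cplus; apply continuous_Cmult; try apply continuous_const;
  apply continuous_heat.
  - apply (nvs_F _ _ _ _ _ HF).
  - intros y. apply (second_solution_solves _ _ _ _ _ HF).
Qed.

(** The operator [y'' - q y] lowers the power of [J] by one and annihilates [h] itself. *)
Definition Jn_rhs (h : R -> C) (k : nat) (x : R) : C :=
  match k with O => RtoC 0 | S i => Jn F i h x end.

Lemma Jn_solves (h : R -> C) (k : nat) : solves b q (fun _ => RtoC 0) h ->
  solves b q (Jn_rhs h k) (Jn F k h).
Proof.
  intros Sh. destruct k as [|k]; [exact Sh|].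
  apply (J_solves _ _ _ _ _ HF). apply (Jn_continuous _ _ _ _ _ HF). apply Sh.
Qed.

Lemma solves_csum (c : nat -> C) (r y : nat -> R -> C) (n : nat) :
  (forall j, (j <= n)%nat -> solves b q (r j) (y j)) ->
  solves b q (fun x => sum_n (fun j => (c j * r j x)%C) n) (fun x => sum_n (fun j => (c j * y j x)%C) n).
Proof.
  induction n as [|n IH]; intros H.
  - pose proof (H 0%nat (le_n _)) as H0. generalize (solves_lin b q (c 0%nat) (RtoC 0) _ _ _ _ H0 H0).
    apply solves_ext; intros x; rewrite sum_n_0_C; ring.
  - generalize (solves_lin b q (RtoC 1) (c (S n)) _ _ _ _ (IH (fun j Hj => H j (le_S _ _ Hj))) (H (S n) (le_n _))).
    apply solves_ext; intros x; rewrite sum_n_S_C; ring.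
Qed.

(** In each term the space operator lowers the power of [J] and the time derivative lowers the power
    of [t]; after a shift of the index both give the same sum [r]. *)
Lemma heat_interior_solution (tau : R) (h : R -> C) (n : nat) :
  solves b q (fun _ => RtoC 0) h -> interior_solution b tau q (heat F h n).
Proof.
  intros Sh x t Hx Ht.
  destruct (solves_csum (fun j => RtoC (t ^ j / INR (fact j))) (fun j => Jn_rhs h (n - j))
    (fun j => Jn F (n - j) h) n) as [_ [v1 [_ D]]].
  { intros j _. now apply Jn_solves. }
  set (r := sum_n (fun j => (RtoC (t ^ j / INR (fact j)) * Jn_rhs h (n - j) x)%C) n : C).
  exists v1, (q x * heat F h n x t + r)%C, r. refine (conj _ (conj _ (conj _ _))).
  - intros y Hy. apply (D y Hy).
  - apply (D x Hx).
  - set (da := fun j => match j with O => RtoC 0 | S i => RtoC (t ^ i / INR (fact i)) end).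
    assert (E : r = sum_n (fun j => (da j * Jn F (n - j) h x)%C) n).
    { unfold r. destruct n as [|n].
      - rewrite !sum_n_0_C. simpl. ring.
      - rewrite sum_n_S_C, Nat.sub_diag, csum_shift. simpl Jn_rhs at 2. simpl (da 0%nat).
        rewrite (csum_ext (fun j => (RtoC (t ^ j / INR (fact j)) * Jn_rhs h (S n - j) x)%C)
          (fun j => (da (S j) * Jn F (S n - S j) h x)%C)).
        + ring.
        + intros j Hj. rewrite Nat.sub_succ_l by lia. reflexivity. }
    rewrite E. unfold heat, conv.
    apply (Cder_csum (fun j s => (RtoC (s ^ j / INR (fact j)) * Jn F (n - j) h x)%C)).
    intros j.
    assert (Dj : Cder (fun s => RtoC (s ^ j / INR (fact j))) t (da j)).
    { destruct j as [|j].
      - apply (Cder_ext (fun _ => RtoC (1 / 1)) _ _ (RtoC 0)); try reflexivity. apply Cder_const.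
      - apply Cder_RtoC. unfold da. auto_derive; auto.
        change (fact j + j * fact j)%nat with (fact (S j)).
        change (match j with O => 1 | S _ => INR j + 1 end) with (INR (S j)).
        rewrite fact_simpl, mult_INR. field.
        split; [apply INR_fact_neq_0 | apply not_0_INR; lia]. }
    generalize (Cder_mult _ _ _ _ _ Dj (Cder_const (Jn F (n - j) h x) t)).
    apply Cder_ext; [reflexivity | ring].
  - ring.
Qed.

Lemma interior_solution_lin (tau : R) (k l : C) (v w : R -> R -> C) :
  interior_solution b tau q v -> interior_solution b tau q w ->
  interior_solution b tau q (fun x t => (k * v x t + l * w x t)%C).
Proof.
  intros Hv Hw x t Hx Ht.
  destruct (Hv x t Hx Ht) as (v1 & v2 & vt & V1 & V2 & V3 & V4).
  destruct (Hw x t Hx Ht) as (w1 & w2 & wt & W1 & W2 & W3 & W4).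
  exists (fun y => (k * v1 y + l * w1 y)%C), (k * v2 + l * w2)%C, (k * vt + l * wt)%C.
  refine (conj _ (conj _ (conj _ _))).
  - intros y Hy. apply Cder_plus; apply Cder_scal; auto.
  - apply Cder_plus; apply Cder_scal; auto.
  - apply (Cder_plus (fun s => (k * v x s)%C) (fun s => (l * w x s)%C)); apply Cder_scal; auto.
  - rewrite <- V4, <- W4. ring.
Qed.

Lemma interior_solution_ext (tau : R) (v w : R -> R -> C) :
  (forall x t, -b < x < b -> 0 < t < tau -> v x t = w x t) ->
  interior_solution b tau q v -> interior_solution b tau q w.
Proof.
  intros E Hv x t Hx Ht. destruct (Hv x t Hx Ht) as (v1 & v2 & vt & V1 & V2 & V3 & V4).
  exists v1, v2, vt. refine (conj _ (conj V2 (conj _ _))).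
  - intros y Hy. apply (Cder_ext_interval (fun z => v z t) _ (- b) b); auto.
  - apply (Cder_ext_interval (fun s => v x s) _ 0 tau); auto.
  - rewrite <- E; auto.
Qed.

Lemma heat_span_interior_solution (tau : R) (v : R -> R -> C) :
  heat_span F v -> interior_solution b tau q v.
Proof.
  intros (N & a & c & E). apply (interior_solution_ext tau (heat_comb F a c N)); [auto|].
  clear E v.
  pose proof (fun n => heat_interior_solution tau F n (F_solves _ _ _ _ _ HF)) as I1.
  pose proof (fun n => heat_interior_solution tau _ n (second_solution_solves _ _ _ _ _ HF)) as I2.
  induction N as [|N IH].
  - apply (interior_solution_ext tau (fun x t => (a 0%nat * heat F F 0 x t + c 0%nat * heat F (second_solution F) 0 x t)%C)).
    + intros. unfold heat_comb. now rewrite sum_n_0_C.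
    + now apply interior_solution_lin.
  - apply (interior_solution_ext tau (fun x t => (RtoC 1 * heat_comb F a c N x t + RtoC 1 *
      (a (S N) * heat F F (S N) x t + c (S N) * heat F (second_solution F) (S N) x t))%C)).
    + intros. unfold heat_comb. rewrite sum_n_S_C. ring.
    + apply interior_solution_lin; [exact IH | now apply interior_solution_lin].
Qed.

End Polynomials.

(** ** Extension from the closed domain *)

Lemma continuous_on_comp {T U V : UniformSpace} (D : U -> Prop) (g : U -> V) (c : T -> U) (x : T) :
  continuous_on D g -> (forall y, D (c y)) -> continuous c x -> continuous (fun y => g (c y)) x.
Proof.
  intros Cg Dc Cc P HP. specialize (Cg (c x) (Dc x) P HP). specialize (Cc _ Cg).
  unfold filtermap in *. revert Cc. apply filter_imp. intros y Hy. now apply Hy.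
Qed.

Lemma is_derive_within_continuous_on (D : R -> Prop) (g l : R -> C) :
  (forall x, D x -> is_derive_within D g x (l x)) -> continuous_on D g.
Proof.
  intros H x Dx.
  apply (filterdiff_continuous_aux (K := R_AbsRing) (U := R_NormedModule) (V := C_R_NormedModule)).
  - eexists. apply (H x Dx).
  - intros P HP. unfold within. revert HP. now apply filter_imp.
Qed.

Lemma is_derive_within_interior (D : R -> Prop) (g : R -> C) (x : R) (l : C) :
  locally x D -> is_derive_within D g x l -> Cder g x l.
Proof.
  intros HD [L H]. split; [exact L|]. intros z Hz.
  assert (Hz' : is_filter_lim (within D (locally x)) z).
  { intros P HP. specialize (Hz P HP). unfold within. revert Hz. now apply filter_imp. }
  intros e. generalize (filter_and _ _ HD (H z Hz' e)). apply filter_imp. intros y [A B]. auto.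
Qed.

Lemma clamp_extension (b : R) (g : R -> C) (x : R) : 0 < b ->
  continuous_on (segment b) g -> continuous (fun y => g (clamp (- b) b y)) x.
Proof.
  intros Hb Cg. apply (continuous_on_comp (segment b) g); auto.
  - intros y. apply clamp_in. lra.
  - apply clamp_continuous. lra.
Qed.

Lemma clamp_extension_bounded (b : R) (g : R -> C) : 0 < b ->
  continuous_on (segment b) g -> exists M, forall x, Cmod (g (clamp (- b) b x)) <= M.
Proof.
  intros Hb Cg.
  destruct (continuity_ab_maj (fun x => Cmod (g (clamp (- b) b x))) (- b) b) as [xm [Hm _]]; [lra| |].
  { intros x _. apply continuity_pt_filterlim.
    apply (continuous_Cmod (fun x => g (clamp (- b) b x))). now apply clamp_extension. }
  exists (Cmod (g (clamp (- b) b xm))). intros x.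
  pose proof (clamp_in (- b) b x ltac:(lra)) as I. specialize (Hm _ I). cbv beta in Hm.
  rewrite (clamp_id (- b) b (clamp (- b) b x)) in Hm by auto. exact Hm.
Qed.

(** Clamping preserves continuity and nonvanishing, and compactness of the segment supplies the
    bounds. The clamped [f1] is a derivative only inside, which is all the record asks. *)
Lemma nonvanishing_extension (b : R) (q : R -> C) (alpha : C) (f : R -> C) : 0 < b ->
  continuous_on (segment b) q -> ode_solution b q alpha f ->
  (forall x, segment b x -> f x <> RtoC 0) ->
  exists F1 m, nonvanishing_solution b (fun x => q (clamp (- b) b x)) (fun x => f (clamp (- b) b x)) F1 m.
Proof.
  intros Hb Hq (f1 & f2 & D1 & D2 & Eq & _) Hf.
  assert (Cf : continuous_on (segment b) f) by (now apply (is_derive_within_continuous_on _ _ f1)).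
  assert (Cf1 : continuous_on (segment b) f1) by (now apply (is_derive_within_continuous_on _ _ f2)).
  assert (Seg : forall x, segment b (clamp (- b) b x)) by (intros; apply clamp_in; lra).
  assert (CF : forall x, continuous (fun y => f (clamp (- b) b y)) x) by (intros; now apply clamp_extension).
  destruct (clamp_extension_bounded b f Hb Cf) as [M1 H1].
  destruct (continuity_ab_maj (fun x => Cmod (/ (f (clamp (- b) b x) * f (clamp (- b) b x)))%C) (- b) b)
    as [xm [Hm _]]; [lra| |].
  { intros x _. apply continuity_pt_filterlim.
    apply (continuous_Cmod (fun x => (/ (f (clamp (- b) b x) * f (clamp (- b) b x)))%C)).
    apply continuous_Cinv; [apply Cmult_neq_0; auto | now apply continuous_Cmult]. }
  set (M2 := Cmod (/ (f (clamp (- b) b xm) * f (clamp (- b) b xm)))%C) in *.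
  exists (fun x => f1 (clamp (- b) b x)), (Rmax M1 M2).
  assert (Nb : forall x, -b < x < b -> locally x (segment b)).
  { intros x Hx.
    assert (O : locally x (fun y => -b < y < b))
      by (apply (open_and (fun y : R => -b < y) (fun y : R => y < b)); auto using open_gt, open_lt).
    revert O. apply filter_imp. intros y Hy. split; lra. }
  split; auto.
  - intros; now apply clamp_extension.
  - intros; now apply clamp_extension.
  - intros x. eapply Rle_trans; [apply H1 | apply Rmax_l].
  - intros x. eapply Rle_trans; [|apply Rmax_r].
    pose proof (clamp_in (- b) b x ltac:(lra)) as I. specialize (Hm _ I). cbv beta in Hm.
    rewrite (clamp_id (- b) b (clamp (- b) b x)) in Hm by auto. exact Hm.
  - intros x Hx. rewrite (clamp_id (- b) b x) by lra.
    apply (Cder_ext_interval f _ (- b) b); auto.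
    + intros y Hy. now rewrite clamp_id by lra.
    + apply (is_derive_within_interior (segment b)); auto. apply D1. split; lra.
  - intros x Hx. rewrite !(clamp_id (- b) b x) by lra.
    apply (Cder_ext_interval f1 _ (- b) b); auto.
    + intros y Hy. now rewrite clamp_id by lra.
    + assert (Sx : segment b x) by (split; lra).
      generalize (is_derive_within_interior (segment b) _ _ _ (Nb x Hx) (D2 x Sx)).
      apply Cder_ext; [reflexivity|].
      replace (f2 x) with ((f2 x - q x * f x) + q x * f x)%C by ring. rewrite Eq by auto. ring.
Qed.

Lemma clamp_solution (b tau : R) (q : R -> C) (u : R -> R -> C) : 0 < b -> 0 < tau ->
  classical_solution b tau q u ->
  interior_solution b tau (fun x => q (clamp (- b) b x)) (fun x t => u (clamp (- b) b x) (clamp 0 tau t)).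
Proof.
  intros Hb Htau (ux & uxx & ut & D & _ & _ & Eq).
  apply (interior_solution_ext b _ tau u).
  - intros x t Hx Ht. now rewrite !clamp_id by lra.
  - intros x t Hx Ht. assert (O : Omega b tau (x, t)) by (split; auto).
    exists (fun y => ux y t), (uxx x t), (ut x t). destruct (D x t O) as (A & B & E).
    refine (conj _ (conj B (conj E _))).
    + intros y Hy. apply D. split; auto.
    + rewrite clamp_id by lra. now apply Eq.
Qed.

Lemma clamp_continuous_2d (b tau : R) (u : R -> R -> C) (p : R * R) : 0 < b -> 0 < tau ->
  continuous_on (Omega_bar b tau) (fun p : R * R => u (fst p) (snd p)) ->
  continuous (fun p : R * R => u (clamp (- b) b (fst p)) (clamp 0 tau (snd p))) p.
Proof.
  intros Hb Htau Cu.
  apply (continuous_on_comp (T := prod_UniformSpace R_UniformSpace R_UniformSpace)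
    (U := prod_UniformSpace R_UniformSpace R_UniformSpace)
    (Omega_bar b tau) (fun p : R * R => u (fst p) (snd p))
    (fun p => (clamp (- b) b (fst p), clamp 0 tau (snd p)))); auto.
  - intros y. split; simpl; apply clamp_in; lra.
  - apply continuous_pair_C.
    + apply (continuous_comp (fun p : R * R => fst p) (clamp (- b) b)).
      apply (continuous_fst (U := R_UniformSpace) (V := R_UniformSpace)). apply clamp_continuous. lra.
    + apply (continuous_comp (fun p : R * R => snd p) (clamp 0 tau)).
      apply (continuous_snd (U := R_UniformSpace) (V := R_UniformSpace)). apply clamp_continuous. lra.
Qed.

(** ** Density on the parabolic boundary *)

Lemma twice_differentiable_lin (k l : C) (g h : R -> C) :
  twice_differentiable g -> twice_differentiable h ->
  twice_differentiable (fun x => (k * g x + l * h x)%C).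
Proof.
  intros (g1 & g2 & G1 & G2 & G3) (h1 & h2 & H1 & H2 & H3).
  exists (fun x => (k * g1 x + l * h1 x)%C), (fun x => (k * g2 x + l * h2 x)%C).
  refine (conj _ (conj _ _)); intros x.
  - apply Cder_plus; apply Cder_scal; auto.
  - apply Cder_plus; apply Cder_scal; auto.
  - apply continuous_Cplus; apply continuous_Cmult; auto using continuous_const.
Qed.

Lemma twice_differentiable_affine_pow (c d : R) (j : nat) :
  twice_differentiable (fun x => RtoC ((c * x + d) ^ j)).
Proof.
  (* The default [pred 0 = 0] is harmless, since the factor [INR j] or [INR (pred j)] vanishes with
     it. *)
  exists (fun x => RtoC (INR j * c * (c * x + d) ^ pred j)),
    (fun x => RtoC (INR j * c * (INR (pred j) * c * (c * x + d) ^ pred (pred j)))).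
  assert (D : forall n x, is_derive (fun x => (c * x + d) ^ n) x (INR n * c * (c * x + d) ^ pred n)).
  { intros n x. auto_derive; auto. ring. }
  refine (conj _ (conj _ _)); intros x.
  - apply Cder_RtoC, D.
  - apply Cder_RtoC. apply (is_derive_scal (fun x => (c * x + d) ^ pred j)). apply D.
  - apply continuous_RtoC, (ex_derive_continuous (V := R_NormedModule)). auto_derive. auto.
Qed.

Lemma twice_differentiable_cpoly (e : nat -> C) (n : nat) (c d : R) :
  twice_differentiable (fun x => cpoly e n (c * x + d)).
Proof.
  assert (X : forall g h : R -> C, (forall x, g x = h x) -> twice_differentiable g -> twice_differentiable h).
  { intros g h E (g1 & g2 & G1 & G2 & G3). exists g1, g2. refine (conj _ (conj G2 G3)).
    intros x. generalize (G1 x). now apply Cder_ext. }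
  unfold cpoly. induction n as [|n IH].
  - generalize (twice_differentiable_lin (e 0%nat) (RtoC 0) _ _
      (twice_differentiable_affine_pow c d 0) (twice_differentiable_affine_pow c d 0)).
    apply X. intros x. rewrite sum_n_0_C. ring.
  - generalize (twice_differentiable_lin (RtoC 1) (e (S n)) _ _ IH (twice_differentiable_affine_pow c d (S n))).
    apply X. intros x. rewrite sum_n_S_C. ring.
Qed.

Section Density.

Context (b : R) (hb : 0 < b) (tau : R) (htau : 0 < tau)
  (q F F1 : R -> C) (m : R) (HF : nonvanishing_solution b q F F1 m).
Context (Q : R) (HQ : forall x, -b <= x <= b -> Cmod (q x) <= Q).

(** The sides are fitted up to [3 * d] before the initial values. The initial error left over is
    then small at the corners, and a function vanishing there is within [5 * d] of it; fitting that
    function hardly disturbs the sides. In total the error is at most [7 * d] at time 0 and [5 * d]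
    on the sides. *)
Lemma boundary_values_dense (u : R -> R -> C) (d : R) :
  (forall p, continuous (fun p : R * R => u (fst p) (snd p)) p) -> 0 < d ->
  exists p, heat_span F p /\
    forall x t, parabolic_boundary b tau x t -> Cmod (u x t - p x t)%C <= 9 * d.
Proof.
  intros Cu Hd.
  (* Affine functions with sum 1, equal to 1 at one end and 0 at the other; they separate the two
     sides and interpolate end values. *)
  set (kl := fun x => RtoC (- / (2 * b) * x + / 2)). set (kr := fun x => RtoC (/ (2 * b) * x + / 2)).
  assert (El : kl (- b) = RtoC 1 /\ kl b = RtoC 0) by (unfold kl; split; f_equal; field; lra).
  assert (Er : kr (- b) = RtoC 0 /\ kr b = RtoC 1) by (unfold kr; split; f_equal; field; lra).
  destruct El as [El1 El2], Er as [Er1 Er2].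
  assert (K1 : forall x, -b <= x <= b -> Cmod (kl x) <= 1 /\ Cmod (kr x) <= 1).
  { intros x Hx. unfold kl, kr. rewrite !Cmod_R.
    assert (P : 0 < / (2 * b)) by (apply Rinv_0_lt_compat; lra).
    assert (E : / (2 * b) * b = / 2) by (field; lra).
    split; apply Rabs_le; nra. }
  destruct (heat_limit_lateral b hb tau q F F1 m HF Q HQ kl (fun t => u (- b) t) d) as (wl & Ll & Bl); auto.
  { intros t. apply (continuous_slice_t (fun p : R * R => u (fst p) (snd p))), Cu. }
  { apply K1; lra. } { apply K1; lra. }
  destruct (heat_limit_lateral b hb tau q F F1 m HF Q HQ kr (fun t => u b t) d) as (wr & Lr & Br); auto.
  { intros t. apply (continuous_slice_t (fun p : R * R => u (fst p) (snd p))), Cu. }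
  { apply K1; lra. } { apply K1; lra. }
  destruct (heat_limit_lin b tau F (RtoC 1) (RtoC 1) wl wr Ll Lr d Hd) as (p1 & S1 & B1).
  assert (Side : forall x t, x = - b \/ x = b -> 0 <= t <= tau -> Cmod (u x t - p1 x t)%C <= 3 * d).
  { intros x t Hx Ht.
    assert (Hx' : -b <= x <= b) by (destruct Hx; lra).
    replace (u x t - p1 x t)%C with
      ((RtoC 1 * wl x t + RtoC 1 * wr x t - p1 x t) + ((kl x * u (- b)%R t + kr x * u b t - wl x t - wr x t)))%C.
    2:{ destruct Hx as [-> | ->]; rewrite ?El1, ?El2, ?Er1, ?Er2; ring. }
    eapply Rle_trans; [apply Cmod_triangle|].
    replace (kl x * u (- b)%R t + kr x * u b t - wl x t - wr x t)%C with
      (- (wl x t - kl x * u (- b)%R t) + - (wr x t - kr x * u b t))%C by ring.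
    pose proof (Cmod_triangle (- (wl x t - kl x * u (- b)%R t)) (- (wr x t - kr x * u b t))) as T.
    rewrite !Cmod_opp in T.
    pose proof (Bl x t Hx Ht). pose proof (Br x t Hx Ht). pose proof (B1 x t Hx' Ht). lra. }
  set (g0 := fun x => (u x 0 - p1 x 0)%C).
  assert (Cg0 : forall x, continuous g0 x).
  { intros x. apply continuous_Cminus.
    - apply (continuous_slice_x (fun p : R * R => u (fst p) (snd p))), Cu.
    - apply (continuous_slice_x (fun p : R * R => p1 (fst p) (snd p))).
      now apply (continuous_heat_span b q F F1 m HF). }
  destruct (weierstrass (fun s => g0 (2 * b * s - b)) d) as (n & e & He); auto.
  { intros s. apply (continuous_comp (fun s => 2 * b * s - b) g0); auto.
    apply (ex_derive_continuous (V := R_NormedModule)). auto_derive. auto. }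
  (* A polynomial replaces the merely continuous [g0], because [heat_limit_initial] asks for two
     derivatives. *)
  set (P := fun x => cpoly e n (/ (2 * b) * x + / 2)).
  assert (BP : forall x, -b <= x <= b -> Cmod (g0 x - P x)%C <= d).
  { intros x Hx. assert (P0 : 0 < / (2 * b)) by (apply Rinv_0_lt_compat; lra).
    assert (E : / (2 * b) * b = / 2) by (field; lra).
    specialize (He (/ (2 * b) * x + / 2) ltac:(nra)). cbv beta in He.
    replace (2 * b * (/ (2 * b) * x + / 2) - b) with x in He by (field; lra). exact He. }
  (* Subtracting the affine interpolant of the end values makes [g] vanish at both ends; those
     values are at most [4 * d], from [3 * d] on the sides and [d] for [P]. *)
  set (g := fun x => (RtoC 1 * P x + (- RtoC 1) * (P (- b)%R * kl x + P b * kr x))%C).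
  assert (BPe : Cmod (P (- b)%R) <= 4 * d /\ Cmod (P b) <= 4 * d).
  { assert (A : forall x, x = - b \/ x = b -> Cmod (P x) <= 4 * d).
    { intros x Hx. assert (Hx' : -b <= x <= b) by (destruct Hx; lra).
      replace (P x) with (- (g0 x - P x) + g0 x)%C by ring.
      eapply Rle_trans; [apply Cmod_triangle|]. rewrite Cmod_opp.
      pose proof (BP x Hx'). pose proof (Side x 0 Hx ltac:(lra)). unfold g0 in *. lra. }
    split; apply A; auto. }
  assert (KS : forall x, -b <= x <= b -> Cmod (kl x) + Cmod (kr x) = 1).
  { intros x Hx. unfold kl, kr. rewrite !Cmod_R.
    assert (P0 : 0 < / (2 * b)) by (apply Rinv_0_lt_compat; lra).
    assert (E : / (2 * b) * b = / 2) by (field; lra). rewrite !Rabs_pos_eq by nra. lra. }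
  assert (Bg : forall x, -b <= x <= b -> Cmod (g0 x - g x)%C <= 5 * d).
  { intros x Hx. replace (g0 x - g x)%C with ((g0 x - P x) + (P (- b)%R * kl x + P b * kr x))%C
      by (unfold g; ring).
    eapply Rle_trans; [apply Cmod_triangle|].
    pose proof (Cmod_triangle (P (- b)%R * kl x) (P b * kr x)) as T. rewrite !Cmod_mult in T.
    pose proof (BP x Hx). pose proof (KS x Hx). pose proof (Cmod_ge_0 (kl x)). pose proof (Cmod_ge_0 (kr x)).
    destruct BPe. nra. }
  destruct (heat_limit_initial b hb tau htau q F F1 m HF Q HQ g d) as (w & Lw & Bw); auto.
  { apply twice_differentiable_lin; [apply twice_differentiable_cpoly|].
    apply (twice_differentiable_lin (P (- b)%R) (P b) kl kr);
    unfold kl, kr; [generalize (twice_differentiable_affine_pow (- / (2 * b)) (/ 2) 1)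
      | generalize (twice_differentiable_affine_pow (/ (2 * b)) (/ 2) 1)];
    intros (h1 & h2 & H1 & H2 & H3); exists h1, h2; (refine (conj _ (conj H2 H3)); intros x;
    generalize (H1 x); apply Cder_ext; [intros y; f_equal; ring | reflexivity]). }
  { unfold g. rewrite El1, Er1. ring. }
  { unfold g. rewrite El2, Er2. ring. }
  destruct (Lw d Hd) as (p2 & S2 & B2).
  exists (fun x t => (RtoC 1 * p1 x t + RtoC 1 * p2 x t)%C). split; [now apply heat_span_lin|].
  intros x t Hxt. specialize (Bw x t Hxt).
  assert (Hxt' : -b <= x <= b /\ 0 <= t <= tau)
    by (destruct Hxt as [[? ->] | [[-> | ->] ?]]; lra).
  specialize (B2 x t (proj1 Hxt') (proj2 Hxt')).
  destruct Hxt as [[Hx ->] | [Hx Ht]].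
  - replace (u x 0 - (RtoC 1 * p1 x 0 + RtoC 1 * p2 x 0))%C with
      ((g0 x - g x) + (- (w x 0 - g x) + (w x 0 - p2 x 0)))%C by (unfold g0; ring).
    pose proof (Cmod_triangle (g0 x - g x) (- (w x 0 - g x) + (w x 0 - p2 x 0))) as T1.
    pose proof (Cmod_triangle (- (w x 0 - g x)) (w x 0 - p2 x 0)) as T2. rewrite Cmod_opp in T2.
    pose proof (Bg x Hx). lra.
  - assert (G0 : g x = RtoC 0).
    { unfold g. destruct Hx as [-> | ->]; rewrite ?El1, ?El2, ?Er1, ?Er2; ring. }
    rewrite G0 in Bw.
    replace (u x t - (RtoC 1 * p1 x t + RtoC 1 * p2 x t))%C with
      ((u x t - p1 x t) + (- (w x t - RtoC 0) + (w x t - p2 x t)))%C by ring.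
    pose proof (Cmod_triangle (u x t - p1 x t) (- (w x t - RtoC 0) + (w x t - p2 x t))) as T1.
    pose proof (Cmod_triangle (- (w x t - RtoC 0)) (w x t - p2 x t)) as T2. rewrite Cmod_opp in T2.
    pose proof (Side x t Hx Ht). lra.
Qed.

End Density.

(** * Approximation on the closed rectangle *)

Theorem theorem4p1 (b tau : R) (hb : 0 < b) (htau : 0 < tau)
  (q : R -> C) (hq : continuous_on (segment b) q)
  (alpha : C) (f : R -> C) (hf : ode_solution b q alpha f)
  (hf0 : forall x : R, segment b x -> f x <> RtoC 0)
  (u : R -> R -> C)
  (hu_cont : continuous_on (Omega_bar b tau) (fun p : R * R => u (fst p) (snd p)))
  (hu : classical_solution b tau q u) :
  forall eps : R, 0 < eps ->
  exists (N : nat) (a : nat -> C) (M : R),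
    (1 <= N)%nat /\
    is_max_on (Omega_bar b tau)
      (fun p : R * R =>
         Cmod (u (fst p) (snd p) -
               sum_n (fun n : nat =>
                 a n * transmuted_heat_poly f n (fst p) (snd p)) N)%C) M /\
    M < eps.
Proof.
  intros eps Heps.
  destruct (nonvanishing_extension b q alpha f hb hq hf hf0) as (F1 & m & HF).
  set (F := fun x => f (clamp (- b) b x)) in *. set (qc := fun x => q (clamp (- b) b x)) in *.
  assert (Ef : forall x, -b <= x <= b -> F x = f x) by (intros x Hx; unfold F; now rewrite clamp_id).
  destruct (clamp_extension_bounded b q hb hq) as [Q HQ]. fold qc in HQ.
  set (v := fun x t => u (clamp (- b) b x) (clamp 0 tau t)).
  assert (Cv : forall p, continuous (fun p : R * R => v (fst p) (snd p)) p)
    by (intros p; exact (clamp_continuous_2d b tau u p hb htau hu_cont)).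
  set (E := exp ((Q + 1) * tau)). assert (E0 : 0 < E) by apply exp_pos.
  (* [E] is the constant of the maximum principle and [9 * d] the boundary error, so that their
     product is [eps / 2]. *)
  set (d := eps / (18 * E)). assert (Hd : 0 < d) by (apply Rdiv_lt_0_compat; lra).
  destruct (boundary_values_dense b hb tau htau qc F F1 m HF Q (fun x _ => HQ x) v d Cv Hd)
    as (p & Sp & Bp).
  pose proof Sp as (N & a & c & Ep).
  destruct (heat_comb_transmuted b qc F F1 m HF f Ef a c N) as [e He].
  set (w := fun x t => (RtoC 1 * v x t + (- RtoC 1) * p x t)%C).
  assert (Cw : forall z, continuous (fun z : R * R => w (fst z) (snd z)) z).
  { intros z.
    apply (continuous_Cplus (U := prod_UniformSpace R_UniformSpace R_UniformSpace)
      (fun z => (RtoC 1 * v (fst z) (snd z))%C) (fun z => (- RtoC 1 * p (fst z) (snd z))%C));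
    apply continuous_Cmult; auto using continuous_const.
    now apply (continuous_heat_span b qc F F1 m HF). }
  assert (Iw : interior_solution b tau qc w).
  { apply interior_solution_lin.
    - now apply clamp_solution.
    - now apply (heat_span_interior_solution b qc F F1 m HF). }
  assert (Bw : forall x t, parabolic_boundary b tau x t -> Cmod (w x t) <= 9 * d).
  { intros x t H. specialize (Bp x t H). unfold w.
    replace (RtoC 1 * v x t + - RtoC 1 * p x t)%C with (v x t - p x t)%C by ring. exact Bp. }
  pose proof (maximum_principle b tau qc Q (9 * d) w hb htau (fun x _ => HQ x) Cw Iw) as MP.
  assert (MP' : forall x t, -b <= x <= b -> 0 <= t <= tau -> Cmod (w x t) <= E * (9 * d)).
  { apply MP.
    - intros x Hx. apply Bw. now left.
    - intros t Ht. split; apply Bw; right; auto. }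
  assert (Eq : forall z, Omega_bar b tau z -> Cmod (w (fst z) (snd z)) =
    Cmod (u (fst z) (snd z) - sum_n (fun n : nat =>
                 (e n * transmuted_heat_poly f n (fst z) (snd z))%C) (S (2 * N)))%C).
  { intros [x t] [Hx Ht]; simpl fst in *; simpl snd in *. rewrite <- He, <- Ep by auto.
    unfold w, v. rewrite !clamp_id by auto. f_equal. ring. }
  destruct (rectangle_max (fun z => Cmod (w (fst z) (snd z))) (- b) b 0 tau) as [z0 [Hz0 Hmax]]; try lra.
  { intros z. apply (continuous_Cmod (fun z : R * R => w (fst z) (snd z))), Cw. }
  (* The indices up to [S (2 * N)] consist of the pairs [2 * n], [2 * n + 1] with [n <= N]; the last
     one is at least 1 even for [N = 0]. *)
  exists (S (2 * N)), e, (Cmod (w (fst z0) (snd z0))). refine (conj _ (conj (conj _ _) _)).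
  - lia.
  - exists z0. split; [exact Hz0|]. symmetry. apply Eq. exact Hz0.
  - intros z Hz. rewrite <- Eq by auto. apply Hmax. exact Hz.
  - eapply Rle_lt_trans; [apply MP'; apply Hz0|].
    replace (E * (9 * d)) with (eps / 2) by (unfold d; field; lra). lra.
Qed.
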